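(* Let $T>0$, $d\ge 1$, $x_0\in\mathbb{R}^d$, and let $L=W=(W_t)_{0\le t\le T}$ be a $d$-dimensional Wiener process on a complete probability space $(\Omega,\mathcal{F},\mathbb{P})$. Let $b:[0,T]\times\mathbb{R}^d\to\mathbb{R}^d$ be bounded, $\beta$-Hölder continuous in space with $\beta\in(0,1)$, and $\eta$-Hölder continuous in time with $\eta\in[1/2,1]$, i.e. there exists $K>0$ such that for all $x,y\in\mathbb{R}^d$ and $t,s\in[0,T]$, $$|b(t,x)-b(t,y)|\le K|x-y|^{\beta}\quad\text{and}\quad |b(t,x)-b(s,x)|\le K|t-s|^{\eta}.$$ Let $X=(X_t)_{0\le t\le T}$ be the unique strong solution of $$X_t=x_0+\int_0^t b(s,X_s)\,\mathrm{d}s+W_t,\qquad t\in[0,T],$$ and for $n\in\mathbb{N}$ let $X^{(n)}$ be its Euler-Maruyama approximation $$X^{(n)}_t=x_0+\int_0^t b\big(\eta_n(s),X^{(n)}_{\eta_n(s)}\big)\,\mathrm{d}s+W_t,\qquad t\in[0,T],$$ where $\eta_n(s)=kT/n$ if $s\in[kT/n,(k+1)T/n)$. Then for any $p\ge 1$ there exists a positive constant $C$, depending on $K,M,T,d,p,x_0,\beta,\eta$ and $\|b\|_{C_b^\beta([0,T])}$ (and not on $n$), such that for all $n\in\mathbb{N}$ $$\mathbb{E}\Big[\sup_{0\le t\le T}\big|X_t-X_t^{(n)}\big|^p\Big]\le\frac{C}{n^{p\beta/2}}.$$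
   Context: The norm of $b$ is $\|b\|_{C_b^\beta([0,T])}:=\sup_{t\in[0,T],x\in\mathbb{R}^d}|b(t,x)|+\sup_{t\in[0,T],x\ne y}\frac{|b(t,x)-b(t,y)|}{|x-y|^\beta}$; it is finite under the hypotheses. The constant $M$ (independent of $n$) is the constant in the second-derivative estimate $\|D^2u\|_{C_b^{\beta'}([t_1,t_2])}\le M\|\varphi\|_{C_b^\beta([t_1,t_2])}$, $\beta'\in(0,\beta)$, for the solution $u$ of the backward Kolmogorov equation $\partial_t u+\nabla u\cdot b+\frac12\Delta u=-\varphi$ on $[t_1,t_2]\times\mathbb{R}^d$, $u(t_2,\cdot)=0$, on sufficiently short intervals $[t_1,t_2]\subset[0,T]$; it enters only in the list of quantities on which $C$ may depend. *)

(* Defs.v *)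
From HB Require Import structures.
From mathcomp Require Import all_boot all_order all_algebra.
From mathcomp Require Import all_classical all_reals all_analysis.

Set Implicit Arguments.
Unset Strict Implicit.
Unset Printing Implicit Defensive.

Import Order.TTheory GRing.Theory Num.Theory.
Import numFieldNormedType.Exports.

Local Open Scope classical_set_scope.
Local Open Scope ring_scope.

(* Euclidean norm of a finite family of reals; the library norm on matrices is
   the sup norm.  A vector [x : 'rV_d] is passed as the family [x 0]. *)
Definition enorm (R : realType) (I : finType) (v : I -> R) : R :=
  Num.sqrt (\sum_i v i ^+ 2).

(* The norm of C_b^beta([t1, t2]), an extended real, for functions with values
   in R^I. *)
Definition Cb_norm (R : realType) (d : nat) (I : finType) (beta t1 t2 : R)
    (f : R -> 'rV[R]_d -> I -> R) : \bar R :=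
  (ereal_sup [set r | exists (t : R) (x : 'rV[R]_d),
     (t1 <= t <= t2)%R /\ r = (enorm (f t x))%:E] +
   ereal_sup [set r | exists (t : R) (x y : 'rV[R]_d),
     [/\ (t1 <= t <= t2)%R, x != y &
     r = (enorm (fun i => f t x i - f t y i)
            / enorm ((x - y) 0) `^ beta)%:E]])%E.

Definition bounded_continuous (R : realType) (d : nat) (t1 t2 : R)
    (f : R -> 'rV[R]_d -> 'rV[R]_d) : Prop :=
  {within [set z : R * 'rV[R]_d | t1 <= z.1 <= t2],
     continuous (fun z : R * 'rV[R]_d => f z.1 z.2)} /\
  exists c : R, forall t x, t1 <= t <= t2 -> enorm (f t x 0) <= c.

Definition partial (R : realType) (d : nat) (j : 'I_d)
    (f : 'rV[R]_d -> 'rV[R]_d) (x : 'rV[R]_d) : 'rV[R]_d :=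
  'D_(delta_mx 0 j) f x.

(* [u] is a bounded classical solution on [t1, t2] x R^d of
     d_t u + (grad u) b + 1/2 Laplacian u = - phi,   u(t2, .) = 0,
   read componentwise.  The time derivative at [t] is the limit of difference
   quotients taken inside [t1, t2], hence one-sided at the endpoints. *)
Record kolmogorov_solution (R : realType) (d : nat) (t1 t2 : R)
    (b phi u : R -> 'rV[R]_d -> 'rV[R]_d) : Prop := KolmogorovSolution {
  kolm_bounded : bounded_continuous t1 t2 u;
  kolm_derivable1 : forall j t x, t1 <= t <= t2 ->
    derivable (u t) x (delta_mx 0 j);
  kolm_bounded1 : forall j,
    bounded_continuous t1 t2 (fun t => partial j (u t));
  kolm_derivable2 : forall j k t x, t1 <= t <= t2 ->
    derivable (partial k (u t)) x (delta_mx 0 j);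
  kolm_bounded2 : forall j k,
    bounded_continuous t1 t2 (fun t => partial j (partial k (u t)));
  kolm_eq : forall t x, t1 <= t <= t2 ->
    (s - t)^-1 *: (u s x - u t x) @[s --> within `[t1, t2] t^'] -->
      - phi t x - \sum_j b t x 0 j *: partial j (u t) x
      - 2^-1 *: \sum_j partial j (partial j (u t)) x;
  kolm_final : forall x, u t2 x = 0 }.

Definition hessian (R : realType) (d : nat) (u : R -> 'rV[R]_d -> 'rV[R]_d)
    (t : R) (x : 'rV[R]_d) : 'I_d * 'I_d * 'I_d -> R :=
  fun ijk => partial ijk.1.2 (partial ijk.2 (u t)) x 0 ijk.1.1.

(* [M] is admissible in
     ||D^2 u||_{C_b^beta'([t1, t2])} <= M ||phi||_{C_b^beta([t1, t2])}
   for all beta' in (0, beta) and all sufficiently short [t1, t2] in [0, T]. *)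
Definition second_derivative_bound (R : realType) (d : nat) (T beta : R)
    (b : R -> 'rV[R]_d -> 'rV[R]_d) (M : R) : Prop :=
  0 < M /\ exists2 delta : R, 0 < delta &
    forall (t1 t2 beta' : R) (phi u : R -> 'rV[R]_d -> 'rV[R]_d),
      0 <= t1 -> t1 < t2 -> t2 <= T -> t2 - t1 <= delta ->
      0 < beta' < beta ->
      bounded_continuous t1 t2 phi ->
      (Cb_norm beta t1 t2 (fun t x => phi t x 0%R) < +oo)%E ->
      kolmogorov_solution t1 t2 b phi u ->
      (Cb_norm beta' t1 t2 (hessian u)
         <= M%:E * Cb_norm beta t1 t2 (fun t x => phi t x 0%R))%E.

(* The optimal constant in the estimate.  It is an extended real so that it is
   attached to every [b] without presupposing the estimate itself. *)
Definition second_derivative_const (R : realType) (d : nat) (T beta : R)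
    (b : R -> 'rV[R]_d -> 'rV[R]_d) : \bar R :=
  ereal_inf [set M%:E | M in second_derivative_bound T beta b].

Definition mutually_independent (R : realType) (disp : measure_display)
    (Omega : measurableType disp) (P : probability Omega R) (I : finType)
    (Z : I -> Omega -> R) : Prop :=
  forall (J : {set I}) (A : I -> set R), (forall i, measurable (A i)) ->
    P [set w | forall i, i \in J -> A i (Z i w)] =
    (\prod_(i in J) fine (P (Z i @^-1` A i)))%:E.

(* Joint independence of all scalar increments encodes both the independence of
   increments over disjoint intervals and the diagonal covariance of each
   vector increment.  [normal_prob] takes a standard deviation. *)
Record wiener_process (R : realType) (d : nat) (disp : measure_display)
    (Omega : measurableType disp) (P : probability Omega R) (T : R)
    (W : R -> Omega -> 'rV[R]_d) : Prop := WienerProcess {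
  wiener_measurable : forall t i, 0 <= t <= T ->
    measurable_fun setT (fun w => W t w 0 i);
  wiener_start : {ae P, forall w, W 0 w = 0};
  wiener_independent : forall (m : nat) (t : nat -> R),
    0 <= t 0%N -> (forall k, (k < m)%N -> t k < t k.+1) -> t m <= T ->
    mutually_independent P (fun (ki : 'I_m * 'I_d) w =>
      W (t ki.1.+1) w 0 ki.2 - W (t ki.1) w 0 ki.2);
  wiener_gaussian : forall s t i (A : set R), 0 <= s -> s < t -> t <= T ->
    measurable A ->
    P [set w | A (W t w 0 i - W s w 0 i)] =
    normal_prob 0 (Num.sqrt (t - s)) A;
  wiener_continuous : {ae P, forall w,
    {within `[0, T], continuous (fun t => W t w)}} }.

Definition augmented_filtration (R : realType) (d : nat)
    (disp : measure_display) (Omega : measurableType disp)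
    (P : probability Omega R) (W : R -> Omega -> 'rV[R]_d) (t : R) :
    set (set Omega) :=
  <<s [set A | (exists s i (B : set R), [/\ 0 <= s <= t, measurable B &
                  A = [set w | B (W s w 0 i)]]) \/ P.-negligible A] >>.

Record strong_solution (R : realType) (d : nat) (disp : measure_display)
    (Omega : measurableType disp) (P : probability Omega R) (T : R)
    (x0 : 'rV[R]_d) (b : R -> 'rV[R]_d -> 'rV[R]_d)
    (W X : R -> Omega -> 'rV[R]_d) : Prop := StrongSolution {
  strong_adapted : forall t i (B : set R), 0 <= t <= T -> measurable B ->
    augmented_filtration P W t [set w | B (X t w 0 i)];
  strong_continuous : {ae P, forall w,
    {within `[0, T], continuous (fun t => X t w)}};
  strong_eq : {ae P, forall w, forall t i, 0 <= t <= T ->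
    X t w 0 i = x0 0 i
      + \int[lebesgue_measure]_(s in `[0, t]) (b s (X s w) 0 i)
      + W t w 0 i} }.

Definition eta_n (R : realType) (T : R) (n : nat) (s : R) : R :=
  (Num.truncn (s * n%:R / T))%:R * T / n%:R.

Lemma eta_nE (R : realType) (T : R) (n k : nat) (s : R) :
  0 < T -> (0 < n)%N ->
  k%:R * T / n%:R <= s < k.+1%:R * T / n%:R -> eta_n T n s = k%:R * T / n%:R.
Proof.
move=> T0 n0; have n0' : 0 < n%:R :> R by rewrite ltr0n.
rewrite ler_pdivrMr// ltr_pdivlMr// => /andP[h1 h2].
rewrite /eta_n; congr (_%:R * T / n%:R); apply: truncn_def.
by rewrite ler_pdivlMr// ltr_pdivrMr// h1 h2.
Qed.

(* This determines [Xn] on [0, T] almost surely, by recursion on the grid. *)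
Definition euler_maruyama (R : realType) (d : nat) (disp : measure_display)
    (Omega : measurableType disp) (P : probability Omega R) (T : R)
    (x0 : 'rV[R]_d) (b : R -> 'rV[R]_d -> 'rV[R]_d)
    (W : R -> Omega -> 'rV[R]_d) (n : nat) (Xn : R -> Omega -> 'rV[R]_d) :
    Prop :=
  {ae P, forall w, forall t i, 0 <= t <= T ->
    Xn t w 0 i = x0 0 i
      + \int[lebesgue_measure]_(s in `[0, t])
          (b (eta_n T n s) (Xn (eta_n T n s) w) 0 i)
      + W t w 0 i}.

(* Main.v *)
From HB Require Import structures.
Require Import Defs.
From mathcomp Require Import all_boot all_order all_algebra.
From mathcomp Require Import all_classical all_reals all_analysis.
From mathcomp Require Import measurable_realfun ring lra zify.
Import Order.TTheory GRing.Theory Num.Theory.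
Import numFieldNormedType.Exports.
Set Implicit Arguments.
Unset Strict Implicit.
Unset Printing Implicit Defensive.
Local Open Scope classical_set_scope.
Local Open Scope ring_scope.

(** Write X = W + phi for the solution and Y = W + psi for its Euler approximation.
    The drifts phi and psi are adapted and Lipschitz in time, and X - Y = phi - psi
    =: D is much smoother than X or Y.  The noise between times u and r is Gaussian of
    variance r - u and independent of the past of u; averaged over it, a drift that is
    Hölder of exponent beta becomes Lipschitz, with a constant of order
    (r - u)^((beta - 1)/2), which is integrable at r = u ([smooth_holder_lipschitz],
    [heat_lipschitz]), and its second differences are of order
    (r - u)^(beta/2 - 1), integrable as well ([smooth_second_difference]).

    Stochastic sewing turns this into a bound for the integral over [s, t] of
    b(r, X_r) - b(r, Y_r).  Approximate it on each dyadic block by conditional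
    expectations given the start of the block, the drifts being frozen there.  Halving
    a block changes the approximation by a martingale increment, where only squares
    add up ([martingale_Lp]), and by the effect of moving the frozen drifts, which is
    of higher order ([frozen_drift]).  Summing over all levels ([dyadic_sewing],
    [grid_sewing]) bounds the integral in L^q by
      C (t - s)^((1 + beta)/2) (N + V),
    where N bounds the L^q norm of D and V its Hölder seminorm of exponent 1/2.

    The Euler scheme is driven by b at the last grid point; replacing it by b(r, Y_r)
    costs E of order n^(- beta/2) per unit of time ([consistency_Lp]), because the
    noise moves by n^(- 1/2) over one step.  As (1 + beta)/2 > 1/2, on intervals of a
    fixed short length V is absorbed and is at most N/4 plus a multiple of E; N at
    most doubles from one interval to the next and vanishes at time 0, so
      || D_t - D_s ||_q <= C n^(- beta/2) (t - s)^(1/2)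
    on the whole of [0, T] ([increment_Lp]).  Taking q >= max(4, p), dyadic chaining
    brings the supremum over t inside the norm ([chaining_bound],
    [chaining_sup_Lp]). *)

(** * Expectations of bounded random variables *)

Section expectation.
Context (R : realType) d (T : measurableType d) (P : probability T R).
Implicit Types f g : T -> R.

Definition bmeas f := measurable_fun setT f /\ exists B, forall w, `|f w| <= B.

Definition Ex f : R := \int[P]_w f w.

Lemma bmeas_meas f : bmeas f -> measurable_fun setT f. Proof. by case. Qed.

Lemma bmeasI f B : measurable_fun setT f -> (forall w, `|f w| <= B) -> bmeas f.
Proof. by move=> mf fB; split=> //; exists B. Qed.

Lemma bmeas_cst c : bmeas (fun=> c).
Proof. by apply: (@bmeasI _ `|c|) => //; exact: measurable_cst. Qed.

Lemma bmeasD f g : bmeas f -> bmeas g -> bmeas (fun w => f w + g w).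
Proof.
move=> [mf [B fB]] [mg [C gC]]; apply: (@bmeasI _ (B + C)).
  exact: measurable_funD.
by move=> w; rewrite (le_trans (ler_normD _ _))// lerD.
Qed.

Lemma bmeasN f : bmeas f -> bmeas (fun w => - f w).
Proof.
move=> [mf [B fB]]; apply: (@bmeasI _ B); last by move=> w; rewrite normrN.
exact: measurableT_comp.
Qed.

Lemma bmeasB f g : bmeas f -> bmeas g -> bmeas (fun w => f w - g w).
Proof. by move=> bf bg; apply: bmeasD => //; exact: bmeasN. Qed.

Lemma bmeasM f g : bmeas f -> bmeas g -> bmeas (fun w => f w * g w).
Proof.
move=> [mf [B fB]] [mg [C gC]]; apply: (@bmeasI _ (B * C)).
  exact: measurable_funM.
by move=> w; rewrite normrM ler_pM.
Qed.

Lemma bmeasX f k : bmeas f -> bmeas (fun w => f w ^+ k).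
Proof.
move=> bf; elim: k => [|k ih]; first by rewrite (eq_fun (fun w => expr0 _)); exact: bmeas_cst.
by rewrite (eq_fun (fun w => exprS _ _)); exact: bmeasM.
Qed.

Lemma bmeas_norm f : bmeas f -> bmeas (fun w => `|f w|).
Proof.
move=> [mf [B fB]]; apply: (@bmeasI _ B); last by move=> w; rewrite normr_id.
exact: measurableT_comp.
Qed.

Lemma bmeas_sum (I : Type) (r : seq I) (Q : pred I) (F : I -> T -> R) :
  (forall i, Q i -> bmeas (F i)) -> bmeas (fun w => \sum_(i <- r | Q i) F i w).
Proof.
move=> bF; elim: r => [|i r ih].
  rewrite (_ : (fun w => _) = fun=> 0); first exact: bmeas_cst.
  by apply/funext => w; rewrite big_nil.
have [Qi|nQi] := boolP (Q i); last first.
  by rewrite (eq_fun (fun w => big_cons _ _ _ _ _ _)) (negbTE nQi).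
rewrite (eq_fun (fun w => big_cons _ _ _ _ _ _)) Qi.
by apply: bmeasD => //; exact: bF.
Qed.

Lemma bmeas_integrable f : bmeas f -> P.-integrable setT (EFin \o f).
Proof.
move=> [mf [B fB]]; apply: measurable_bounded_integrable => //.
  by rewrite (le_lt_trans (probability_le1 _ _))// ltry.
by exists B; split => [|x Bx y _ /=]; [exact: num_real|exact: le_trans (fB y) (ltW Bx)].
Qed.

Lemma ExE f : bmeas f -> (Ex f)%:E = (\int[P]_w (f w)%:E)%E.
Proof. by move=> bf; rewrite /Ex fineK//; exact/integrable_fin_num/bmeas_integrable. Qed.

Lemma Ex_cst c : Ex (fun=> c) = c.
Proof.
rewrite /Ex Rintegral_cst//.
by rewrite -[RHS]mulr1; move: (@probability_setT _ _ _ P) => /= ->.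
Qed.

Lemma ExD f g : bmeas f -> bmeas g -> Ex (fun w => f w + g w) = Ex f + Ex g.
Proof. by move=> bf bg; rewrite /Ex RintegralD//; exact: bmeas_integrable. Qed.

Lemma ExB f g : bmeas f -> bmeas g -> Ex (fun w => f w - g w) = Ex f - Ex g.
Proof. by move=> bf bg; rewrite /Ex RintegralB//; exact: bmeas_integrable. Qed.

Lemma ExZ c f : bmeas f -> Ex (fun w => c * f w) = c * Ex f.
Proof. by move=> bf; rewrite /Ex RintegralZl//; exact: bmeas_integrable. Qed.

Lemma Ex_sum (I : Type) (r : seq I) (F : I -> T -> R) :
  (forall i, bmeas (F i)) ->
  Ex (fun w => \sum_(i <- r) F i w) = \sum_(i <- r) Ex (F i).
Proof.
move=> bF; elim: r => [|i r ih].
  by rewrite (eq_fun (fun w => big_nil _ _ _ _)) big_nil Ex_cst.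
rewrite (eq_fun (fun w => big_cons _ _ _ _ _ _)).
by rewrite big_cons ExD ?ih//; exact: bmeas_sum.
Qed.

Lemma le_Ex f g : bmeas f -> bmeas g -> (forall w, f w <= g w) -> Ex f <= Ex g.
Proof. by move=> bf bg fg; apply: le_Rintegral => //; exact: bmeas_integrable. Qed.

Lemma Ex_norm_le f B : bmeas f -> (forall w, `|f w| <= B) -> `|Ex f| <= B.
Proof.
move=> bf fB; rewrite (le_trans (le_normr_Rintegral _ _))//.
  exact: bmeas_integrable.
rewrite -[leRHS](Ex_cst B); apply: le_Ex => //; first exact: bmeas_norm.
exact: bmeas_cst.
Qed.

Lemma eq_Ex f g : f =1 g -> Ex f = Ex g.
Proof. by move=> /funext ->. Qed.

End expectation.

(** * Measurability of continuous functions of random vectors *)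

Section measurable_vector.
Context (R : realType) (n : nat) d (T : measurableType d).

Definition vmeas (Y : T -> 'rV[R]_n) :=
  forall i, measurable_fun setT (fun w => Y w 0 i).

Lemma vmeasD Y Z : vmeas Y -> vmeas Z -> vmeas (fun w => Y w + Z w).
Proof.
move=> mY mZ i; rewrite (_ : (fun w => _) = fun w => Y w 0 i + Z w 0 i).
  exact: measurable_funD.
by apply/funext => w; rewrite mxE.
Qed.

Lemma vmeasN Y : vmeas Y -> vmeas (fun w => - Y w).
Proof.
move=> mY i; rewrite (_ : (fun w => _) = fun w => - Y w 0 i).
  exact: measurableT_comp.
by apply/funext => w; rewrite mxE.
Qed.

Lemma vmeasB Y Z : vmeas Y -> vmeas Z -> vmeas (fun w => Y w - Z w).
Proof. by move=> mY mZ; apply: vmeasD => //; exact: vmeasN. Qed.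

Lemma vmeas_cst c : vmeas (fun=> c).
Proof. by move=> i; exact: measurable_cst. Qed.

(** An open set of row vectors is a countable union of boxes with rational corners,
    and boxes are coordinatewise conditions. *)
Lemma measurable_continuous_vector (g : 'rV[R]_n -> R) Y :
  continuous g -> vmeas Y -> measurable_fun setT (g \o Y).
Proof.
move=> cg mY.
pose box (q : 'rV[rat]_n * nat) : set 'rV[R]_n :=
  [set x | forall i, `|x 0 i - ratr (q.1 0 i)| < q.2.+1%:R^-1].
apply: (measurability _ (RGenOInfty.measurableE R)) => _ [_ [a ->] <-].
rewrite setTI.
have -> : (g \o Y) @^-1` `]a, +oo[ =
    \bigcup_(q in [set q | box q `<=` [set x | a < g x]]) (Y @^-1` box q).
  apply/seteqP; split => w /=; last by case=> q /= + /= => /[apply]; rewrite in_itv/= andbT.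
  rewrite in_itv/= andbT => agY.
  have /nbhs_ballP[e /= e0 eball] : \forall x \near Y w, a < g x.
    exact: (cvgr_gt _ (cg (Y w))).
  have /andP[k0 ke] : (0 < (Num.truncn (2 / e)).+1%:R^-1 :> R) &&
      ((Num.truncn (2 / e)).+1%:R^-1 < e / 2).
    rewrite invr_gt0 ltr0n/= -[e / 2]invrK ltf_pV2 ?posrE ?ltr0n ?invr_gt0 ?divr_gt0//.
    by rewrite invf_div truncnS_gt.
  set k := Num.truncn _ in k0 ke.
  set r : R := k.+1%:R^-1 in k0 ke.
  have /choice[q qY] : forall i, exists q : rat,
      `|Y w 0 i - ratr q| < r.
    move=> i; have /rat_in_itvoo[q] :
        Y w 0 i - r < Y w 0 i + r by lra.
    by rewrite in_itv/= => /andP[? ?]; exists q; rewrite ltr_distl; apply/andP; split; lra.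
  exists (\row_i q i, k) => /=; last by move=> i; rewrite /= mxE.
  move=> x /= xq; apply: eball; rewrite mx_norm_ball /ball_/=.
  rewrite [`|_|]mx_normrE; apply/bigmax_ltP; split=> // -[i j] _ /=.
  rewrite ord1 !mxE; have := xq j; have := qY j; rewrite !mxE -/r /= => h1 h2.
  rewrite (_ : _ - _ = (Y w 0 j - ratr (q j)) - (x 0 j - ratr (q j))); last by ring.
  by rewrite (le_lt_trans (ler_normB _ _))//; lra.
rewrite bigcup_mkcond; apply: countable_bigcupT_measurable; first exact: countableP.
move=> q; case: ifPn => // _.
rewrite (_ : _ @^-1` _ = \big[setI/setT]_(i < n) ((fun w => Y w 0 i) @^-1`
    [set y | `|y - ratr (q.1 0 i)| < q.2.+1%:R^-1])); last first.
  apply/seteqP; split => w /=.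
    move=> h; apply: (@big_ind _ (fun A : set T => A w)) => // i _; exact: h.
  by move=> + i; rewrite (bigD1 i)//= => -[].
apply: big_ind => //; first exact: measurableI.
move=> i _; rewrite -[X in measurable X]setTI; apply: mY => //.
rewrite (_ : [set y | _] = `]ratr (q.1 0 i) - q.2.+1%:R^-1, ratr (q.1 0 i) + q.2.+1%:R^-1[%classic); first exact: measurable_itv.
by apply/seteqP; split => y /=; rewrite in_itv/= ltr_distl.
Qed.

End measurable_vector.

(** * Independent sigma-algebras *)

Section independence.
Context (R : realType) d (T : measurableType d) (P : probability T R).
Implicit Types G : set (set T).
Local Open Scope ereal_scope.

Definition indep G1 G2 :=
  [/\ G1 `<=` measurable, G2 `<=` measurable &
      forall A B, <<s G1>> A -> <<s G2>> B -> P (A `&` B) = P A * P B].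

Lemma sub_salgebra_measurable G : G `<=` measurable -> <<s G>> `<=` measurable.
Proof.
move=> Gm; apply: smallest_sub => //; exact: sigma_algebra_measurable.
Qed.

Lemma indep_sym G1 G2 : indep G1 G2 -> indep G2 G1.
Proof.
by move=> [m1 m2 i12]; split => // A B GA GB; rewrite setIC i12// muleC.
Qed.

Let indep_half G B : G `<=` measurable -> setI_closed G -> measurable B ->
  (forall A, G A -> P (A `&` B) = P A * P B) ->
  forall A, <<s G>> A -> P (A `&` B) = P A * P B.
Proof.
move=> Gm GI mB PG.
have sGm := sub_salgebra_measurable Gm.
apply: (@dynkin_induction _ (g_sigma_algebraType G) G
  (fun A => P (A `&` B) = P A * P B)) => //.
- by rewrite setTI (@probability_setT _ _ _ P) mul1e.
- move=> A /sGm mA PA.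
  have -> : P (~` A) = 1 - P A by rewrite probability_setC.
  have -> : P (~` A `&` B) = P B - P A * P B.
    rewrite setIC -setDE measureD//; last by rewrite ltey_eq fin_num_measure.
    by rewrite -PA; congr (P B - P _); exact: setIC.
  have -> : P A = (fine (P A))%:E by rewrite fineK// fin_num_measure.
  have -> : P B = (fine (P B))%:E by rewrite fineK// fin_num_measure.
  by rewrite -EFinM -!EFinB -EFinM mulrBl mul1r.
- move=> F mF tF PF.
  have mF' n : @measurable d T (F n) by apply: sGm; exact: mF.
  rewrite setI_bigcupl !measure_bigcup//.
  + rewrite [RHS]muleC -(@fineK _ (P B)) ?fin_num_measure//.
    rewrite -nneseriesZl//; apply: eq_eseriesr => k _.
    by rewrite fineK ?fin_num_measure// muleC; exact: PF.
  + by move=> n _; exact: measurableI.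
  + exact: trivIset_setIr.
Qed.

Lemma indep_pi G1 G2 : G1 `<=` measurable -> G2 `<=` measurable ->
  setI_closed G1 -> setI_closed G2 ->
  (forall A B, G1 A -> G2 B -> P (A `&` B) = P A * P B) -> indep G1 G2.
Proof.
move=> m1 m2 I1 I2 PG; split => // A B sA sB.
apply: (indep_half m1 I1) sA; first exact: sub_salgebra_measurable sB.
move=> C GC; rewrite setIC muleC; apply: (indep_half m2 I2) sB.
  exact: m1.
by move=> E GE; rewrite setIC muleC PG.
Qed.

Lemma indepS G1 G2 H1 H2 : H1 `<=` <<s G1>> -> H2 `<=` <<s G2>> ->
  indep G1 G2 -> indep H1 H2.
Proof.
move=> s1 s2 [m1 m2 i12]; split.
- by move=> A /s1; exact: sub_salgebra_measurable.
- by move=> A /s2; exact: sub_salgebra_measurable.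
- move=> A B sA sB; apply: i12.
    by apply: smallest_sub sA => //; exact: smallest_sigma_algebra.
  by apply: smallest_sub sB => //; exact: smallest_sigma_algebra.
Qed.

End independence.

(** * Freezing: integrating out an independent variable *)

Section decouple.
Context (R : realType) d (T : measurableType d) (P : probability T R).
Context (G1 G2 : set (set T)).
Hypothesis ind : indep P G1 G2.
Let T1 := g_sigma_algebraType G1.
Let T2 := g_sigma_algebraType G2.

Lemma measurable_id_salgebra (G : set (set T)) : G `<=` measurable ->
  measurable_fun setT (id : T -> g_sigma_algebraType G).
Proof.
by move=> Gm _ A mA; rewrite setTI; exact: sub_salgebra_measurable mA.
Qed.

Let m1 : measurable_fun setT (id : T -> T1).
Proof. by have [? _ _] := ind; exact: measurable_id_salgebra. Qed.
Let m2 : measurable_fun setT (id : T -> T2).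
Proof. by have [_ ? _] := ind; exact: measurable_id_salgebra. Qed.
Let m12 : measurable_fun setT ((fun w => (w, w)) : T -> T1 * T2).
Proof. exact: (measurable_fun_pair m1 m2). Qed.

Let X1_mixin := isMeasurableFun.Build _ _ _ _ _ m1.
Let X1 : {mfun T >-> T1} := HB.pack (id : T -> T1) X1_mixin.
Let X2_mixin := isMeasurableFun.Build _ _ _ _ _ m2.
Let X2 : {mfun T >-> T2} := HB.pack (id : T -> T2) X2_mixin.
Let X12_mixin := isMeasurableFun.Build _ _ _ _ _ m12.
Let X12 : {mfun T >-> (T1 * T2)%type} :=
  HB.pack ((fun w => (w, w)) : T -> T1 * T2) X12_mixin.

Let P1 : probability T1 R := distribution P X1.
Let P2 : probability T2 R := distribution P X2.
Let P12 : probability (T1 * T2)%type R := distribution P X12.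

Let prodE A : measurable A -> (P1 \x P2)%E A = P12 A.
Proof.
move=> mA; apply: (@product_measure_unique _ _ _ _ _ P1 P2 P12) => // B C mB mC.
by have [_ _ <-] := ind.
Qed.

Let Ex1 (f : T1 -> R) : bmeas f -> Ex P1 f = Ex P f.
Proof.
move=> bf; rewrite /Ex /Rintegral; congr fine; apply: integral_distribution.
  by apply/measurable_EFinP; case: bf.
apply: bmeas_integrable; case: bf => mf [B fB]; apply: (bmeasI (B := B)) => //.
exact: (measurableT_comp mf m1).
Qed.

Let Ex2 (f : T2 -> R) : bmeas f -> Ex P2 f = Ex P f.
Proof.
move=> bf; rewrite /Ex /Rintegral; congr fine; apply: integral_distribution.
  by apply/measurable_EFinP; case: bf.
apply: bmeas_integrable; case: bf => mf [B fB]; apply: (bmeasI (B := B)) => //.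
exact: (measurableT_comp mf m2).
Qed.

Let bmeas_section (Phi : T1 * T2 -> R) w : bmeas Phi ->
  bmeas (fun w' : T2 => Phi (w, w')).
Proof.
move=> [mP [B PB]]; apply: (bmeasI (B := B)) => //.
exact: (measurableT_comp mP (pair1_measurable _)).
Qed.

(** The measurability part of the theorem of Fubini. *)
Lemma bmeas_partial_Ex (Phi : T1 * T2 -> R) : bmeas Phi ->
  bmeas (fun w : T1 => Ex P (fun w' : T => Phi (w, w'))).
Proof.
move=> bP; have [mP [B PB]] := bP.
rewrite (_ : (fun w => _) = fun w => Ex P2 (fun w' => Phi (w, w'))); last first.
  by apply/funext => w; rewrite Ex2//; exact: bmeas_section.
apply: (bmeasI (B := B)).
  apply/measurable_EFinP.
  rewrite (_ : _ \o _ = fubini_F P2 (EFin \o Phi)).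
    exact/measurable_fubini_F/(bmeas_integrable (P1 \x P2)%E).
  by apply/funext => w; rewrite /= ExE//; exact: bmeas_section.
by move=> w; apply: Ex_norm_le => //; exact: bmeas_section.
Qed.

(** Under independence the law of the pair (first algebra, second algebra) is
    the product of the laws, so the second variable may be averaged out with the
    first one frozen.  This replaces conditional expectation throughout. *)
Lemma Ex_decouple (Phi : T1 * T2 -> R) : bmeas Phi ->
  Ex P (fun w => Phi (w, w)) = Ex P (fun w => Ex P (fun w' => Phi (w, w'))).
Proof.
move=> bP; have [mP [B PB]] := bP.
rewrite -(Ex1 (bmeas_partial_Ex bP)).
have -> : Ex P (fun w => Phi (w, w)) = Ex P12 Phi.
  rewrite /Ex /Rintegral; congr fine; apply/esym/integral_distribution.
    exact/measurable_EFinP.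
  apply: bmeas_integrable; apply: (bmeasI (B := B)) => //.
  exact: (measurableT_comp mP m12).
rewrite /Ex {1 2}/Rintegral; congr fine.
rewrite -(@eq_measure_integral _ _ _ _ _ (P1 \x P2)%E); last by move=> A mA _; exact: prodE.
rewrite -integral12_prod_meas1; last exact: (bmeas_integrable (P1 \x P2)%E).
apply: eq_integral => w _; rewrite /fubini_F -ExE; last exact: bmeas_section.
by congr (_%:E); rewrite Ex2//; exact: bmeas_section.
Qed.

End decouple.

(** * Mutually independent families *)

Section mutual_independence.
Context (R : realType) d (T : measurableType d) (P : probability T R).
Context (I : finType) (Z : I -> T -> R).

(** The pi-system of product events generating the sigma-algebra of the
    variables [Z i], [i \in J]. *)
Definition cylinder (J : {set I}) : set (set T) :=
  [set E | exists2 A : I -> set R, forall i, measurable (A i) &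
    E = [set w | forall i, i \in J -> A i (Z i w)]].

Lemma cylinder_setI J : setI_closed (cylinder J).
Proof.
move=> _ _ [A mA ->] [B mB ->]; exists (fun i => A i `&` B i).
  by move=> i; exact: measurableI.
apply/seteqP; split => w /=; first by move=> [h1 h2] i iJ; split; [exact: h1|exact: h2].
by move=> h; split => i iJ; have [] := h i iJ.
Qed.

Lemma cylinder_measurable J : (forall i, measurable_fun setT (Z i)) ->
  cylinder J `<=` measurable.
Proof.
move=> mZ _ [A mA ->].
rewrite (_ : [set w | _] = \big[setI/setT]_(i in J) (Z i @^-1` A i)).
  apply: big_ind => //; first exact: measurableI.
  by move=> i _; rewrite -[X in measurable X]setTI; exact: mZ.
apply/seteqP; split => w /=.
  by move=> h; apply: (@big_ind _ (fun A : set T => A w)) => // i /h.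
by move=> + i iJ; rewrite (bigD1 i)//= => -[].
Qed.

Lemma cylinder1 (J : {set I}) i (B : set R) : i \in J -> measurable B ->
  cylinder J (Z i @^-1` B).
Proof.
move=> iJ mB; exists (fun j => if j == i then B else setT).
  by move=> j; case: ifP.
apply/seteqP; split => w /=; last by move=> /(_ i iJ); rewrite eqxx.
by move=> h j jJ; case: eqVneq => // ->.
Qed.

Lemma measurable_cylinder (J : {set I}) i : i \in J ->
  measurable_fun setT (Z i : g_sigma_algebraType (cylinder J) -> R).
Proof.
move=> iJ _ B mB; rewrite setTI; apply: sub_sigma_algebra; exact: cylinder1.
Qed.

Lemma mutually_independent_indep (J : {set I}) :
  (forall i, measurable_fun setT (Z i)) ->
  mutually_independent P Z -> indep P (cylinder J) (cylinder (~: J)).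
Proof.
move=> mZ iZ; apply: indep_pi; [exact: cylinder_measurable|
  exact: cylinder_measurable|exact: cylinder_setI|exact: cylinder_setI|].
move=> _ _ [A mA ->] [B mB ->].
pose C i := if i \in J then A i else B i.
have mC i : measurable (C i) by rewrite /C; case: ifP.
have -> : [set w | forall i, i \in J -> A i (Z i w)] `&`
    [set w | forall i, i \in ~: J -> B i (Z i w)] =
    [set w | forall i, i \in [set: I]%SET -> C i (Z i w)].
  apply/seteqP; split => w /=.
    move=> [hA hB] i _; rewrite /C; case: ifPn => iJ; first exact: hA.
    by apply: hB; rewrite inE.
  move=> h; split=> i iJ; have := h i; rewrite finset.in_setT => /(_ isT); rewrite /C ?iJ//.
  by move: iJ; rewrite inE => /negbTE ->.
rewrite !iZ// -EFinM; congr EFin.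
rewrite (bigID [in J])/=; congr (_ * _).
- by apply: eq_big => i; rewrite ?inE// => /andP[_ iJ]; rewrite /C iJ.
- by apply: eq_big => i; rewrite ?inE// => /andP[_ /negbTE iJ]; rewrite /C iJ.
Qed.

End mutual_independence.

(** * The Brownian filtration and its increments *)

(** Centred Gaussian vector with covariance [tau] times the identity, in a form that
    lets one coordinate be integrated at a time. *)
Record gauss_vec (R : realType) (n : nat) d (T : measurableType d)
    (P : probability T R) (tau : R) (Z : T -> 'rV[R]_n) : Prop := GaussVec {
  gauss_vec_meas : vmeas Z;
  gauss_vec_law : forall i (A : set R), measurable A ->
    P [set w | A (Z w 0 i)] = normal_prob 0 (Num.sqrt tau) A;
  gauss_vec_indep : forall i : 'I_n,
    indep P (cylinder (fun i w => Z w 0 i) [set i]%SET)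
            (cylinder (fun i w => Z w 0 i) (~: [set i]%SET)) }.

Section wiener.
Context (R : realType) (n : nat) d (T : measurableType d) (P : probability T R).
Context (tmax : R) (W : R -> T -> 'rV[R]_n).
Hypothesis (wW : wiener_process P tmax W).

Lemma wiener_vmeas t : 0 <= t <= tmax -> vmeas (W t).
Proof. by move=> tT i; exact: wiener_measurable wW t i tT. Qed.

Lemma wiener_increment_gauss (s r : R) : 0 <= s -> s < r -> r <= tmax ->
  gauss_vec P (r - s) (fun w => W r w - W s w).
Proof.
move=> s0 sr rT.
have mW : vmeas (fun w => W r w - W s w).
  by apply: vmeasB; apply: wiener_vmeas; apply/andP; split=> //; lra.
split=> //.
  move=> i A mA; rewrite -(wiener_gaussian wW i s0 sr rT mA).
  by congr (P _); apply/seteqP; split => w /=; rewrite !mxE.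
move=> i.
pose tt (k : nat) := if k is 0%N then s else r.
have := wiener_independent wW (m := 1) (t := tt) s0 _ rT.
move=> /(_ _)/wrap[[|//]|]//.
set Z := (Z in mutually_independent _ Z) => iZ.
have mZ ki : measurable_fun setT (Z ki).
  case: ki => k j; rewrite /Z ord1/=.
  by have := mW j; congr measurable_fun; apply/funext => w; rewrite !mxE.
have ZE k j w : Z (k, j) w = (W r w - W s w) 0 j by rewrite /Z ord1/= !mxE.
apply: indepS (mutually_independent_indep [set ki | ki.2 == i]%SET mZ iZ).
  move=> _ [A mA ->]; apply: sub_sigma_algebra; exists (fun ki => A ki.2) => //.
  apply/seteqP; split => w /= h.
    by move=> [k j]; rewrite inE/= ZE => /eqP ->; apply: h; rewrite inE.
  by move=> j; rewrite inE => /eqP ->; rewrite -(ZE ord0); apply: (h (ord0, i)); rewrite inE.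
move=> _ [A mA ->]; apply: sub_sigma_algebra; exists (fun ki => A ki.2) => //.
apply/seteqP; split => w /= h.
  by move=> [k j]; rewrite !inE/= ZE => ji; apply: h; rewrite !inE.
by move=> j; rewrite !inE => ji; rewrite -(ZE ord0); apply: (h (ord0, j)); rewrite !inE.
Qed.

Definition past_events (t : R) : set (set T) :=
  [set A | (exists s i (B : set R), [/\ 0 <= s <= t, measurable B &
              A = [set w | B (W s w 0 i)]]) \/ P.-negligible A].

(* Increments from time 0, rather than values: the joint independence of a Wiener
   process concerns increments, and [W 0] vanishes only almost surely. *)
Let past_grid (ts : seq R) : set (set T) :=
  [set A | exists s i (B : set R), [/\ s \in ts, measurable B &
              A = [set w | B (W s w 0 i - W 0 w 0 i)]]].

(* Sorting the grid together with 0 and [t], and appending [r], makes the events on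
   both sides depend on complementary sets of consecutive increments. *)
Let grid_indep ts (t r : R) : all (fun s => 0 <= s <= t) ts -> 0 <= t -> t < r ->
  r <= tmax ->
  indep P (past_grid ts)
    (cylinder (fun i w => (W r w - W t w) 0 i) [set: 'I_n]%SET).
Proof.
move=> tst t0 tr rT.
pose gs := sort <=%R (undup (0 :: t :: ts)).
have gsE x : (x \in gs) = (x \in 0 :: t :: ts) by rewrite mem_sort mem_undup.
have gsb x : x \in gs -> 0 <= x <= t.
  rewrite gsE !inE => /orP[/eqP ->|/orP[/eqP ->|xts]].
  - by rewrite lexx t0.
  - by rewrite lexx t0.
  - exact: (allP tst).
have gss : sorted <%R gs.
  by rewrite lt_sorted_uniq_le sort_uniq undup_uniq sort_le_sorted.
have gs0 : (0 < size gs)%N.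
  by rewrite size_sort lt0n size_eq0; apply/eqP => e; have := gsE 0; rewrite /gs e !inE eqxx.
pose tt k := nth r gs k.
have tt_in k : (k < size gs)%N -> 0 <= tt k <= t by move=> h; apply: gsb; exact: mem_nth.
have tt_size : tt (size gs) = r by rewrite /tt nth_default.
have tt_lt k l : (k < l)%N -> (l < size gs)%N -> tt k < tt l.
  move=> kl lm; apply: (sorted_ltn_nth lt_trans) => //; rewrite inE//.
  exact: ltn_trans kl lm.
have ttS k : (k < size gs)%N -> tt k < tt k.+1.
  move=> km; have [e|ne] := eqVneq k.+1 (size gs).
    by rewrite e tt_size (le_lt_trans _ tr)//; case/andP: (tt_in _ km).
  by apply: tt_lt => //; rewrite ltn_neqAle ne.
have tt0 : tt 0 = 0.
  have /(nthP r)[j jm je] : 0 \in gs by rewrite gsE inE eqxx.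
  have := tt_in _ gs0; case: j jm je => [//|j] jm je.
  by have := tt_lt 0%N j.+1 isT jm; rewrite /tt je => /lt_geF ->.
have ttl : tt (size gs).-1 = t.
  have lm : ((size gs).-1 < size gs)%N by rewrite prednK.
  have /(nthP r)[j jm je] : t \in gs by rewrite gsE !inE eqxx orbT.
  have [->//|ne] := eqVneq (size gs).-1 j.
  have : (j < (size gs).-1)%N by rewrite ltn_neqAle eq_sym ne -ltnS prednK.
  move=> /tt_lt/(_ lm); rewrite /tt je => /lt_geF; have := tt_in _ lm.
  by rewrite /tt => /andP[_ ->].
have := wiener_independent wW (m := size gs) (t := tt).
rewrite tt0 tt_size => /(_ (lexx _) ttS rT).
set Z := (Z in mutually_independent _ Z) => iZ.
have ttT k : (k <= size gs)%N -> 0 <= tt k <= tmax.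
  rewrite leq_eqVlt => /orP[/eqP ->|/tt_in /andP[h1 h2]].
    by rewrite tt_size; apply/andP; split=> //; lra.
  by apply/andP; split=> //; lra.
have mZ ki : measurable_fun setT (Z ki).
  case: ki => k j; rewrite /Z/=.
  have := vmeasB (wiener_vmeas (ttT k.+1 (ltn_ord k))) (wiener_vmeas (ttT k (ltnW (ltn_ord k)))) j.
  by congr measurable_fun; apply/funext => w; rewrite !mxE.
pose J := [set ki : 'I_(size gs) * 'I_n | (ki.1 < (size gs).-1)%N]%SET.
apply: indepS (mutually_independent_indep J mZ iZ).
  move=> _ [s [i [B [sts mB ->]]]].
  have /(nthP r)[j jm <-] : s \in gs by rewrite gsE !inE sts !orbT.
  rewrite -/(tt j).
  suff : forall j, (j < size gs)%N -> measurable_fun setT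
    ((fun w => W (tt j) w 0 i - W 0 w 0 i) : g_sigma_algebraType (cylinder Z J) -> R).
    by move=> /(_ j jm measurableT B mB); rewrite setTI.
  elim=> [_|k ih km].
    rewrite tt0 (_ : (fun w => _) = fun=> 0); first exact: measurable_cst.
    by apply/funext => w; rewrite subrr.
  have km' := ltn_trans (ltnSn k) km.
  rewrite (_ : (fun w => _) = fun w => (W (tt k) w 0 i - W 0 w 0 i) + Z (Ordinal km', i) w).
    apply: measurable_funD; first exact: ih.
    by apply: measurable_cylinder; rewrite inE/= -ltnS prednK.
  by apply/funext => w; rewrite /Z/=; ring.
move=> _ [A mA ->]; apply: sub_sigma_algebra; exists (fun ki => A ki.2) => //.
have lm : ((size gs).-1 < size gs)%N by rewrite prednK.
have ZE k j w : (k, j) \in ~: J -> Z (k, j) w = (W r w - W t w) 0 j.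
  rewrite !inE/= -leqNgt => mk; rewrite /Z/= !mxE.
  have -> : k = Ordinal lm by apply/val_inj/eqP; rewrite /= eqn_leq mk andbT -ltnS prednK.
  by rewrite /= prednK// ttl tt_size.
apply/seteqP; split => w /= h.
  move=> [k j] kJ; rewrite ZE//=; apply: h; exact: finset.in_setT.
move=> j _.
have kJ : (Ordinal lm, j) \in ~: J by rewrite !inE/= ltnn.
by rewrite -(ZE _ _ _ kJ); exact: (h _ kJ).
Qed.

Hypothesis cP : measure_is_complete P.

Let symdiff (A B : set T) := (A `\` B) `|` (B `\` A).

Let symdiff_measurable A B : measurable B -> P.-negligible (symdiff A B) ->
  measurable A.
Proof.
move=> mB nAB.
have -> : A = (B `\` (B `\` A)) `|` (A `\` B).
  by apply/seteqP; split => w /=; have [|] := pselect (A w); have [|] := pselect (B w); tauto.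
apply: measurableU; first apply: measurableD => //.
  by apply: cP; apply: negligibleS nAB => w; right.
by apply: cP; apply: negligibleS nAB => w; left.
Qed.

Let symdiff_measure A B : measurable B -> P.-negligible (symdiff A B) ->
  P A = P B.
Proof.
move=> mB nAB; have mA := symdiff_measurable mB nAB.
rewrite (measureDI P mA mB) (measureDI P mB mA) setIC; congr (_ + _)%E.
rewrite !measure_negligible//; [exact: measurableD| |exact: measurableD|].
  by apply: negligibleS nAB => w; right.
by apply: negligibleS nAB => w; left.
Qed.

(* The pi-system that generates the past of [t]: each single event is approximated,
   up to a null set, from a finite grid. *)
Let past_approx t : set (set T) :=
  [set A | exists2 ts : seq R, all (fun s => 0 <= s <= t) ts &
     exists2 A' : set T, <<s past_grid ts>> A' & P.-negligible (symdiff A A')].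

Let past_gridS ts us : {subset ts <= us} ->
  <<s past_grid ts>> `<=` <<s past_grid us>>.
Proof.
move=> tu; apply: smallest_sub; first exact: smallest_sigma_algebra.
move=> _ [s [i [B [sts mB ->]]]]; apply: sub_sigma_algebra.
by exists s, i, B; split => //; exact: tu.
Qed.

Let past_approx_setI t : setI_closed (past_approx t).
Proof.
move=> A B [ts tst [A' sA nA]] [us ust [B' sB nB]].
exists (ts ++ us); first by rewrite all_cat tst.
exists (A' `&` B').
  apply: (@measurableI _ (g_sigma_algebraType (past_grid (ts ++ us)))).
    by apply: past_gridS sA => x xts; rewrite mem_cat xts.
  by apply: past_gridS sB => x xus; rewrite mem_cat xus orbT.
apply: negligibleS (negligibleU nA nB) => w; rewrite /symdiff/=.
by have [|] := pselect (A w); have [|] := pselect (B w);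
  have [|] := pselect (A' w); have [|] := pselect (B' w); tauto.
Qed.

(** Up to null sets, every generating event of the past lives on a finite grid, and the
    grid events form a pi-system on which independence is that of finitely many
    increments. *)
Lemma past_increment_indep (t r : R) : 0 <= t -> t < r -> r <= tmax ->
  indep P (past_events t)
    (cylinder (fun i w => (W r w - W t w) 0 i) [set: 'I_n]%SET).
Proof.
move=> t0 tr rT.
have mgrid ts : all (fun s => 0 <= s <= t) ts -> <<s past_grid ts>> `<=` measurable.
  by move=> tst; have [+ _ _] := grid_indep tst t0 tr rT; exact: sub_salgebra_measurable.
have mcyl : cylinder (fun i w => (W r w - W t w) 0 i) [set: 'I_n]%SET `<=` measurable.
  by have [_ + _] := @grid_indep [::] _ _ isT t0 tr rT.
apply: (@indepS _ _ _ _ (past_approx t) _ _ _ _ (@sub_sigma_algebra _ _ _)).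
  move=> A pA; apply: sub_sigma_algebra; case: pA => [[s [i [B [st mB ->]]]]|nA].
    exists [:: s]; first by rewrite /= andbT.
    exists [set w | B (W s w 0 i - W 0 w 0 i)].
      by apply: sub_sigma_algebra; exists s, i, B; split => //; rewrite inE.
    apply: negligibleS (wiener_start wW) => w /= + W0.
    by rewrite /symdiff/= W0 mxE subr0 => -[] [].
  exists [::] => //; exists set0; first exact: sigma_algebra0.
  by apply: negligibleS nA => w /= [[]|[]].
apply: indep_pi => //.
- by move=> A [ts tst [A' /(mgrid _ tst) mA' /(symdiff_measurable mA')]].
- exact: cylinder_setI.
- move=> A B [ts tst [A' sA' nA]] cB.
  have [_ _ iP] := grid_indep tst t0 tr rT.
  have mA' := mgrid _ tst _ sA'.
  have mB := mcyl _ cB.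
  rewrite (symdiff_measure mA' nA) -iP//; last exact: sub_sigma_algebra.
  apply: symdiff_measure; first exact: measurableI.
  by apply: negligibleS nA => w /= [[[? ?] h]|[[? ?] h]]; [left|right]; split=> // ?; exact: h.
Qed.

Lemma past_eventsS (s t : R) : s <= t -> <<s past_events s>> `<=` <<s past_events t>>.
Proof.
move=> st; apply: smallest_sub; first exact: smallest_sigma_algebra.
move=> A pA; apply: sub_sigma_algebra; case: pA => [[u [i [B [/andP[u0 us] mB ->]]]]|nA].
  by left; exists u, i, B; split => //; rewrite u0 (le_trans us).
by right.
Qed.

(** The augmentation puts every null set into every sigma-algebra of the past. *)
Lemma measurable_past_ae t (f g : T -> R) :
  measurable_fun setT (f : g_sigma_algebraType (past_events t) -> R) ->
  {ae P, forall w, f w = g w} ->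
  measurable_fun setT (g : g_sigma_algebraType (past_events t) -> R).
Proof.
move=> mf fg _ B mB; rewrite setTI.
have neg (A : set T) : P.-negligible A ->
    (@measurable _ (g_sigma_algebraType (past_events t))) A.
  by move=> nA; apply: sub_sigma_algebra; right.
have -> : g @^-1` B = (f @^-1` B `\` [set w | f w <> g w]) `|`
    (g @^-1` B `&` [set w | f w <> g w]).
  apply/seteqP; split => w /=.
    by have [e|ne] := pselect (f w = g w); [rewrite -e; left; split => // /(_ e)|right].
  by move=> [[fB /contrapT <-]//|[]].
apply: measurableU.
  apply: measurableD; first by rewrite -[X in measurable X]setTI; exact: mf.
  exact: neg.
by apply: neg; apply: negligibleS fg => w [].
Qed.

Lemma measurable_past_wiener s t i : 0 <= s <= t ->
  measurable_fun setT
    ((fun w => W s w 0 i) : g_sigma_algebraType (past_events t) -> R).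
Proof.
move=> st _ B mB; rewrite setTI; apply: sub_sigma_algebra; left.
by exists s, i, B.
Qed.

Lemma past_events_measurable t : 0 <= t <= tmax -> past_events t `<=` measurable.
Proof.
move=> /andP[t0 tT] A [[s [i [B [/andP[s0 st] mB ->]]]]|]; last exact: cP.
rewrite (_ : [set w | _] = (fun w => W s w 0 i) @^-1` B)//.
rewrite -[X in measurable X]setTI; apply: (@wiener_vmeas s) => //.
by rewrite s0 (le_trans st).
Qed.

End wiener.

(** * Gaussian integrals *)

Section normal.
Context (R : realType).
Local Notation mu := (@lebesgue_measure R).
Implicit Types (F : R -> R) (h s : R).

Lemma integral_normal_prob_bounded s F : bmeas F ->
  (\int[normal_prob 0 s]_x (F x)%:E = \int[mu]_x (F x * normal_pdf 0 s x)%:E)%E.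
Proof.
move=> bF; have [mF [B FB]] := bF.
have iF := bmeas_integrable (normal_prob 0 s) bF.
rewrite -(Radon_Nikodym_change_of_variables (normal_prob_dominates 0 s))//=.
have mp : measurable_fun setT (fun x => (normal_pdf 0 s x)%:E).
  by apply/measurable_EFinP; exact: measurable_normal_pdf.
apply: ae_eq_integral => //.
- apply: emeasurable_funM; first exact/measurable_EFinP.
  by apply: (measurable_int mu); apply: Radon_Nikodym_integrable; exact: normal_prob_dominates.
- apply/measurable_EFinP; apply: measurable_funM => //; exact: measurable_normal_pdf.
- under [X in ae_eq _ _ _ X]eq_fun do rewrite EFinM.
  apply: ae_eqe_mul2l => /=.
  rewrite Radon_NikodymE//=; first exact: normal_prob_dominates.
  move=> dom; case: cid => /= g [g1 g2 g3].
  apply: integral_ae_eq => //=.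
  by move=> E _ mE; rewrite -g3.
Qed.

Lemma integral_normal_prob_ge0 s F : measurable_fun setT F ->
  (forall x, 0 <= F x) ->
  (\int[normal_prob 0 s]_x (F x)%:E = \int[mu]_x (F x * normal_pdf 0 s x)%:E)%E.
Proof.
move=> mF F0.
pose g (N : nat) x : R := Num.min (F x) N%:R.
have mg N : measurable_fun setT (g N) by apply: measurable_minr.
have g0 N x : 0 <= g N x by rewrite /g le_min F0/=.
have gb N : bmeas (g N).
  by apply: (bmeasI (B := N%:R)) => // x; rewrite ger0_norm// ge_min lexx orbT.
have gnd x : {homo g^~ x : m n / (m <= n)%N >-> m <= n}.
  move=> m k mk; rewrite /g le_min ge_min lexx/= ge_min.
  by rewrite ler_nat mk orbT.
have gF x : ((g N x)%:E @[N --> \oo] --> (F x)%:E)%E.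
  apply: cvg_near_cst; near=> N; congr EFin; apply/min_idPl.
  near: N; exact: nbhs_infty_ger.
have p0 x : 0 <= normal_pdf 0 s x := normal_pdf_ge0 0 s x.
transitivity (limn (fun N => \int[normal_prob 0 s]_x (g N x)%:E))%E.
  rewrite -monotone_convergence//.
  - by apply: eq_integral => x _; apply/esym/cvg_lim.
  - by move=> N; apply/measurable_EFinP; exact: mg.
  - by move=> N x _; rewrite lee_fin.
  - by move=> x _ m k mk; rewrite lee_fin; exact: gnd.
under eq_fun do rewrite integral_normal_prob_bounded//.
rewrite -monotone_convergence//.
- apply: eq_integral => x _; apply/cvg_lim => //.
  rewrite EFinM; under eq_fun do rewrite EFinM.
  by apply: cvgeZr => //; exact: gF.
- move=> N; apply/measurable_EFinP/measurable_funM; [exact: mg|exact: measurable_normal_pdf].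
- by move=> N x _; rewrite lee_fin mulr_ge0.
- by move=> x _ m k mk; rewrite lee_fin ler_wpM2r// gnd.
Unshelve. all: by end_near.
Qed.

Lemma normal_pdf_shift s h x : s != 0 ->
  normal_pdf h s (x + h) = normal_pdf 0 s x.
Proof. by move=> s0; rewrite !normal_pdfE// /normal_fun addrK subr0. Qed.

Lemma integral_shift (G : R -> R) h : continuous G -> (forall x, 0 <= G x) ->
  (\int[mu]_x (G x)%:E = \int[mu]_x (G (x + h))%:E)%E.
Proof.
move=> cG G0.
have dE (x : R) : is_derive x 1 (fun y : R => y + h) 1.
  by rewrite -[X in is_derive _ _ _ X]addr0; apply: is_deriveD.
have d1 : (fun y : R => y + h)^`()%classic = cst 1.
  by apply/funext => x; rewrite derive1E; exact: (@derive_val _ _ _ _ _ _ _ (dE x)).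
rewrite (@increasing_ge0_integration_by_substitutionT _ (fun y => y + h) G)//.
- by apply: eq_integral => x _; rewrite d1 /= mulr1.
- by move=> x y xy; rewrite ltrD2r.
- by rewrite d1 => x; exact: cvg_cst.
- by rewrite d1; exact: is_cvg_cst.
- by rewrite d1; exact: is_cvg_cst.
- exact: cvg_addrr_Ny.
- exact: cvg_addrr.
Qed.

(** Squaring the shifted density gives the doubly shifted one, so the
    chi-square distance between a Gaussian and its translate is explicit. *)
Lemma normal_pdf_sqr_shift s h x : s != 0 ->
  normal_pdf h s x ^+ 2 =
  normal_pdf 0 s x * normal_pdf (2 * h) s x * expR ((h / s) ^+ 2).
Proof.
move=> s0; rewrite !normal_pdfE// /normal_fun.
rewrite exprMn -expRM_natl.
rewrite [RHS](_ : _ = normal_peak s ^+ 2 * (expR (- (x - 0) ^+ 2 / (s ^+ 2 *+ 2)) *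
  expR (- (x - 2 * h) ^+ 2 / (s ^+ 2 *+ 2)) * expR ((h / s) ^+ 2))); last by ring.
rewrite -!expRD; congr (_ * expR _); field.
exact: s0.
Qed.

Lemma integrable_normal_bounded m s F : bmeas F ->
  mu.-integrable setT (EFin \o (fun x => F x * normal_pdf m s x)).
Proof.
move=> [mF [B FB]].
have iB := integrableZl measurableT B (integrable_normal_pdf m s).
apply: (le_integrable measurableT _ _ iB).
  apply/measurable_EFinP/measurable_funM => //; exact: measurable_normal_pdf.
move=> x _; rewrite /= lee_fin !normrM ler_wpM2r//.
by rewrite (le_trans (FB x))// ler_norm.
Qed.

(** The integral against the law N(m, s^2), written with the density so that the
    mean [m] can be moved into it. *)
Definition normal_mean m s F : R := \int[mu]_x (F x * normal_pdf m s x).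

Lemma Ex_normal_prob s F : bmeas F -> Ex (normal_prob 0 s) F = normal_mean 0 s F.
Proof. by move=> bF; rewrite /Ex /normal_mean /Rintegral integral_normal_prob_bounded. Qed.

Lemma normal_mean_cst m s c : normal_mean m s (fun=> c) = c.
Proof.
rewrite /normal_mean RintegralZl//; last exact: integrable_normal_pdf.
by rewrite /Rintegral integral_normal_pdf mulr1.
Qed.

Lemma normal_meanD m s F G : bmeas F -> bmeas G ->
  normal_mean m s (fun x => F x + G x) = normal_mean m s F + normal_mean m s G.
Proof.
move=> bF bG; rewrite /normal_mean -RintegralD//; try exact: integrable_normal_bounded.
by apply: eq_Rintegral => x _; rewrite mulrDl.
Qed.

Lemma continuous_addr F h : continuous F -> continuous (fun x : R => F (x + h)).
Proof.
move=> cF x; apply: (@continuous_comp _ _ _ (fun x : R => x + h) F); last exact: cF.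
by apply: (@cvgD _ R^o) => //; exact: cvg_cst.
Qed.

Lemma normal_mean_shift s h F (B : R) : s != 0 -> continuous F ->
  (forall x, `|F x| <= B) ->
  normal_mean 0 s (fun x => F (x + h)) = normal_mean h s F.
Proof.
move=> s0 cF FB.
have bF : bmeas F by apply: bmeasI FB; exact: continuous_measurable_fun.
have bFh : bmeas (fun x : R => F (x + h)).
  apply: (bmeasI (B := B)) => //; apply: continuous_measurable_fun.
  exact: continuous_addr.
suff : normal_mean 0 s (fun x => F (x + h) + B) = normal_mean h s (fun x => F x + B).
  have bB : bmeas (fun _ : R => B) by exact: bmeas_cst.
  rewrite (normal_meanD 0 s bFh bB) (normal_meanD h s bF bB).
  by rewrite !normal_mean_cst => /addIr.
rewrite /normal_mean; congr fine; apply/esym.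
rewrite (@integral_shift _ h).
- by apply: eq_integral => x _; rewrite normal_pdf_shift.
- move=> x; apply: (@cvgM _ R^o); last exact: continuous_normal_pdf.
  by apply: (@cvgD _ R^o); [exact: cF|exact: cvg_cst].
- move=> x; rewrite mulr_ge0 ?normal_pdf_ge0//.
  by have := FB x; rewrite ler_norml; lra.
Qed.

(* With [y] the difference of the two densities and [z] the centred one, y ^+ 2 / z
   is the integrand of the chi-square distance. *)
Let amgm_bound (y z a : R) : 0 < a -> 0 < z -> y <= (a^-1 * (y ^+ 2 / z) + a * z) / 2.
Proof.
move=> a0 z0; rewrite -subr_ge0.
rewrite [X in 0 <= X](_ : _ = (y - a * z) ^+ 2 / (2 * a * z)).
  by rewrite divr_ge0 ?sqr_ge0// !mulr_ge0// ltW.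
by field; rewrite (gt_eqF a0) (gt_eqF z0).
Qed.

Let expR_sqr_le (a : R) : 2 * a ^+ 2 <= 1 -> expR (a ^+ 2) <= 1 + 2 * a ^+ 2.
Proof.
move=> a1; have e0 := expR_ge1Dx (- a ^+ 2).
have h : expR (a ^+ 2) * (1 + - a ^+ 2) <= 1.
  apply: (@le_trans _ _ (expR (a ^+ 2) * expR (- a ^+ 2))).
    by rewrite ler_wpM2l ?expR_ge0.
  by rewrite -expRD subrr expR0.
move: h a1 (expR_ge0 (a ^+ 2)) (sqr_ge0 a) {e0}.
move: (a ^+ 2) (expR _) => u e h u1 e0 u0.
have h2 : e * (1 + - u) * (1 + 2 * u) <= 1 + 2 * u by rewrite ler_piMl//; lra.
have h3 : 0 <= e * (u * (1 - 2 * u)) by rewrite !mulr_ge0//; lra.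
lra.
Qed.

Let tv_const (B a E : R) : 0 <= B -> 0 < a -> E <= 1 + 2 * a ^+ 2 ->
  B / 2 * (a^-1 * E) + (- (B / a)) + B / 2 * (a^-1 + a) <= 3 * B * a.
Proof.
move=> B0 a0 E2.
rewrite [leLHS](_ : _ = B / 2 * (a^-1 * (E - 1) + a)); last by field; rewrite gt_eqF.
have h1 : a^-1 * (E - 1) <= 2 * a by rewrite mulrC ler_pdivrMr//; lra.
rewrite [leRHS](_ : _ = B / 2 * (6 * a)); last by field.
by rewrite ler_wpM2l//; lra.
Qed.

Let int_add (f g : R -> R) : mu.-integrable setT (EFin \o f) ->
  mu.-integrable setT (EFin \o g) -> mu.-integrable setT (EFin \o (fun x => f x + g x)).
Proof. by move=> fi gi; exact: (integrableD measurableT fi gi). Qed.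

Let int_cpdf (c m s : R) : mu.-integrable setT (EFin \o (fun x => c * normal_pdf m s x)).
Proof. by apply: (@integrable_normal_bounded m s (fun=> c)); exact: bmeas_cst. Qed.

Let int_pdf3 (c1 c2 c3 m1 m2 m3 s : R) :
  mu.-integrable setT (EFin \o (fun x => c1 * normal_pdf m1 s x +
    c2 * normal_pdf m2 s x + c3 * normal_pdf m3 s x)).
Proof. exact: int_add (int_add (int_cpdf _ _ _) (int_cpdf _ _ _)) (int_cpdf _ _ _). Qed.

Let Rint_pdf3 (c1 c2 c3 m1 m2 m3 s : R) :
  \int[mu]_x (c1 * normal_pdf m1 s x + c2 * normal_pdf m2 s x +
     c3 * normal_pdf m3 s x) = c1 + c2 + c3.
Proof.
have i12 := int_add (int_cpdf c1 m1 s) (int_cpdf c2 m2 s).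
rewrite (RintegralD measurableT i12 (int_cpdf c3 m3 s)).
rewrite (RintegralD measurableT (int_cpdf c1 m1 s) (int_cpdf c2 m2 s)).
by congr (_ + _ + _); exact: normal_mean_cst.
Qed.

(** Total variation is controlled by the chi-square distance, through the arithmetic-geometric mean
    inequality, and the latter is explicit since Gaussian densities have mass one. *)
Lemma normal_shift_tv s h F (B : R) : 0 < s -> continuous F ->
  (forall x, `|F x| <= B) ->
  `|Ex (normal_prob 0 s) (fun x => F (x + h)) - Ex (normal_prob 0 s) F|
     <= 3 * B * (`|h| / s).
Proof.
move=> s0 cF FB.
have B0 : 0 <= B := le_trans (normr_ge0 _) (FB 0).
have sn0 : s != 0 by rewrite gt_eqF.
have bF : bmeas F by apply: bmeasI FB; exact: continuous_measurable_fun.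
have bFh : bmeas (fun x : R => F (x + h)).
  apply: (bmeasI (B := B)) => //; apply: continuous_measurable_fun.
  exact: continuous_addr.
have aE : `|h| / s = `|h / s| by rewrite normrM normfV (gtr0_norm s0).
have [a1|a1] := ltP 1 (2 * (h / s) ^+ 2).
  rewrite aE.
  have : `|Ex (normal_prob 0 s) (fun x => F (x + h)) - Ex (normal_prob 0 s) F| <= 2 * B.
    rewrite (le_trans (ler_normB _ _))//.
    have := Ex_norm_le (normal_prob 0 s) bF FB.
    have := Ex_norm_le (normal_prob 0 s) bFh (fun x => FB _).
    lra.
  move/le_trans; apply.
  have a2 : (2/3) <= `|h / s|.
    by rewrite -(@ler_pXn2r _ 2%N) ?nnegrE// real_normK ?num_real//; lra.
  by rewrite [leRHS](_ : _ = 2 * B + 3 * B * (`|h / s| - 2 / 3)) ?lerDl ?mulr_ge0 ?subr_ge0//; field.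
rewrite !Ex_normal_prob// (normal_mean_shift _ _ cF FB)//.
have [->|h0] := eqVneq h 0; first by rewrite subrr !normr0 mul0r mulr0.
set a : R := `|h| / s; have a0 : 0 < a by rewrite divr_gt0// normr_gt0.
set E := expR ((h / s) ^+ 2).
have a2 : (h / s) ^+ 2 = a ^+ 2 by rewrite -real_normK ?num_real// /a aE.
pose p := normal_pdf 0 s; pose ph := normal_pdf h s; pose p2 := normal_pdf (2 * h) s.
have p_gt0 x : 0 < p x.
  by rewrite /p normal_pdfE// mulr_gt0 ?normal_peak_gt0 ?expR_gt0.
pose q x := B / 2 * (a^-1 * E) * p2 x + (- (B / a)) * ph x + B / 2 * (a^-1 + a) * p x.
have iF m := integrable_normal_bounded m s bF.
have iq : mu.-integrable setT (EFin \o q) := int_pdf3 _ _ _ _ _ _ _.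
have q_ge x : `|F x * ph x - F x * p x| <= q x.
  rewrite -mulrBr normrM.
  have yE : `|ph x - p x| ^+ 2 = p x * (p2 x * E - 2 * ph x + p x).
    rewrite real_normK ?num_real// sqrrB /ph normal_pdf_sqr_shift// -/E -/p -/p2 -/ph; ring.
  have y2 := amgm_bound `|ph x - p x| a0 (p_gt0 x).
  rewrite yE mulrAC mulfV ?mul1r ?gt_eqF// in y2.
  apply: (le_trans (ler_pM _ _ (FB x) y2)) => //.
  by rewrite le_eqVlt; apply/orP; left; apply/eqP; rewrite /q; field; rewrite gt_eqF.
have iD := integrableB measurableT (iF h) (iF 0).
rewrite /normal_mean -(RintegralB measurableT (iF h) (iF 0)).
apply: (le_trans (le_normr_Rintegral measurableT iD)).
apply: (@le_trans _ _ (\int[mu]_x q x)).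
  by apply: (le_Rintegral measurableT (integrable_norm iD) iq) => x _; exact: q_ge.
rewrite Rint_pdf3.
by apply: tv_const => //; rewrite /E a2 expR_sqr_le// -a2.
Qed.

Lemma expR_ge_pow (y : R) (k : nat) : 0 <= y -> (0 < k)%N ->
  y ^+ k <= k%:R ^+ k * expR y.
Proof.
move=> y0 k0; have k0' : 0 < k%:R :> R by rewrite ltr0n.
have -> : expR y = expR (y / k%:R) ^+ k.
  by rewrite -expRM_natl; congr expR; field; rewrite gt_eqF.
rewrite -exprMn; apply: lerXn2r; rewrite ?nnegrE ?mulr_ge0 ?expR_ge0//.
have := expR_ge1Dx (y / k%:R); rewrite -ler_pdivrMl// mulrC; lra.
Qed.

(** The power is dominated by k^k times an exponential, and an exponential times the
    centred density is a translated density, of mass one. *)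
Lemma normal_moment s k : 0 < s -> (0 < k)%N ->
  (\int[normal_prob 0 s]_x ((`|x| / s) ^+ k)%:E <=
     (2 * (k%:R ^+ k * expR 2^-1))%:E)%E.
Proof.
move=> s0 k0; have sn0 : s != 0 by rewrite gt_eqF.
rewrite integral_normal_prob_ge0; first last.
- by move=> x; rewrite exprn_ge0// divr_ge0// ltW.
- apply: measurable_funX; apply: measurable_funM => //; exact: measurableT_comp.
have pE (h : R) x : expR (h * x / s ^+ 2 - h ^+ 2 / (2 * s ^+ 2)) * normal_pdf 0 s x = normal_pdf h s x.
  rewrite !normal_pdfE// /normal_fun mulrCA -expRD; congr (_ * expR _); field.
  exact: sn0.
pose q x := k%:R ^+ k * expR 2^-1 * (normal_pdf s s x + normal_pdf (- s) s x).
apply: (@le_trans _ _ (\int[mu]_x (q x)%:E)%E).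
  apply: ge0_le_integral => //.
  - by move=> x _; rewrite lee_fin mulr_ge0 ?normal_pdf_ge0// exprn_ge0// divr_ge0// ltW.
  - apply/measurable_EFinP/measurable_funM; last exact: measurable_normal_pdf.
    apply: measurable_funX; apply: measurable_funM => //; exact: measurableT_comp.
  - apply/measurable_EFinP/measurable_funM => //.
    apply: measurable_funD; exact: measurable_normal_pdf.
  move=> x _; rewrite lee_fin /q.
  rewrite -(pE s) -(pE (- s)).
  have -> : s * x / s ^+ 2 - s ^+ 2 / (2 * s ^+ 2) = x / s - 2^-1 by field.
  have -> : - s * x / s ^+ 2 - (- s) ^+ 2 / (2 * s ^+ 2) = - (x / s) - 2^-1 by field.
  rewrite -mulrDl !mulrA ler_wpM2r ?normal_pdf_ge0// -mulrA mulrDr -!expRD.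
  rewrite !addrA !(addrC 2^-1) -!addrA subrr !addr0.
  apply: (le_trans (expR_ge_pow _ k0)); first by rewrite divr_ge0// ltW.
  rewrite ler_wpM2l// ?exprn_ge0//.
  have -> : `|x| / s = `|x / s| by rewrite normrM normfV (gtr0_norm s0).
  by have [?|?] := ler0P (x / s); rewrite ?lerDl ?lerDr ?expR_ge0.
have i1 := integrable_normal_pdf s s.
have i2 := integrable_normal_pdf (- s) s.
have -> : (\int[mu]_x (q x)%:E = (k%:R ^+ k * expR 2^-1 * 2)%:E)%E.
  under eq_integral do rewrite EFinM EFinD.
  rewrite integralZl//; last exact: integrableD.
  by rewrite integralD// !integral_normal_pdf -EFinD -EFinM.
by rewrite lee_fin mulrC.
Qed.

End normal.

(** * Smoothing by a Gaussian vector *)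

Section l1norm.
Context (R : realType) (n : nat).
Implicit Types x y : 'rV[R]_n.

Definition l1 x : R := \sum_i `|x 0 i|.

Lemma l1_ge0 x : 0 <= l1 x. Proof. by apply: sumr_ge0. Qed.

Lemma l1N x : l1 (- x) = l1 x.
Proof. by apply: eq_bigr => i _; rewrite mxE normrN. Qed.

Lemma l1_triangle x y : l1 (x + y) <= l1 x + l1 y.
Proof.
by rewrite /l1 -big_split/=; apply: ler_sum => i _; rewrite mxE ler_normD.
Qed.

Lemma l1_coord x i : `|x 0 i| <= l1 x.
Proof. by rewrite /l1 (bigD1 i)//= lerDl sumr_ge0. Qed.

Lemma l1_enorm_coord x i : `|x 0 i| <= enorm (x 0).
Proof.
rewrite /enorm -sqrtr_sqr ler_wsqrtr// (bigD1 i)//= lerDl.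
by apply: sumr_ge0 => j _; exact: sqr_ge0.
Qed.

Lemma enorm_le_l1 x : enorm (x 0) <= l1 x.
Proof.
rewrite -(ger0_norm (l1_ge0 x)) -sqrtr_sqr /enorm ler_wsqrtr//.
rewrite expr2 [X in _ <= X * _]/l1 mulr_suml; apply: ler_sum => i _.
by rewrite -real_normK ?num_real// expr2 ler_wpM2l// l1_coord.
Qed.

Lemma l1_le_norm x : l1 x <= n%:R * `|x|.
Proof.
rewrite /l1 -[n in n%:R]card_ord -sumr_const mulr_suml; apply: ler_sum => i _.
rewrite mul1r [leRHS]mx_normrE.
exact: (le_bigmax _ (fun ij : 'I_1 * 'I_n => `|x ij.1 ij.2|) (0, i)).
Qed.

(** Moving one coordinate at a time is what makes the l1 norm the natural one. *)
Lemma coordwise_lipschitz (G : 'rV[R]_n -> R) (C : R) :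
  (forall x i (h : R), `|G (x + h *: delta_mx 0 i) - G x| <= C * `|h|) ->
  forall x y, `|G x - G y| <= C * l1 (x - y).
Proof.
move=> GC x y.
have H (s : seq 'I_n) (c : 'I_n -> R) :
    `|G (y + \sum_(i <- s) c i *: delta_mx 0 i) - G y| <= C * \sum_(i <- s) `|c i|.
  elim: s => [|i s ih]; first by rewrite !big_nil addr0 subrr normr0 mulr0.
  rewrite !big_cons mulrDr (addrC (_ *: _)) addrA.
  set z := y + _.
  rewrite (_ : _ - _ = (G (z + c i *: delta_mx 0 i) - G z) + (G z - G y)); last by ring.
  by rewrite (le_trans (ler_normD _ _))// lerD.
have := H (index_enum _) (fun i => (x - y) 0 i).
rewrite -row_sum_delta.
by have -> : y + (x - y) = x by rewrite addrC subrK.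
Qed.

Definition holder (K beta : R) (g : 'rV[R]_n -> R) :=
  forall x y, `|g x - g y| <= K * l1 (x - y) `^ beta.

Lemma holder_continuous (K beta : R) g : 0 < K -> 0 < beta -> holder K beta g ->
  continuous g.
Proof.
move=> K0 b0 hg x; have Fx : Filter (nbhs x) by exact: nbhs_filter.
apply/cvgrPdist_le => e e0.
pose dl := (e / K) `^ beta^-1.
have dl0 : 0 < dl by rewrite powR_gt0// divr_gt0.
have : nbhs x (ball x (dl / n.+1%:R)).
  by apply: nbhsx_ballx; rewrite divr_gt0.
apply: filterS => y; rewrite mx_norm_ball /ball_/= => xy; rewrite (le_trans (hg _ _))//.
rewrite -ler_pdivlMl// mulrC.
have -> : e / K = dl `^ beta.
  by rewrite /dl -powRrM mulVf ?gt_eqF// powRr1// divr_ge0// ltW.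
rewrite ge0_ler_powR ?nnegrE ?l1_ge0 ?ltW//.
rewrite (le_lt_trans (l1_le_norm _))//.
rewrite ltr_pdivlMr// in xy; apply: le_lt_trans xy.
by rewrite mulrC ler_wpM2l// ler_nat.
Qed.

(** The Lipschitz regularization of [g] with constant [L] is an infimal
    convolution; for a Hölder [g] and L = K e ^ (beta - 1) it is uniformly
    within K e ^ beta of [g]. *)
Definition inf_convolution (L : R) (g : 'rV[R]_n -> R) x : R :=
  inf [set g y + L * l1 (x - y) | y in setT].

Section inf_convolution.
Variables (g : 'rV[R]_n -> R) (B L : R).
Hypothesis (gB : forall x, `|g x| <= B) (L0 : 0 <= L).

Lemma inf_convolution_le x y : inf_convolution L g x <= g y + L * l1 (x - y).
Proof.
apply: ge_inf; last by exists y.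
exists (- B) => _ [z _ <-]; have := gB z; rewrite ler_norml => /andP[h _].
by rewrite -[leLHS]addr0 lerD// mulr_ge0// l1_ge0.
Qed.

Lemma inf_convolution_ge x c : (forall y, c <= g y + L * l1 (x - y)) ->
  c <= inf_convolution L g x.
Proof.
move=> cg; apply: lb_le_inf; first by exists (g x + L * l1 (x - x)), x.
by move=> _ [y _ <-].
Qed.

Lemma inf_convolution_lipschitz x y :
  `|inf_convolution L g x - inf_convolution L g y| <= L * l1 (x - y).
Proof.
suff H u v : inf_convolution L g u - inf_convolution L g v <= L * l1 (u - v).
  rewrite ler_norml H andbT lerNl opprB -[l1 _]l1N opprB; exact: H.
rewrite lerBlDl -lerBlDr; apply: inf_convolution_ge => z.
rewrite lerBlDr (le_trans (inf_convolution_le u z))// -addrA lerD2l -mulrDr.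
by rewrite ler_wpM2l// [u - z](_ : _ = (v - z) + (u - v)) ?l1_triangle// [RHS]addrC addrA subrK.
Qed.

End inf_convolution.

(** A competitor at distance [rho] gains at most K rho ^ beta and pays L rho; with
    L = K e ^ (beta - 1) the net gain is at most K e ^ beta whatever [rho]. *)
Lemma inf_convolution_dist g (B K beta e : R) : (forall x, `|g x| <= B) -> 0 < K ->
  0 < beta < 1 -> 0 < e -> holder K beta g ->
  forall x, `|g x - inf_convolution (K * e `^ (beta - 1)) g x| <= K * e `^ beta.
Proof.
move=> gB K0 /andP[b0 b1] e0 hg x; set L := K * _.
have L0 : 0 <= L by rewrite mulr_ge0 ?powR_ge0// ltW.
rewrite ger0_norm; last first.
  rewrite subr_ge0 (le_trans (inf_convolution_le gB L0 x x))//.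
  by rewrite subrr /l1 big1 ?mulr0 ?addr0// => i _; rewrite mxE normr0.
rewrite lerBlDr -lerBlDl; apply: inf_convolution_ge => y.
have := hg x y; rewrite ler_norml => /andP[_ h].
set r := l1 (x - y) in h *; have r0 : 0 <= r := l1_ge0 _.
suff : K * r `^ beta <= K * e `^ beta + L * r by lra.
have [re|er] := leP r e.
  rewrite -[leLHS]addr0; apply: lerD; last by rewrite mulr_ge0.
  rewrite ler_wpM2l ?(ltW K0)//.
  by rewrite ge0_ler_powR ?nnegrE// ltW.
rewrite -[leLHS]add0r; apply: lerD; first by rewrite mulr_ge0 ?powR_ge0 ?(ltW K0).
rewrite /L -mulrA.
rewrite ler_wpM2l ?(ltW K0)//.
have rr : 0 < r := lt_trans e0 er.
have -> : r `^ beta = r `^ (beta - 1) * r.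
  by rewrite -[X in _ * X]powRr1// -powRD ?subrK// gt_eqF// implybT.
rewrite ler_wpM2r//.
rewrite -(opprB 1 beta) !powRN lef_pV2 ?posrE ?powR_gt0//.
by rewrite ge0_ler_powR ?nnegrE ?subr_ge0 ?ltW.
Qed.

End l1norm.

Section smoothing.
Context (R : realType) (n : nat) d (T : measurableType d) (P : probability T R).
Implicit Types (Z : T -> 'rV[R]_n) (g : 'rV[R]_n -> R) (x y : 'rV[R]_n).

Definition smooth Z g x : R := Ex P (fun w => g (x + Z w)).

Lemma bmeas_continuous_vector d' (S : measurableType d') (Y : S -> 'rV[R]_n) g B :
  continuous g -> (forall x, `|g x| <= B) -> vmeas Y -> bmeas (fun w => g (Y w)).
Proof.
move=> cg gB mY; apply: (bmeasI (B := B)) => //.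
exact: measurable_continuous_vector.
Qed.

Lemma bmeas_shift Z g B x : continuous g -> (forall x, `|g x| <= B) ->
  vmeas Z -> bmeas (fun w => g (x + Z w)).
Proof.
move=> cg gB mZ; apply: bmeas_continuous_vector gB _ => //.
by apply: vmeasD => //; exact: vmeas_cst.
Qed.

Lemma smooth_bounded Z g B x : continuous g -> (forall x, `|g x| <= B) ->
  vmeas Z -> `|smooth Z g x| <= B.
Proof. by move=> cg gB mZ; apply: Ex_norm_le => //; exact: bmeas_shift gB _. Qed.

Lemma smooth_holder_holder Z g B K beta : continuous g ->
  (forall x, `|g x| <= B) -> vmeas Z -> holder K beta g ->
  holder K beta (smooth Z g).
Proof.
move=> cg gB mZ hg x y.
rewrite /smooth -ExB; try exact: bmeas_shift gB _.
apply: Ex_norm_le; first by apply: bmeasB; exact: bmeas_shift gB _.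
move=> w; apply: (le_trans (hg _ _)).
by rewrite opprD addrACA subrr addr0.
Qed.

Lemma smoothB Z f g Bf Bg x : continuous f -> continuous g ->
  (forall x, `|f x| <= Bf) -> (forall x, `|g x| <= Bg) -> vmeas Z ->
  smooth Z (fun x => f x - g x) x = smooth Z f x - smooth Z g x.
Proof.
move=> cf cg fB gB mZ; rewrite /smooth ExB//; first exact: bmeas_shift fB _.
exact: bmeas_shift gB _.
Qed.

(** Freezing lemma: the part of the argument known at the time of [G1] may be
    frozen while the independent increment is integrated out. *)
Lemma Ex_freeze (G1 G2 : set (set T)) (xi : T -> R) (Y Z : T -> 'rV[R]_n) g B :
  indep P G1 G2 -> continuous g -> (forall x, `|g x| <= B) ->
  bmeas (xi : g_sigma_algebraType G1 -> R) ->
  vmeas (Y : g_sigma_algebraType G1 -> _) ->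
  vmeas (Z : g_sigma_algebraType G2 -> _) ->
  Ex P (fun w => xi w * g (Y w + Z w)) =
  Ex P (fun w => xi w * smooth Z g (Y w)).
Proof.
move=> ind cg gB [mxi [C xiC]] mY mZ.
have mZ' : vmeas Z.
  have [_ s2 _] := ind.
  by move=> i; exact: (measurableT_comp (mZ i) (measurable_id_salgebra s2)).
pose Phi (ww : g_sigma_algebraType G1 * g_sigma_algebraType G2) :=
  xi ww.1 * g (Y ww.1 + Z ww.2).
have bP : bmeas Phi.
  apply: bmeasM.
    apply: (bmeasI (B := C)) => //.
    exact: (measurableT_comp mxi measurable_fst).
  apply: bmeas_continuous_vector gB _ => //; apply: vmeasD => i.
    exact: (measurableT_comp (mY i) measurable_fst).
  exact: (measurableT_comp (mZ i) measurable_snd).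
rewrite (Ex_decouple ind bP); apply: eq_Ex => w.
by rewrite /Phi/= ExZ//; exact: bmeas_shift gB _.
Qed.

Lemma bmeas_salgebra (G : set (set T)) (f : T -> R) : G `<=` measurable ->
  bmeas (f : g_sigma_algebraType G -> R) -> bmeas f.
Proof.
move=> Gm [mf [B fB]]; apply: (bmeasI (B := B)) => //.
exact: (measurableT_comp mf (measurable_id_salgebra Gm)).
Qed.

Lemma vmeas_salgebra (G : set (set T)) (Y : T -> 'rV[R]_n) : G `<=` measurable ->
  vmeas (Y : g_sigma_algebraType G -> _) -> vmeas Y.
Proof.
by move=> Gm mY i; exact: (measurableT_comp (mY i) (measurable_id_salgebra Gm)).
Qed.

Lemma bmeas_smooth (G1 G2 : set (set T)) (Y Z : T -> 'rV[R]_n) g B :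
  indep P G1 G2 -> continuous g -> (forall x, `|g x| <= B) ->
  vmeas (Y : g_sigma_algebraType G1 -> _) ->
  vmeas (Z : g_sigma_algebraType G2 -> _) ->
  bmeas ((fun w => smooth Z g (Y w)) : g_sigma_algebraType G1 -> R).
Proof.
move=> ind cg gB mY mZ.
pose Phi (ww : g_sigma_algebraType G1 * g_sigma_algebraType G2) :=
  g (Y ww.1 + Z ww.2).
apply: (bmeas_partial_Ex ind (Phi := Phi)).
apply: bmeas_continuous_vector gB _ => //; apply: vmeasD => i.
  exact: (measurableT_comp (mY i) measurable_fst).
exact: (measurableT_comp (mZ i) measurable_snd).
Qed.

(** Semigroup property: smoothing by a sum of independent vectors is smoothing twice. *)
Lemma smooth_comp (G1 G2 : set (set T)) (Y Z : T -> 'rV[R]_n) g B x :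
  indep P G1 G2 -> continuous g -> (forall x, `|g x| <= B) ->
  vmeas (Y : g_sigma_algebraType G1 -> _) ->
  vmeas (Z : g_sigma_algebraType G2 -> _) ->
  smooth (fun w => Y w + Z w) g x = smooth Y (smooth Z g) x.
Proof.
move=> ind cg gB mY mZ; rewrite /smooth.
transitivity (Ex P (fun w => 1 * g ((x + Y w) + Z w))).
  by apply: eq_Ex => w; rewrite mul1r addrA.
rewrite (@Ex_freeze G1 G2 (fun=> 1) (fun w => x + Y w) Z g B)//.
- by apply: eq_Ex => w; rewrite mul1r.
- exact: bmeas_cst.
- by apply: vmeasD => //; exact: vmeas_cst.
Qed.

Lemma Ex_law (Y : T -> R) (Q : probability (measurableTypeR R) R) (F : R -> R) :
  measurable_fun setT Y ->
  (forall A, measurable A -> P [set w | A (Y w)] = Q A) ->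
  bmeas (F : measurableTypeR R -> R) -> Ex P (fun w => F (Y w)) = Ex Q F.
Proof.
move=> mY YQ bF.
have mY' : measurable_fun setT (Y : T -> measurableTypeR R) := mY.
pose mixin := isMeasurableFun.Build _ _ _ _ _ mY'.
pose Y' : {mfun T >-> measurableTypeR R} := HB.pack Y mixin.
rewrite /Ex /Rintegral; congr fine.
transitivity (\int[distribution P Y']_y (F y)%:E)%E.
  apply/esym/integral_distribution; first by apply/measurable_EFinP; case: bF.
  apply: bmeas_integrable; case: bF => mF [B FB].
  by apply: (bmeasI (B := B)) => //; exact: (measurableT_comp mF mY').
by apply: eq_measure_integral => A mA _; exact: YQ.
Qed.

Variables (tau : R) (Z : T -> 'rV[R]_n).
Hypotheses (tau0 : 0 < tau) (gZ : gauss_vec P tau Z).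
Let s := Num.sqrt tau.
Let s0 : 0 < s. Proof. by rewrite sqrtr_gt0. Qed.
Let mZ : vmeas Z := gauss_vec_meas gZ.

Let smooth_coord g B x i (h : R) : continuous g -> (forall x, `|g x| <= B) ->
  `|smooth Z g (x + h *: delta_mx 0 i) - smooth Z g x| <= 3 * B / s * `|h|.
Proof.
move=> cg gB.
pose Z1 w : 'rV[R]_n := \row_j (if j == i then 0 else Z w 0 j).
pose e : 'rV[R]_n := delta_mx 0 i.
have ZE w : Z w = Z1 w + Z w 0 i *: e.
  by apply/rowP => j; rewrite !mxE eqxx/=; case: eqVneq => [->|_]; rewrite ?mulr1 ?add0r// mulr0 addr0.
have ind := indep_sym (gauss_vec_indep gZ i).
set G1 := cylinder _ (~: _) in ind; set G2 := cylinder _ _ in ind.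
have mZ1 : vmeas (Z1 : g_sigma_algebraType G1 -> _).
  move=> j; rewrite (_ : (fun w => _) = fun w => if j == i then 0 else Z w 0 j).
    have [_|ji] := eqVneq j i; first exact: measurable_cst.
    by apply: (@measurable_cylinder _ _ _ _ (fun i w => Z w 0 i)); rewrite !inE.
  by apply/funext => w; rewrite mxE.
have mZ2 : vmeas ((fun w => Z w 0 i *: e) : g_sigma_algebraType G2 -> _).
  move=> j; rewrite (_ : (fun w => _) = fun w => Z w 0 i * e 0 j).
    apply: measurable_funM => //.
    by apply: (@measurable_cylinder _ _ _ _ (fun i w => Z w 0 i)); rewrite !inE.
  by apply/funext => w; rewrite mxE.
have cZ x' : smooth Z g x' = smooth Z1 (smooth (fun w => Z w 0 i *: e) g) x'.
  by rewrite -(smooth_comp _ ind cg gB)//; apply: eq_Ex => w; rewrite -ZE.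
have cF (z : 'rV[R]_n) : continuous (fun t : R => g (z + t *: e)).
  move=> t; apply: (@continuous_comp _ _ _ (fun t : R => z + t *: e) g); last exact: cg.
  apply: (@cvgD _ _ _ _ _ (fun=> z)); first exact: cvg_cst.
  by apply: (@cvgZl _ _ _ _ _ (fun t : R => t)) => //; exact: cvg_id.
have step z : `|smooth (fun w => Z w 0 i *: e) g (z + h *: e) -
    smooth (fun w => Z w 0 i *: e) g z| <= 3 * B / s * `|h|.
  rewrite [leRHS](_ : _ = 3 * B * (`|h| / s)); last by field; rewrite gt_eqF.
  have := normal_shift_tv h s0 (cF z) (fun t => gB _).
  have bF (f : R -> R) : continuous f -> (exists C, forall t, `|f t| <= C) -> bmeas f.
    by move=> cf [C fC]; apply: (bmeasI (B := C)) => //; exact: continuous_measurable_fun.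
  rewrite -(Ex_law (mZ i) (gauss_vec_law gZ i)); last first.
    by apply: bF; [exact: (@continuous_addr _ (fun t => g (z + t *: e)))|exists B].
  rewrite -(Ex_law (mZ i) (gauss_vec_law gZ i)); last by apply: bF; [|exists B].
  move=> H; rewrite (le_trans _ H)// le_eqVlt; apply/orP; left; apply/eqP.
  congr `|_ - _|; apply: eq_Ex => w; congr g.
  by rewrite scalerDl addrA addrAC.
rewrite !cZ /smooth.
have ccoord : forall z, bmeas (fun w => smooth (fun w => Z w 0 i *: e) g (z + Z1 w)).
  move=> z; have [s1 _ _] := ind; apply: (bmeas_salgebra s1).
  apply: (bmeas_smooth ind cg gB (Y := fun w => z + Z1 w)) => //.
  by apply: vmeasD => //; exact: vmeas_cst.
rewrite -(ExB P (ccoord (x + h *: e)) (ccoord x)).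
apply: Ex_norm_le; first by apply: bmeasB; exact: ccoord.
by move=> w; rewrite addrAC; exact: step.
Qed.

(** A translation of one coordinate is passed on to the density of that coordinate,
    the other ones being frozen by independence. *)
Lemma smooth_bounded_lipschitz g B x y : continuous g -> (forall x, `|g x| <= B) ->
  `|smooth Z g x - smooth Z g y| <= 3 * B / s * l1 (x - y).
Proof.
by move=> cg gB; apply: coordwise_lipschitz => z i h; exact: smooth_coord.
Qed.

(** For a Hölder function the constant improves to s ^ (beta - 1): split it into
    its Lipschitz regularization at scale [s] and a uniformly small rest. *)
Lemma smooth_holder_lipschitz g (B K beta : R) x y : (forall x, `|g x| <= B) ->
  0 < K -> 0 < beta < 1 -> holder K beta g ->
  `|smooth Z g x - smooth Z g y| <= 4 * K * s `^ (beta - 1) * l1 (x - y).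
Proof.
move=> gB K0 b01 hg; have /andP[b0 b1] := b01.
have cg := holder_continuous K0 b0 hg.
pose L := K * s `^ (beta - 1).
have L0 : 0 < L by rewrite mulr_gt0 ?powR_gt0.
pose f := inf_convolution L g.
have fg z : `|g z - f z| <= K * s `^ beta by exact: inf_convolution_dist gB _ _ _ _ _.
have fB z : `|f z| <= B + K * s `^ beta.
  have -> : f z = g z - (g z - f z) by ring.
  by rewrite (le_trans (ler_normB _ _))// lerD.
have fL z z' : `|f z - f z'| <= L * l1 (z - z').
  exact: (inf_convolution_lipschitz gB (ltW L0)).
have cf : continuous f.
  apply: (@holder_continuous _ _ L 1) => // z z'.
  by rewrite powRr1 ?l1_ge0.
have cgf : continuous (fun z => g z - f z).
  by move=> z; apply: continuousB; [exact: cg|exact: cf].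
have gE z : smooth Z g z = smooth Z f z + smooth Z (fun z => g z - f z) z.
  by rewrite (smoothB _ cg cf gB fB)//; ring.
rewrite !gE opprD addrACA (le_trans (ler_normD _ _))//.
have h1 : `|smooth Z f x - smooth Z f y| <= L * l1 (x - y).
  rewrite -[l1 (x - y)]powRr1 ?l1_ge0//.
  apply: (smooth_holder_holder cf fB mZ) => z z'.
  by rewrite powRr1 ?l1_ge0.
have h2 := smooth_bounded_lipschitz x y cgf fg.
apply: (le_trans (lerD h1 h2)); rewrite -mulrDl ler_wpM2r ?l1_ge0// /L.
have -> : s `^ beta = s * s `^ (beta - 1).
  rewrite -[X in X * _]powRr1 ?ltW// -powRD; first by congr (_ `^ _); ring.
  by rewrite (gt_eqF s0) implybT.
rewrite le_eqVlt; apply/orP; left; apply/eqP; field.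
by rewrite gt_eqF.
Qed.

End smoothing.

Section second_difference.
Context (R : realType) (n : nat) d (T : measurableType d) (P : probability T R).
Variables (G1 G2 : set (set T)) (tau : R) (Y Z : T -> 'rV[R]_n).
Hypotheses (ind : indep P G1 G2)
  (mY : vmeas (Y : g_sigma_algebraType G1 -> _))
  (mZ : vmeas (Z : g_sigma_algebraType G2 -> _))
  (tau0 : 0 < tau) (gY : gauss_vec P tau Y) (gZ : gauss_vec P tau Z).
Let s := Num.sqrt tau.
Let s0 : 0 < s. Proof. by rewrite sqrtr_gt0. Qed.
Variables (g : 'rV[R]_n -> R) (B K beta : R).
Hypotheses (gB : forall x, `|g x| <= B) (K0 : 0 < K) (b01 : 0 < beta < 1)
  (hg : holder K beta g).

Let cg : continuous g.
Proof. by move/andP: b01 => [b0 _]; exact: holder_continuous hg. Qed.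

Let g1 := smooth P Z g.
Let mZ' : vmeas Z := gauss_vec_meas gZ.
Let mY' : vmeas Y := gauss_vec_meas gY.

(** Second differences: half of the noise gains one derivative starting from
    Hölder regularity, the other half gains one more starting from boundedness. *)
Lemma smooth_second_difference x h k :
  `|smooth P (fun w => Y w + Z w) g (x + h + k)
    - smooth P (fun w => Y w + Z w) g (x + h)
    - (smooth P (fun w => Y w + Z w) g (x + k)
       - smooth P (fun w => Y w + Z w) g x)|
  <= 12 * K * s `^ (beta - 2) * l1 h * l1 k.
Proof.
have g1B z : `|g1 z| <= B by exact: smooth_bounded.
have hg1 : holder K beta g1 by exact: smooth_holder_holder gB mZ' hg.
have cg1 : continuous g1 by move/andP: b01 => [b0 _]; exact: holder_continuous hg1.
pose f (z : 'rV[R]_n) := g1 (z + k) - g1 z.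
have cg1k : continuous (fun z : 'rV[R]_n => g1 (z + k)).
  have b0 : 0 < beta by case/andP: b01.
  apply: (holder_continuous K0 b0) => z z'.
  by have := hg1 (z + k) (z' + k); rewrite opprD addrACA subrr addr0.
have cf : continuous f.
  by move=> z; exact: (continuousB (cg1k z) (cg1 z)).
have fB z : `|f z| <= 4 * K * s `^ (beta - 1) * l1 k.
  rewrite (le_trans (smooth_holder_lipschitz tau0 gZ _ _ gB K0 b01 hg))//.
  by rewrite addrAC subrr add0r.
have E z : smooth P (fun w => Y w + Z w) g z = smooth P Y g1 z.
  exact: smooth_comp ind cg gB mY mZ.
have Ek z : smooth P Y g1 (z + k) - smooth P Y g1 z = smooth P Y f z.
  have -> : smooth P Y g1 (z + k) = smooth P Y (fun z' => g1 (z' + k)) z.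
    by apply: eq_Ex => w; congr g1; rewrite addrAC.
  exact/esym/(smoothB P z cg1k cg1 (fun z => g1B _) g1B mY').
pose sub (a b : R) := a - b.
have eq := congr2 sub (etrans (congr2 sub (E (x + h + k)) (E (x + h))) (Ek (x + h)))
  (etrans (congr2 sub (E (x + k)) (E x)) (Ek x)).
have {eq}-> := congr1 Num.norm eq.
rewrite (le_trans (smooth_bounded_lipschitz tau0 gY _ _ cf fB))// -/s.
rewrite [x + h - x](_ : _ = h); last by rewrite addrAC subrr add0r.
have -> : s `^ (beta - 1) = s `^ (beta - 2) * s.
  rewrite -[X in _ * X]powRr1 ?ltW// -powRD; first by congr (_ `^ _); ring.
  by rewrite (gt_eqF s0) implybT.
rewrite le_eqVlt; apply/orP; left; apply/eqP; field.
by rewrite gt_eqF.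
Qed.

End second_difference.

(** * Moment bounds *)

Section Lp.
Context (R : realType) d (T : measurableType d) (P : probability T R) (q' : nat).
Hypothesis q'0 : (0 < q')%N.
Let q : R := q'%:R.
Implicit Types f g : T -> R.

(** Measurability travels with the bound because Minkowski's inequality asks for it. *)
Definition Lp f (a : R) : Prop :=
  measurable_fun setT f /\ ('N[P]_((q'%:R : R)%:E) [EFin \o f] <= a%:E)%E.

Let q0 : 0 < q. Proof. by rewrite ltr0n. Qed.
Let q1 : 1 <= q. Proof. by rewrite ler1n. Qed.
Let mq g : measurable_fun setT g -> measurable_fun setT (fun w => (`|g w| `^ q)%:E).
Proof.
move=> mg; apply/measurable_EFinP.
apply: (@measurableT_comp _ _ _ _ _ _ (@powR R ^~ q)) => //.
exact: measurableT_comp.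
Qed.

Let LnormE f : ('N[P]_(q%:E) [EFin \o f] `^ q = \int[P]_w (`|f w| `^ q)%:E)%E.
Proof. by rewrite powR_Lnorm ?gt_eqF//; apply: eq_integral => w _; rewrite /= poweR_EFin. Qed.

Lemma Lp_ge0 f a : Lp f a -> 0 <= a.
Proof. by move=> [_ h]; rewrite -lee_fin (le_trans _ h)// Lnorm_ge0. Qed.

Lemma Lp_moment f a : Lp f a -> (\int[P]_w (`|f w| `^ q)%:E <= (a `^ q)%:E)%E.
Proof.
move=> h; have a0 := Lp_ge0 h; case: h => _ h.
rewrite -LnormE -poweR_EFin; apply: gt0_ler_poweR (ltW q0) _ _ _ _ h.
  by rewrite in_itv/= Lnorm_ge0 leey.
by rewrite in_itv/= lee_fin a0 leey.
Qed.

Lemma moment_Lp f a : measurable_fun setT f -> 0 <= a ->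
  (\int[P]_w (`|f w| `^ q)%:E <= (a `^ q)%:E)%E -> Lp f a.
Proof.
move=> mf a0 h; split=> //.
have -> : ('N[P]_(q%:E) [EFin \o f] = (\int[P]_w (`|f w| `^ q)%:E) `^ q^-1)%E.
  by rewrite unlock; congr (_ `^ _)%E; apply: eq_integral => w _; rewrite /= poweR_EFin.
have -> : (a%:E = ((a `^ q)%:E `^ q^-1))%E.
  by rewrite poweR_EFin -powRrM mulfV ?gt_eqF// powRr1.
apply: gt0_ler_poweR h; first by rewrite invr_ge0 ltW.
  by rewrite in_itv/= leey andbT; apply: integral_ge0 => w _; rewrite lee_fin powR_ge0.
by rewrite in_itv/= leey andbT lee_fin powR_ge0.
Qed.

Lemma le_Lp f a g b : Lp f a -> measurable_fun setT g ->
  (forall w, `|g w| <= `|f w|) -> a <= b -> Lp g b.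
Proof.
move=> fa mg gf ab; have a0 := Lp_ge0 fa; have [mf _] := fa.
apply: moment_Lp => //; first exact: le_trans ab.
apply: (@le_trans _ _ (\int[P]_w (`|f w| `^ q)%:E)%E).
  apply: ge0_le_integral => //.
  - exact: mq.
  - exact: mq.
  - by move=> w _; rewrite lee_fin ge0_ler_powR ?nnegrE// ltW.
apply: (le_trans (Lp_moment fa)); rewrite lee_fin ge0_ler_powR ?nnegrE ?(ltW q0)//.
exact: le_trans ab.
Qed.

Lemma Lp_cst c : 0 <= c -> Lp (fun=> c) c.
Proof.
move=> c0; apply: moment_Lp => //; rewrite integral_cst//.
by move: (@probability_setT _ _ _ P) => /= ->; rewrite mule1 ger0_norm.
Qed.

Lemma Lp_bounded f c : measurable_fun setT f -> (forall w, `|f w| <= c) -> Lp f c.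
Proof.
move=> mf fc; have c0 : 0 <= c := le_trans (normr_ge0 _) (fc point).
by apply: (le_Lp (Lp_cst c0)) => // w; rewrite (ger0_norm c0).
Qed.

Lemma LpD f g a b : Lp f a -> Lp g b -> Lp (fun w => f w + g w) (a + b).
Proof.
move=> [mf fa] [mg gb]; split; first exact: measurable_funD.
by rewrite EFinD (le_trans (minkowski_EFin P mf mg q1))// leeD.
Qed.

Lemma LpN f a : Lp f a -> Lp (fun w => - f w) a.
Proof.
move=> fa; apply: (le_Lp fa) => //; last by move=> w; rewrite normrN.
by apply: measurableT_comp => //; case: fa.
Qed.

Lemma Lp_norm f a : Lp f a -> Lp (fun w => `|f w|) a.
Proof.
move=> fa; apply: (le_Lp fa) => //; last by move=> w; rewrite normr_id.
by apply: measurableT_comp => //; case: fa.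
Qed.

Lemma LpB f g a b : Lp f a -> Lp g b -> Lp (fun w => f w - g w) (a + b).
Proof. by move=> fa gb; apply: LpD => //; exact: LpN. Qed.

Lemma LpZ c f a : Lp f a -> Lp (fun w => c * f w) (`|c| * a).
Proof.
move=> fa; have [mf _] := fa; have a0 := Lp_ge0 fa.
apply: moment_Lp; [exact: measurable_funM|exact: mulr_ge0|].
under eq_integral do rewrite normrM powRM// EFinM.
rewrite ge0_integralZl_EFin ?powR_ge0//.
- by rewrite powRM// EFinM lee_wpmul2l ?lee_fin ?powR_ge0//; exact: Lp_moment.
- exact: mq.
Qed.

Lemma Lp_sum (I : Type) (r : seq I) (F : I -> T -> R) (a : I -> R) :
  (forall i, Lp (F i) (a i)) ->
  Lp (fun w => \sum_(i <- r) F i w) (\sum_(i <- r) a i).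
Proof.
move=> Fa; elim: r => [|i r ih].
  rewrite big_nil (_ : (fun w => _) = fun=> 0); first exact: Lp_cst.
  by apply/funext => w; rewrite big_nil.
rewrite big_cons (_ : (fun w => _) = fun w => F i w + \sum_(i <- r) F i w).
  exact: LpD.
by apply/funext => w; rewrite big_cons.
Qed.

(** Fatou's lemma for the q-th powers. *)
Lemma Lp_limit (F : nat -> T -> R) (a : nat -> R) f b :
  (forall k, Lp (F k) (a k)) -> measurable_fun setT f ->
  {ae P, forall w, F k w @[k --> \oo] --> f w} -> a k @[k --> \oo] --> b -> Lp f b.
Proof.
move=> Fa mf Ff ab.
have b0 : 0 <= b.
  rewrite -(cvg_lim _ ab)//; apply: limr_ge; first by apply/cvg_ex; exists b.
  by apply: nearW => k; exact: Lp_ge0 (Fa k).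
have cvgq (u : nat -> R) l : u n @[n --> \oo] --> l ->
    ((`|u n| `^ q)%:E @[n --> \oo] --> (`|l| `^ q)%:E)%E.
  move=> ul; apply: cvg_EFin; first exact: nearW.
  under eq_fun do rewrite powR_mulrn//.
  rewrite powR_mulrn//.
  have h : (fun n => `|u n|) @ \oo --> `|l| by exact: cvg_norm.
  exact: (cvg_comp _ _ h (@exprn_continuous _ q' _)).
apply: moment_Lp => //.
have -> : (\int[P]_w (`|f w| `^ q)%:E =
    \int[P]_w limn_einf (fun k => (`|F k w| `^ q)%:E))%E.
  apply: ae_eq_integral => //.
  - exact: mq.
  - rewrite (_ : (fun w => _) =
        (fun w => - limn_esup (fun k => - (`|F k w| `^ q)%:E))%E); last first.
      by apply/funext => w; rewrite -[LHS]oppeK -limn_esupN.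
    apply: measurableT_comp => //; apply: measurable_fun_limn_esup => k.
    by apply: measurableT_comp => //; apply: mq; case: (Fa k).
  - apply: filterS Ff => w Fw _.
    have cF := cvgq _ _ Fw.
    by rewrite is_cvg_limn_einfE; [apply/esym/cvg_lim|apply/cvg_ex; exists (`|f w| `^ q)%:E].
apply: (@le_trans _ _ (limn_einf (fun k => \int[P]_w (`|F k w| `^ q)%:E))%E).
  by apply: fatou => // k; apply: mq; case: (Fa k).
have ca := cvgq _ _ ab.
rewrite (ger0_norm b0) in ca.
rewrite -(cvg_lim _ ca)// limn_einf_lim; apply: lee_lim.
- exact: is_cvg_einfs.
- by apply/cvg_ex; exists (b `^ q)%:E.
- apply: nearW => k; rewrite (ger0_norm (Lp_ge0 (Fa k))).
  apply: le_trans (Lp_moment (Fa k)).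
  by apply: ereal_inf_lbound; exists k => /=.
Qed.

End Lp.

(** * A Burkholder inequality for discrete martingales *)

Section burkholder.
Context (R : realType).

(** All the terms beyond the linear one are dominated by the two extreme ones, whose
    expectations the moment recursion controls. *)
Lemma exprD_taylor2 (n : nat) (x y : R) :
  (x + y) ^+ n.+2 <= x ^+ n.+2 + n.+2%:R * (x ^+ n.+1 * y) +
    2 ^+ n.+2 * (`|x| ^+ n * y ^+ 2 + `|y| ^+ n.+2).
Proof.
rewrite exprDn big_ord_recl big_ord_recl /= subn0 expr0 mulr1 bin0 mulr1n.
rewrite addrA /bump/= subn1/= expr1 bin1 -mulr_natl lerD2l.
have cE : (2 ^+ n.+2 : R) = \sum_(i < n.+3) 'C(n.+2, i)%:R.
  rewrite -natrX (_ : 2%N = 1 + 1)%N// Pascal natr_sum.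
  by apply: eq_bigr => i _; rewrite !exp1n !muln1.
have r0 : 0 <= `|x| ^+ n * y ^+ 2 + `|y| ^+ n.+2.
  by apply: addr_ge0; [apply: mulr_ge0; [exact: exprn_ge0|exact: sqr_ge0]|exact: exprn_ge0].
rewrite cE (big_ord_recl n.+2) (big_ord_recl n.+1)/= mulrDl mulrDl -[leLHS]add0r; apply: lerD.
  exact: mulr_ge0.
rewrite -[leLHS]add0r; apply: lerD; first exact: mulr_ge0.
rewrite mulr_suml; apply: ler_sum => i _; rewrite /bump/= !add1n.
rewrite -mulr_natl ler_wpM2l//.
rewrite (le_trans (ler_norm _))// normrM !normrX.
have -> : (n.+2 - i.+2 = n - i)%N by rewrite !subSS.
have ile : (i <= n)%N by rewrite -ltnS.
have [xy|yx] := leP `|x| `|y|.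
  apply: (@le_trans _ _ (`|y| ^+ n.+2)); last first.
    by rewrite lerDr; apply: mulr_ge0; [exact: exprn_ge0|exact: sqr_ge0].
  have e : (n.+2 = (n - i) + i.+2)%N by rewrite !addnS subnK.
  by rewrite [in leRHS]e exprD ler_wpM2r ?exprn_ge0// lerXn2r ?nnegrE.
apply: (@le_trans _ _ (`|x| ^+ n * y ^+ 2)); last by rewrite lerDl exprn_ge0.
rewrite [X in _ <= _ ^+ X * _](_ : _ = (n - i) + i)%N; last by rewrite subnK.
rewrite exprD -mulrA ler_wpM2l ?exprn_ge0//.
rewrite -addn2 exprD -[y ^+ 2]real_normK ?num_real// ler_wpM2r ?exprn_ge0//.
by rewrite lerXn2r ?nnegrE// ltW.
Qed.

Lemma pow_mixed_le (m : nat) (x y : R) : 0 <= x -> 0 <= y ->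
  x ^+ m * y <= x ^+ m.+1 + y ^+ m.+1.
Proof.
move=> x0 y0; have [xy|yx] := leP x y.
  rewrite (le_trans (_ : _ <= y ^+ m.+1)) ?lerDr ?exprn_ge0// exprSr.
  by rewrite ler_wpM2r// lerXn2r ?nnegrE.
rewrite (le_trans (_ : _ <= x ^+ m.+1)) ?lerDl ?exprn_ge0// exprSr.
by rewrite ler_wpM2l ?exprn_ge0// ltW.
Qed.

(** The constant produced by the recursion on even moments; its growth in [m] is far
    from optimal. *)
Definition burkholder_const (m : nat) : R := 3 * 2 ^+ m.*2.

Context d (T : measurableType d) (P : probability T R).

Lemma even_moment_Lp (m : nat) (f : T -> R) (a : R) : bmeas f -> 0 <= a ->
  Lp P m.+1.*2 f a <-> Ex P (fun w => f w ^+ m.+1.*2) <= a ^+ m.+1.*2.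
Proof.
move=> bf a0.
have E : (\int[P]_w (`|f w| `^ m.+1.*2%:R)%:E = (Ex P (fun w => f w ^+ m.+1.*2))%:E)%E.
  rewrite ExE; last exact: bmeasX.
  apply: eq_integral => w _; rewrite powR_mulrn//; congr EFin.
  by rewrite -normrX ger0_norm// exprn_even_ge0// odd_double.
split.
  by move=> /Lp_moment; rewrite E powR_mulrn//; exact.
by move=> h; apply: moment_Lp => //; [case: bf|rewrite E powR_mulrn].
Qed.

(** Orthogonality of each increment to the previous partial sum kills the linear
    term in the expansion of the even moment, so squares of the increments add up. *)
Lemma martingale_Lp (m N : nat) (D : nat -> T -> R) (c : R) : 0 < c ->
  (forall k, bmeas (D k)) ->
  (forall k, (k < N)%N -> Lp P m.+1.*2 (D k) c) ->
  (forall k, (k < N)%N ->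
     Ex P (fun w => (\sum_(j < k) D j w) ^+ m.*2.+1 * D k w) = 0) ->
  Lp P m.+1.*2 (fun w => \sum_(j < N) D j w)
    (Num.sqrt (burkholder_const m.+1 * N.+1%:R) * c).
Proof.
move=> c0 bD DL orth.
set G := burkholder_const m.+1.
have G0 : 0 < G by rewrite mulr_gt0 ?exprn_gt0.
have G1 : 1 <= G.
  rewrite /G /burkholder_const (@le_trans _ _ (3 * 1))//; first by rewrite mulr1 ler1n.
  by rewrite ler_wpM2l// exprn_ege1// ler1n.
pose S k w := \sum_(j < k) D j w.
have bS k : bmeas (S k) by apply: bmeas_sum.
suff H k : (k <= N)%N -> Ex P (fun w => S k w ^+ m.+1.*2) <= (G * k.+1%:R * c ^+ 2) ^+ m.+1.
  apply/even_moment_Lp; [exact: bS|by rewrite mulr_ge0// ltW|].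
  apply: (le_trans (H N (leqnn N))).
  by rewrite -mul2n [leRHS]exprM [(_ * c) ^+ 2]exprMn sqr_sqrtr// mulr_ge0// ltW.
elim: k => [_|k ih kN].
  rewrite (_ : (fun w => _) = fun=> 0); last first.
    by apply/funext => w; rewrite /S big_ord0 doubleS expr0n.
  rewrite Ex_cst; apply: exprn_ge0; apply: mulr_ge0; last exact: sqr_ge0.
  by rewrite mulr1 ltW.
have {}ih := ih (ltnW kN).
set a := G * k.+1%:R * c ^+ 2 in ih *; set b := c ^+ 2.
have b0 : 0 < b by rewrite exprn_gt0.
have ba : b <= a.
  rewrite /a -[leLHS]mul1r ler_wpM2r ?(ltW b0)//.
  by rewrite -[leLHS]mulr1 ler_pM// ler1n.
have a0 : 0 < a := lt_le_trans b0 ba.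
have Db : Ex P (fun w => D k w ^+ m.+1.*2) <= b ^+ m.+1.
  have /even_moment_Lp := DL k kN; rewrite -mul2n [c ^+ _]exprM; apply => //.
  exact: ltW.
pose u w := S k w ^+ 2 / a; pose v w := D k w ^+ 2 / b.
have bu : bmeas u by apply: bmeasM; [exact: bmeasX|exact: bmeas_cst].
have bv : bmeas v by apply: bmeasM; [exact: bmeasX|exact: bmeas_cst].
have Eu : Ex P (fun w => u w ^+ m.+1) <= 1.
  rewrite (_ : (fun w => _) = fun w => (a ^+ m.+1)^-1 * S k w ^+ m.+1.*2).
    rewrite ExZ; last exact: bmeasX.
    by rewrite mulrC ler_pdivrMr ?exprn_gt0// mul1r.
  by apply/funext => w; rewrite /u expr_div_n -exprM mul2n mulrC.
have Ev : Ex P (fun w => v w ^+ m.+1) <= 1.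
  rewrite (_ : (fun w => _) = fun w => (b ^+ m.+1)^-1 * D k w ^+ m.+1.*2).
    rewrite ExZ; last exact: bmeasX.
    by rewrite mulrC ler_pdivrMr ?exprn_gt0// mul1r.
  by apply/funext => w; rewrite /v expr_div_n -exprM mul2n mulrC.
pose F w := S k w ^+ m.+1.*2 + m.+1.*2%:R * (S k w ^+ m.*2.+1 * D k w) +
  2 ^+ m.+1.*2 * ((a ^+ m * b) * (u w ^+ m.+1 + v w ^+ m.+1) + b ^+ m.+1 * v w ^+ m.+1).
have bXu : bmeas (fun w => u w ^+ m.+1) by exact: bmeasX.
have bXv : bmeas (fun w => v w ^+ m.+1) by exact: bmeasX.
have bc (e : R) f : bmeas f -> bmeas (fun w : T => e * f w).
  by move=> bf; apply: bmeasM => //; exact: bmeas_cst.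
have b1 : bmeas (fun w => S k w ^+ m.+1.*2) by exact: bmeasX.
have b2 : bmeas (fun w => S k w ^+ m.*2.+1 * D k w) by apply: bmeasM => //; exact: bmeasX.
have b3 : bmeas (fun w => u w ^+ m.+1 + v w ^+ m.+1) by exact: bmeasD.
have b4 : bmeas (fun w => (a ^+ m * b) * (u w ^+ m.+1 + v w ^+ m.+1) + b ^+ m.+1 * v w ^+ m.+1).
  by apply: bmeasD; exact: bc.
have bF : bmeas F by apply: bmeasD; [apply: bmeasD|]; rewrite //; exact: bc.
have ab0 : 0 <= a ^+ m * b := mulr_ge0 (exprn_ge0 _ (ltW a0)) (ltW b0).
have bm0 : 0 <= b ^+ m.+1 := exprn_ge0 _ (ltW b0).
have : Ex P (fun w => S k.+1 w ^+ m.+1.*2) <= Ex P F.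
  apply: le_Ex => //; first exact: bmeasX.
  move=> w; rewrite /S big_ord_recr/= -/(S k w) !doubleS.
  apply: (le_trans (exprD_taylor2 _ _ _)); rewrite /F !doubleS lerD2l ler_wpM2l ?exprn_ge0//.
  have -> : `|S k w| ^+ m.*2 * D k w ^+ 2 = (a ^+ m * b) * (u w ^+ m * v w).
    rewrite /u /v -mul2n exprM real_normK ?num_real// expr_div_n.
    by field; rewrite (gt_eqF b0) expf_neq0// gt_eqF.
  have -> : `|D k w| ^+ m.*2.+2 = b ^+ m.+1 * v w ^+ m.+1.
    rewrite /v -doubleS -mul2n exprM real_normK ?num_real// expr_div_n.
    by field; rewrite expf_neq0// gt_eqF.
  rewrite lerD2r ler_wpM2l//.
  by apply: pow_mixed_le; rewrite divr_ge0 ?sqr_ge0 ?(ltW a0) ?(ltW b0).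
move/le_trans; apply.
have -> : Ex P F = Ex P (fun w => S k w ^+ m.+1.*2) +
  2 ^+ m.+1.*2 * ((a ^+ m * b) * (Ex P (fun w => u w ^+ m.+1) + Ex P (fun w => v w ^+ m.+1)) +
    b ^+ m.+1 * Ex P (fun w => v w ^+ m.+1)).
  rewrite /F ExD; [|by apply: bmeasD => //; exact: bc|exact: bc].
  rewrite ExD//; last exact: bc.
  rewrite (ExZ P m.+1.*2%:R b2) orth// mulr0 addr0 ExZ//.
  by rewrite ExD; [|exact: bc|exact: bc]; rewrite !ExZ// ExD.
apply: (@le_trans _ _ (a ^+ m.+1 + 2 ^+ m.+1.*2 * ((a ^+ m * b) * (1 + 1) + b ^+ m.+1 * 1))).
  rewrite lerD// ler_wpM2l ?exprn_ge0//.
  by rewrite lerD// ler_wpM2l// lerD.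
have h1 : b ^+ m.+1 <= a ^+ m * b.
  by rewrite exprSr ler_wpM2r ?(ltW b0)// lerXn2r ?nnegrE ?(ltW a0) ?(ltW b0).
apply: (@le_trans _ _ (a ^+ m.+1 + G * (a ^+ m * b))).
  rewrite lerD2l (_ : G * _ = 2 ^+ m.+1.*2 * (3 * (a ^+ m * b))).
    by apply: ler_wpM2l; [exact: exprn_ge0|lra].
  by rewrite /G /burkholder_const; ring.
have -> : G * k.+2%:R * b = a + G * b by rewrite /a -/b -[k.+2]addn1 natrD; ring.
rewrite exprSr [leRHS]exprSr.
rewrite (_ : _ + _ = a ^+ m * (a + G * b)); last by ring.
have Gb0 : 0 <= G * b by rewrite mulr_ge0// ltW.
rewrite ler_wpM2r ?addr_ge0 ?(ltW a0)//.
by rewrite lerXn2r ?nnegrE ?addr_ge0 ?(ltW a0)// lerDl.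
Qed.


(** Dyadic sewing.  [A j c] approximates a quantity on the c-th of [2 ^ j] equal
    intervals; halving the interval changes the approximation by a martingale
    increment, whose squares add up over the level, and by a smaller error, which
    adds up linearly. *)
Lemma dyadic_sewing (p m : nat) (A M E : nat -> nat -> T -> R)
    (F : nat -> nat -> set (set T)) (a : R) (mu eps : nat -> R) :
  (forall j c, (j < m)%N -> (c < 2 ^ j)%N -> forall w,
     A j c w = A j.+1 (2 * c)%N w + A j.+1 (2 * c).+1 w + M j c w + E j c w) ->
  (forall j i c, (j < m)%N -> (i < c)%N -> (c < 2 ^ j)%N ->
     bmeas (M j i : g_sigma_algebraType (F j c) -> R)) ->
  (forall j c xi, (j < m)%N -> (c < 2 ^ j)%N ->
     bmeas (xi : g_sigma_algebraType (F j c) -> R) ->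
     Ex P (fun w => xi w * M j c w) = 0) ->
  (forall j c, (j < m)%N -> (c < 2 ^ j)%N -> bmeas (M j c)) ->
  (forall j, 0 < mu j) ->
  (forall j c, (j < m)%N -> (c < 2 ^ j)%N -> Lp P p.+1.*2 (M j c) (mu j)) ->
  (forall j c, (j < m)%N -> (c < 2 ^ j)%N -> Lp P p.+1.*2 (E j c) (eps j)) ->
  Lp P p.+1.*2 (A 0%N 0%N) a ->
  Lp P p.+1.*2 (fun w => \sum_(c < 2 ^ m) A m c w)
    (a + \sum_(j < m) (Num.sqrt (burkholder_const p.+1 * (2 ^ j).+1%:R) * mu j +
                       (2 ^ j)%:R * eps j)).
Proof.
move=> AE Mad Morth bM mu0 Mmu Eeps Aa.
have q0 : (0 < p.+1.*2)%N by [].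
suff H k : (k <= m)%N -> Lp P p.+1.*2 (fun w => \sum_(c < 2 ^ k) A k c w)
    (a + \sum_(j < k) (Num.sqrt (burkholder_const p.+1 * (2 ^ j).+1%:R) * mu j +
                       (2 ^ j)%:R * eps j)) by exact: H.
elim: k => [_|k ih km].
  rewrite big_ord0 addr0 (_ : (fun w => _) = A 0%N 0%N)//.
  by apply/funext => w; rewrite expn0 big_ord_recl big_ord0 addr0.
have {}ih := ih (ltnW km).
pose M' c : T -> R := if (c < 2 ^ k)%N then M k c else fun=> 0.
have LM : Lp P p.+1.*2 (fun w => \sum_(c < 2 ^ k) M' c w)
    (Num.sqrt (burkholder_const p.+1 * (2 ^ k).+1%:R) * mu k).
  apply: martingale_Lp => //.
  - by move=> c; rewrite /M'; case: ifPn => ck; [exact: bM|exact: bmeas_cst].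
  - by move=> c ck; rewrite /M' ck; exact: Mmu.
  - move=> c ck; rewrite /M' ck.
    apply: (Morth _ _ (fun w => (\sum_(j < c) M' j w) ^+ p.*2.+1)) => //.
    apply: bmeasX; apply: bmeas_sum => i _.
    by rewrite /M' (ltn_trans (ltn_ord i) ck); exact: Mad.
have LE : Lp P p.+1.*2 (fun w => \sum_(c < 2 ^ k) E k c w) (\sum_(c < 2 ^ k) eps k).
  by apply: Lp_sum => // c; exact: Eeps.
rewrite big_ord_recr/=.
have -> : (2 ^ k)%:R * eps k = \sum_(c < 2 ^ k) eps k by rewrite sumr_const card_ord mulr_natl.
rewrite addrA addrA.
rewrite (_ : (fun w => _) = fun w => (\sum_(c < 2 ^ k) A k c w - \sum_(c < 2 ^ k) M' c w) -
   \sum_(c < 2 ^ k) E k c w).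
  by apply: LpB => //; apply: LpB.
apply/funext => w.
have -> : \sum_(c < 2 ^ k.+1) A k.+1 c w =
    \sum_(c < 2 ^ k) (A k.+1 (2 * c)%N w + A k.+1 (2 * c).+1 w).
  rewrite expnS; elim: (2 ^ k)%N => [|l ihl]; first by rewrite muln0 !big_ord0.
  by rewrite mulnS !addSn add0n !big_ord_recr/= ihl addrA.
rewrite -!sumrB; apply: eq_bigr => c _.
by rewrite /M' ltn_ord (AE k c)//; ring.
Qed.

End burkholder.

(** * Discrete stochastic sewing *)

Section power_sums.
Context (R : realType).

(** The sum of the geometric series of ratio 2 ^ (g - 1). *)
Definition power_sum_const (g : R) : R := 1 + (2 `^ (1 - g) - 1)^-1.

Lemma power_sum_const_ge1 g : g < 1 -> 1 <= power_sum_const g.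
Proof.
move=> g1; rewrite /power_sum_const lerDl invr_ge0 subr_ge0.
by rewrite -[leLHS](powRr0 2) ler_powR ?subr_ge0 ?ler1n ?ltW.
Qed.

(** Discrete form of the integrability of u ^ (- g) at zero; doubling the length
    of the sum replaces the comparison with an integral. *)
Lemma power_sum_le (g h : R) (l : nat) : 0 <= g < 1 -> 0 < h ->
  \sum_(i < 2 ^ l) h * (i.+1%:R * h) `^ (- g) <=
    power_sum_const g * ((2 ^ l)%:R * h) `^ (1 - g).
Proof.
move=> /andP[g0 g1] h0; set C := power_sum_const g.
have p1 : 1 < 2 `^ (1 - g) :> R.
  by rewrite /powR pnatr_eq0/= -[ltLHS]expR0 ltr_expR; apply: mulr_gt0; [lra|apply: ln_gt0; lra].
have CE : C * (2 `^ (1 - g) - 1) = (2 `^ (1 - g) - 1) + 1.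
  by rewrite /C /power_sum_const mulrDl mul1r mulVf// gt_eqF// subr_gt0.
have hpow x : 0 < x -> x * x `^ (- g) = x `^ (1 - g).
  move=> x0; rewrite -[X in X * _]powRr1 ?(ltW x0)// -powRD//.
  by rewrite (gt_eqF x0) implybT.
elim: l => [|l ih].
  rewrite expn0 big_ord_recl big_ord0 addr0 mul1r hpow// ler_peMl ?powR_ge0//.
  exact: power_sum_const_ge1.
rewrite expnS mul2n -addnn big_split_ord/=.
set X := ((2 ^ l)%:R * h) `^ (1 - g) in ih *.
have L0 : 0 < (2 ^ l)%:R * h by rewrite mulr_gt0// ltr0n expn_gt0.
have X0 : 0 <= X by exact: powR_ge0.
have -> : ((2 ^ l + 2 ^ l)%:R * h) `^ (1 - g) = 2 `^ (1 - g) * X.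
  by rewrite -powRM ?ltW// natrD; congr (_ `^ _); ring.
have tail : \sum_(i < 2 ^ l) h * ((2 ^ l + i).+1%:R * h) `^ (- g) <= X.
  rewrite /X -hpow// -mulrA (_ : _ * (h * _) = \sum_(i < 2 ^ l) h * ((2 ^ l)%:R * h) `^ (- g)); last first.
    by rewrite sumr_const card_ord mulr_natl.
  apply: ler_sum => i _; rewrite ler_wpM2l ?(ltW h0)//.
  rewrite !powRN lef_pV2 ?posrE ?powR_gt0//; last by rewrite mulr_gt0.
  rewrite ge0_ler_powR ?nnegrE ?(ltW L0)//; first by rewrite mulr_ge0// ltW.
  by rewrite ler_wpM2r ?(ltW h0)// ler_nat -addSn ltnW// ltn_addr.
apply: (le_trans (lerD ih tail)).
rewrite -[X in _ + X]mul1r -mulrDl mulrA ler_wpM2r//.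
have -> : C * 2 `^ (1 - g) = C * (2 `^ (1 - g) - 1) + C by ring.
by rewrite CE; lra.
Qed.

Definition geometric_const (g : R) : R := (2 `^ g - 1)^-1.

Lemma geometric_sum_le (g h : R) (m : nat) : 0 < g -> 0 < h ->
  \sum_(l < m) ((2 ^ l)%:R * h) `^ g <= geometric_const g * ((2 ^ m)%:R * h) `^ g.
Proof.
move=> g0 h0.
have p1 : 1 < 2 `^ g :> R.
  by rewrite /powR pnatr_eq0/= -[ltLHS]expR0 ltr_expR; apply: mulr_gt0 => //; apply: ln_gt0; lra.
elim: m => [|m ih].
  by rewrite big_ord0 mulr_ge0 ?powR_ge0// invr_ge0 subr_ge0 ltW.
rewrite big_ord_recr/=.
set X := ((2 ^ m)%:R * h) `^ g in ih *.
have -> : ((2 ^ m.+1)%:R * h) `^ g = 2 `^ g * X.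
  by rewrite -powRM ?mulr_ge0 ?(ltW h0)// expnS natrM; congr (_ `^ _); ring.
apply: (le_trans (lerD ih (lexx X))).
rewrite le_eqVlt; apply/orP; left; apply/eqP.
rewrite /geometric_const; field.
by rewrite gt_eqF// subr_gt0.
Qed.

End power_sums.

Section sewing.
Context (R : realType) (n : nat) d (T : measurableType d) (P : probability T R).
Context (tmax : R) (W : R -> T -> 'rV[R]_n).
Hypotheses (wW : wiener_process P tmax W) (cP : measure_is_complete P).
Variables (f : R -> 'rV[R]_n -> R) (B K beta : R).
Hypotheses (K0 : 0 < K) (b01 : 0 < beta < 1).
Hypothesis fB : forall t x, 0 <= t <= tmax -> `|f t x| <= B.
Hypothesis fH : forall t, 0 <= t <= tmax -> holder K beta (f t).

Let b0 : 0 < beta. Proof. by case/andP: b01. Qed.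
Let b1 : beta < 1. Proof. by case/andP: b01. Qed.
Let cf t : 0 <= t <= tmax -> continuous (f t).
Proof. by move=> /fH; exact: holder_continuous. Qed.

Notation past := (past_events P W).
Notation pastT t := (g_sigma_algebraType (past_events P W t)).

(** Conditional expectation, at time [u], of f(r, x + W_r - W_u). *)
Definition heat (u r : R) : 'rV[R]_n -> R :=
  smooth P (fun w => W r w - W u w) (f r).

Let inc_cyl (u r : R) : vmeas ((fun w => W r w - W u w) :
  g_sigma_algebraType (cylinder (fun i w => (W r w - W u w) 0 i) [set: 'I_n]%SET) -> _).
Proof.
move=> i; apply: (@measurable_cylinder _ _ _ _ (fun i w => (W r w - W u w) 0 i)).
exact: finset.in_setT.
Qed.

Let inc_past (u r t : R) : 0 <= u <= t -> 0 <= r <= t ->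
  vmeas ((fun w => W r w - W u w) : pastT t -> _).
Proof.
by move=> ut rt; apply: (@vmeasB _ _ _ (pastT t)) => i; exact: measurable_past_wiener.
Qed.

Let inc_meas (u r : R) : 0 <= u <= tmax -> 0 <= r <= tmax ->
  vmeas (fun w => W r w - W u w).
Proof. by move=> ut rt; apply: vmeasB; exact: wiener_vmeas wW _ _. Qed.

Lemma heat_refl r x : heat r r x = f r x.
Proof.
rewrite /heat /smooth (_ : (fun w => _) = fun=> f r x) ?Ex_cst//.
by apply/funext => w; rewrite subrr addr0.
Qed.

Lemma heat_bounded (u r : R) x : 0 <= u <= tmax -> 0 <= r <= tmax ->
  `|heat u r x| <= B.
Proof.
move=> ut rt; apply: smooth_bounded; [exact: cf|by move=> y; exact: fB|].
exact: inc_meas.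
Qed.

Lemma heat_holder (u r : R) : 0 <= u <= tmax -> 0 <= r <= tmax ->
  holder K beta (heat u r).
Proof.
move=> ut rt.
exact: (smooth_holder_holder P (cf rt) (fun x => fB x rt) (inc_meas ut rt) (fH rt)).
Qed.

Lemma heat_continuous (u r : R) : 0 <= u <= tmax -> 0 <= r <= tmax ->
  continuous (heat u r).
Proof. by move=> ut rt; apply: (holder_continuous K0 b0); exact: heat_holder. Qed.

Let sqrt_powR (tau a : R) : 0 < tau -> Num.sqrt tau `^ a = tau `^ (a / 2).
Proof. by move=> t0; rewrite -powR12_sqrt ?(ltW t0)// -powRrM mulrC. Qed.

(** The noise accumulated between [u] and [r] has standard deviation (r - u)^(1/2). *)
Lemma heat_lipschitz (u r : R) x y : 0 <= u -> u < r -> r <= tmax ->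
  `|heat u r x - heat u r y| <= 4 * K * (r - u) `^ (- ((1 - beta) / 2)) * l1 (x - y).
Proof.
move=> u0 ur rT.
have rt : 0 <= r <= tmax by apply/andP; split; lra.
have ru : 0 < r - u by lra.
have := smooth_holder_lipschitz ru (wiener_increment_gauss wW u0 ur rT) x y
  (fun x => fB x rt) K0 b01 (fH rt).
by rewrite sqrt_powR// (_ : (beta - 1) / 2 = - ((1 - beta) / 2)) //; field.
Qed.

(** Translating the pair (x, y) by x' - x is a second difference, in the directions
    x - y and x' - x; putting the second point right is a first difference. *)
Lemma heat_four_points (u r : R) x y x' y' : 0 <= u -> u < r -> r <= tmax ->
  `|heat u r x - heat u r y - (heat u r x' - heat u r y')| <=
    4 * K * (r - u) `^ (- ((1 - beta) / 2)) * l1 ((x - y) - (x' - y')) +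
    24 * K * (r - u) `^ (- (1 - beta / 2)) * l1 (x - x') * l1 (x - y).
Proof.
move=> u0 ur rT.
have rt : 0 <= r <= tmax by apply/andP; split; lra.
pose v := (u + r) / 2.
have uv : u < v by rewrite /v; lra.
have vr : v < r by rewrite /v; lra.
have v0 : 0 <= v by lra.
have vT : v <= tmax by lra.
set tau := (r - u) / 2.
have tau0 : 0 < tau by rewrite /tau; lra.
have gY := wiener_increment_gauss wW u0 uv vT.
have gZ := wiener_increment_gauss wW v0 vr rT.
rewrite (_ : v - u = tau) in gY; last by rewrite /v /tau; field.
rewrite (_ : r - v = tau) in gZ; last by rewrite /v /tau; field.
have ind := past_increment_indep wW cP v0 vr rT.
have mY : vmeas ((fun w => W v w - W u w) : pastT v -> _).
  by apply: inc_past; apply/andP; split; lra.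
have heatE z : heat u r z = smooth P (fun w => (W v w - W u w) + (W r w - W v w)) (f r) z.
  by apply: eq_Ex => w; congr (f r (_ + _)); rewrite [RHS]addrC addrA subrK.
have H2 := smooth_second_difference ind mY (@inc_cyl v r) tau0 gY gZ (fun x => fB x rt)
  K0 b01 (fH rt) x' (x - x') (y - x).
rewrite -!heatE in H2.
have E1 : x' + (x - x') = x by rewrite addrC subrK.
have E2 : x' + (x - x') + (y - x) = y by rewrite E1 addrC subrK.
rewrite E2 E1 in H2.
set z := x' + (y - x) in H2.
have H1 := heat_lipschitz y' z u0 ur rT.
have -> : heat u r x - heat u r y - (heat u r x' - heat u r y') =
    (heat u r y' - heat u r z) - (heat u r y - heat u r x - (heat u r z - heat u r x')).
  by ring.
apply: (le_trans (ler_normB _ _)); apply: lerD.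
  rewrite (_ : y' - z = (x - y) - (x' - y')) in H1 => //.
  by apply/rowP => i; rewrite /z !mxE; ring.
apply: (le_trans H2).
rewrite (_ : l1 (y - x) = l1 (x - y)); last by rewrite -l1N opprB.
rewrite ler_wpM2r ?l1_ge0// ler_wpM2r ?l1_ge0//.
rewrite sqrt_powR//.
rewrite [24 * K](_ : _ = 12 * K * 2); last by ring.
rewrite -[leRHS]mulrA ler_wpM2l ?mulr_ge0 ?(ltW K0)//.
rewrite /tau powRM; [|lra|lra].
rewrite (_ : (beta - 2) / 2 = - (1 - beta / 2)); last by field.
rewrite mulrC ler_wpM2r ?powR_ge0//.
have -> : 2^-1 `^ (- (1 - beta / 2)) = 2 `^ (1 - beta / 2) :> R.
  by rewrite -[X in X `^ _]powR_inv1// -powRrM mulN1r opprK.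
by rewrite -[leRHS]powRr1// ler_powR ?ler1n//; have := b0; lra.
Qed.

(** The increments over [u, w] and [w, r] are independent. *)
Lemma heat_semigroup (u w r : R) x : 0 <= u <= w -> w <= r -> r <= tmax ->
  heat u r x = smooth P (fun o => W w o - W u o) (heat w r) x.
Proof.
move=> /andP[u0 uw] wr rT.
have rt : 0 <= r <= tmax by apply/andP; split; lra.
move: wr; rewrite le_eqVlt => /predU1P[wr|wr].
  rewrite -wr /heat; apply: eq_Ex => o; by rewrite -/(heat w w _) heat_refl.
have ind := past_increment_indep wW cP (le_trans u0 uw) wr rT.
rewrite -(smooth_comp _ ind (cf rt) (fun x => fB x rt)).
- by apply: eq_Ex => o; congr (f r (_ + _)); rewrite [RHS]addrC addrA subrK.
- by apply: inc_past; apply/andP; split; lra.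
- exact: inc_cyl.
Qed.

Lemma bmeas_heat_past (w r : R) (Y : T -> 'rV[R]_n) : 0 <= w <= tmax ->
  0 <= r <= tmax -> vmeas (Y : pastT w -> _) ->
  bmeas ((fun o => heat w r (Y o)) : pastT w -> R).
Proof.
move=> wt rt mY; apply: (bmeas_continuous_vector (B := B)) => //.
- exact: heat_continuous.
- by move=> x; exact: heat_bounded.
Qed.

(** Martingale property: advancing the conditioning from [u] to [w] with the
    known position frozen at [u] is orthogonal to the past of [u]. *)
Lemma heat_orthogonal (u w r : R) (xi : T -> R) (Y : T -> 'rV[R]_n) :
  0 <= u -> u < w -> w <= r -> r <= tmax ->
  bmeas (xi : pastT u -> R) -> vmeas (Y : pastT u -> _) ->
  Ex P (fun o => xi o * heat u r (Y o)) =
  Ex P (fun o => xi o * heat w r (Y o + (W w o - W u o))).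
Proof.
move=> u0 uw wr rT bxi mY.
have wT : w <= tmax by lra.
have wt : 0 <= w <= tmax by apply/andP; split; lra.
have rt : 0 <= r <= tmax by apply/andP; split; lra.
have ind := past_increment_indep wW cP u0 uw wT.
apply/esym; apply: (etrans (Ex_freeze ind (heat_continuous wt rt)
  (fun x => heat_bounded x wt rt) bxi mY (@inc_cyl u w))); apply/esym.
apply: eq_Ex => o; rewrite (@heat_semigroup u w r)//.
by rewrite u0 ltW.
Qed.

#[local] Opaque heat.

Variables (phi psi : R -> T -> 'rV[R]_n) (Lam : R).
Hypothesis aphi : forall t, 0 <= t <= tmax -> vmeas (phi t : pastT t -> _).
Hypothesis apsi : forall t, 0 <= t <= tmax -> vmeas (psi t : pastT t -> _).
Hypothesis phiL : forall s t o, 0 <= s <= tmax -> 0 <= t <= tmax ->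
  l1 (phi t o - phi s o) <= Lam * `|t - s|.
Hypothesis psiL : forall s t o, 0 <= s <= tmax -> 0 <= t <= tmax ->
  l1 (psi t o - psi s o) <= Lam * `|t - s|.

(** Both the solution and the Euler approximation are of this form, with a drift that
    is Lipschitz in time; all the roughness is in [W]. *)
Definition perturbed (chi : R -> T -> 'rV[R]_n) t o : 'rV[R]_n := W t o + chi t o.

Let perturbed_vmeas chi t : 0 <= t <= tmax -> vmeas (chi t : pastT t -> _) ->
  vmeas (perturbed chi t : pastT t -> _).
Proof.
move=> /andP[t0 tT] mchi; apply: (@vmeasD _ _ _ (pastT t)) => // i.
by apply: measurable_past_wiener; rewrite t0 lexx.
Qed.

Let past_le (s t : R) (g : T -> R) : s <= t -> bmeas (g : pastT s -> R) ->
  bmeas (g : pastT t -> R).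
Proof.
move=> st [mg [C gC]]; apply: (bmeasI (B := C)) => // _ A mA.
by rewrite setTI; apply: (past_eventsS st); rewrite -[g @^-1` A]setTI; exact: mg.
Qed.

Let past_vle (s t : R) (Y : T -> 'rV[R]_n) : s <= t ->
  vmeas (Y : pastT s -> _) -> vmeas (Y : pastT t -> _).
Proof.
move=> st mY i _ A mA.
by rewrite setTI; apply: (past_eventsS st); rewrite -[_ @^-1` A]setTI; exact: mY.
Qed.

Definition gap t o : R := l1 (phi t o - psi t o).

(** Conditional expectation at [w] of f(r, X_r) - f(r, Y_r), the drifts of both
    paths being frozen at the earlier time [u]. *)
Definition frozen (u w r : R) (o : T) : R :=
  heat w r (perturbed phi u o + (W w o - W u o)) -
  heat w r (perturbed psi u o + (W w o - W u o)).

Let frozenE (u w r : R) o : frozen u w r o =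
  heat w r (perturbed phi u o + (W w o - W u o)) -
  heat w r (perturbed psi u o + (W w o - W u o)).
Proof. by []. Qed.

Lemma frozen_past (u w r : R) : 0 <= u <= w -> w <= tmax -> 0 <= r <= tmax ->
  bmeas (frozen u w r : pastT w -> R).
Proof.
move=> /andP[u0 uw] wT rt.
have wt : 0 <= w <= tmax by apply/andP; split; lra.
have ut : 0 <= u <= tmax by apply/andP; split; lra.
have H chi : vmeas (chi u : pastT u -> _) ->
    bmeas ((fun o => heat w r (perturbed chi u o + (W w o - W u o))) : pastT w -> R).
  move=> mchi; apply: bmeas_heat_past => //; apply: (@vmeasD _ _ _ (pastT w)).
    by apply: (past_vle uw); exact: perturbed_vmeas.
  by apply: inc_past; apply/andP; split; lra.
by apply: bmeasB; apply: H; [exact: aphi|exact: apsi].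
Qed.

Lemma frozen_bounded (u w r : R) o : 0 <= w <= tmax -> 0 <= r <= tmax ->
  `|frozen u w r o| <= 2 * B.
Proof.
move=> wt rt; rewrite (le_trans (ler_normB _ _))//.
apply: (le_trans (lerD (heat_bounded _ wt rt) (heat_bounded _ wt rt))).
by rewrite mulr_natl.
Qed.

(** Noise over [w, r] has been averaged out, and averaging makes [f] Lipschitz. *)
Lemma frozen_gap (u w r : R) o : 0 <= w -> w < r -> r <= tmax ->
  `|frozen u w r o| <= 4 * K * (r - w) `^ (- ((1 - beta) / 2)) * gap u o.
Proof.
move=> w0 wr rT; apply: (le_trans (heat_lipschitz _ _ w0 wr rT)).
rewrite (_ : _ - _ = phi u o - psi u o)//.
by apply/rowP => i; rewrite /perturbed !mxE; ring.
Qed.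

#[local] Opaque frozen.

(** Martingale increments produced by halving [u, r] at [w]. *)
Lemma frozen_orthogonal (u w r : R) (xi : T -> R) : 0 <= u -> u < w -> w <= r ->
  r <= tmax -> bmeas (xi : pastT u -> R) -> Ex P (fun o => xi o * (frozen u u r o - frozen u w r o)) = 0.
Proof.
move=> u0 uw wr rT bxi.
have wT : w <= tmax by lra.
have rt : 0 <= r <= tmax by apply/andP; split; lra.
have ut : 0 <= u <= tmax by apply/andP; split; lra.
have wt : 0 <= w <= tmax by apply/andP; split; lra.
have bxi' : bmeas xi := bmeas_salgebra (past_events_measurable wW cP ut) bxi.
have Hm chi (v : R) : u <= v -> v <= tmax -> vmeas (chi u : pastT u -> _) ->
    bmeas (fun o => heat v r (perturbed chi u o + (W v o - W u o))).
  move=> uv vT mchi; have vt : 0 <= v <= tmax by apply/andP; split; lra.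
  apply: (bmeas_salgebra (past_events_measurable wW cP vt)).
  apply: bmeas_heat_past => //; apply: (@vmeasD _ _ _ (pastT v)).
    by apply: (past_vle uv); exact: perturbed_vmeas.
  by apply: inc_past; apply/andP; split; lra.
have H chi : vmeas (chi u : pastT u -> _) ->
    Ex P (fun o => xi o * heat u r (perturbed chi u o + (W u o - W u o))) =
    Ex P (fun o => xi o * heat w r (perturbed chi u o + (W w o - W u o))).
  move=> mchi; apply: etrans (heat_orthogonal u0 uw wr rT bxi (perturbed_vmeas ut mchi)).
  by apply: eq_Ex => o; congr (xi o * heat u r _); rewrite subrr addr0.
have mphi := aphi ut; have mpsi := apsi ut.
have Hf (v : R) : u <= v -> v <= tmax ->
    Ex P (fun o => xi o * frozen u v r o) =
    Ex P (fun o => xi o * heat v r (perturbed phi u o + (W v o - W u o))) -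
    Ex P (fun o => xi o * heat v r (perturbed psi u o + (W v o - W u o))).
  move=> uv vT; rewrite -ExB; [|apply: bmeasM => //; exact: Hm..].
  by apply: eq_Ex => o; rewrite frozenE mulrBr.
have bf (v : R) : u <= v -> v <= tmax -> bmeas (fun o => xi o * frozen u v r o).
  move=> uv vT; apply: bmeasM => //.
  by rewrite (funext (@frozenE u v r)); apply: bmeasB; exact: Hm.
transitivity (Ex P (fun o => xi o * frozen u u r o - xi o * frozen u w r o)).
  by apply: eq_Ex => o; rewrite mulrBr.
rewrite ExB; [|by apply: bf => //; lra|by apply: bf => //; lra].
have uu : u <= u by []; have uT : u <= tmax by lra.
apply: (etrans (congr2 (fun a b : R => a - b) (Hf u uu uT) (Hf w (ltW uw) wT))).
apply: (etrans (congr2 (fun a b : R => a - b - _) (H phi mphi) (H psi mpsi))).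
exact: subrr.
Qed.

(** Updating the frozen drifts from [u] to [w] changes the distance between the two
    paths, by the increment of phi - psi, and translates both, by at most
    Lam (w - u).  The translation is common, so it only costs a second difference. *)
Lemma frozen_drift (u w r : R) o : 0 <= u -> u <= w -> w < r -> r <= tmax ->
  `|frozen u w r o - frozen w w r o| <=
    4 * K * (r - w) `^ (- ((1 - beta) / 2)) *
      l1 ((phi w o - psi w o) - (phi u o - psi u o)) +
    24 * K * Lam * (r - w) `^ (- (1 - beta / 2)) * (w - u) * gap u o.
Proof.
move=> u0 uw wr rT.
have ut : 0 <= u <= tmax by apply/andP; split; lra.
have wt : 0 <= w <= tmax by apply/andP; split; lra.
have w0 : 0 <= w by lra.
set x := perturbed phi u o + (W w o - W u o).
set y := perturbed psi u o + (W w o - W u o).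
have -> : frozen u w r o - frozen w w r o = heat w r x - heat w r y -
    (heat w r (perturbed phi w o) - heat w r (perturbed psi w o)).
  apply: (congr2 (fun a b : R => a - b)); first exact: frozenE.
  by apply: etrans (frozenE _ _ _ _) _; rewrite subrr !addr0.
apply: (le_trans (heat_four_points x y (perturbed phi w o) (perturbed psi w o) w0 wr rT)).
have xy : x - y = phi u o - psi u o.
  by apply/rowP => i; rewrite /x /y /perturbed !mxE; ring.
have xx : x - perturbed phi w o = - (phi w o - phi u o).
  by apply/rowP => i; rewrite /x /perturbed !mxE; ring.
have xyE : x - y - (perturbed phi w o - perturbed psi w o) =
    - ((phi w o - psi w o) - (phi u o - psi u o)).
  by apply/rowP => i; rewrite /x /y /perturbed !mxE; ring.
rewrite xyE xy xx !l1N lerD2l -/(gap u o) ler_wpM2r ?l1_ge0//.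
have := phiL o ut wt; rewrite ger0_norm ?subr_ge0// => phiLo.
rewrite [leRHS](_ : _ = 24 * K * (r - w) `^ (- (1 - beta / 2)) * (Lam * (w - u))).
  by rewrite ler_wpM2l// !mulr_ge0// ?powR_ge0// ltW.
by ring.
Qed.

(** At the end of the dyadic refinement only the drifts over one mesh interval
    remain to be released. *)
Lemma frozen_release (u r : R) o : 0 <= u <= r -> r <= tmax ->
  `|frozen u r r o - frozen r r r o| <= 2 * K * (Lam * (r - u)) `^ beta.
Proof.
move=> /andP[u0 ur] rT.
have ut : 0 <= u <= tmax by apply/andP; split; lra.
have rt : 0 <= r <= tmax by apply/andP; split; lra.
set x := perturbed phi u o + (W r o - W u o).
set y := perturbed psi u o + (W r o - W u o).
have -> : frozen u r r o - frozen r r r o = (f r x - f r (perturbed phi r o)) -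
    (f r y - f r (perturbed psi r o)).
  rewrite [frozen u r r o]frozenE [frozen r r r o]frozenE subrr !addr0 !heat_refl -/x -/y.
  move: (f r x) (f r y) (f r _) (f r _) => a a' b b'; ring.
apply: (le_trans (ler_normB _ _)).
have Lr0 : 0 <= Lam * (r - u).
  by apply: le_trans (l1_ge0 _) _; have := phiL o ut rt; rewrite ger0_norm ?subr_ge0//; exact.
have H chi : (forall s t o, 0 <= s <= tmax -> 0 <= t <= tmax ->
    l1 (chi t o - chi s o) <= Lam * `|t - s|) ->
    `|f r (perturbed chi u o + (W r o - W u o)) - f r (perturbed chi r o)| <= K * (Lam * (r - u)) `^ beta.
  move=> chiL; apply: (le_trans (fH rt _ _)).
  rewrite ler_wpM2l ?(ltW K0)// ge0_ler_powR ?nnegrE ?l1_ge0 ?(ltW b0)//.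
  rewrite (_ : _ - _ = - (chi r o - chi u o)); last first.
    by apply/rowP => i; rewrite /perturbed !mxE; ring.
  by rewrite l1N; have := chiL _ _ o ut rt; rewrite ger0_norm ?subr_ge0.
apply: (le_trans (lerD (H _ phiL) (H _ psiL))).
by rewrite -mulrA mulr_natl.
Qed.

Lemma frozen_now (r : R) o : frozen r r r o = f r (perturbed phi r o) - f r (perturbed psi r o).
Proof. by rewrite frozenE subrr !addr0 !heat_refl. Qed.

End sewing.

(** The dyadic bookkeeping uses only a few properties of conditional expectations with
    frozen drifts.  [fr u w r] is the one at time [w] of the difference of the rates at
    time [r], the drifts being frozen at [u]; [gap] is the distance between the drifts
    and [dgap] the size of its increment.  The exponents gamma1 and gamma2 are the
    singularities of first and second differences. *)
Section grid.
Context (R : realType) d (T : measurableType d) (P : probability T R).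
Variables (tmax beta B C1 C2 C3 : R) (F : R -> set (set T)).
Variables (fr : R -> R -> R -> T -> R) (gap : R -> T -> R) (dgap : R -> R -> T -> R).
Hypotheses (b01 : 0 < beta < 1) (B0 : 0 < B) (C10 : 0 < C1) (C20 : 0 <= C2) (C30 : 0 <= C3).
Let gamma1 := (1 - beta) / 2.
Let gamma2 := 1 - beta / 2.
Hypothesis Fm : forall t, 0 <= t <= tmax -> F t `<=` measurable.
Hypothesis Fmono : forall (s t : R) (g : T -> R), s <= t ->
  bmeas (g : g_sigma_algebraType (F s) -> R) -> bmeas (g : g_sigma_algebraType (F t) -> R).
Hypothesis fr_past : forall u w r : R, 0 <= u <= w -> w <= tmax -> 0 <= r <= tmax ->
  bmeas (fr u w r : g_sigma_algebraType (F w) -> R).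
Hypothesis fr_bounded : forall (u w r : R) o, 0 <= w <= tmax -> 0 <= r <= tmax ->
  `|fr u w r o| <= 2 * B.
Hypothesis fr_orth : forall (u w r : R) (xi : T -> R), 0 <= u -> u < w -> w <= r ->
  r <= tmax -> bmeas (xi : g_sigma_algebraType (F u) -> R) ->
  Ex P (fun o => xi o * (fr u u r o - fr u w r o)) = 0.
Hypothesis fr_gap : forall (u w r : R) o, 0 <= w -> w < r -> r <= tmax ->
  `|fr u w r o| <= C1 * (r - w) `^ (- gamma1) * gap u o.
Hypothesis fr_drift : forall (u w r : R) o, 0 <= u -> u <= w -> w < r -> r <= tmax ->
  `|fr u w r o - fr w w r o| <= C1 * (r - w) `^ (- gamma1) * dgap u w o +
    C2 * (r - w) `^ (- gamma2) * (w - u) * gap u o.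
Hypothesis gap_ge0 : forall u o, 0 <= gap u o.
Hypothesis dgap_ge0 : forall u w o, 0 <= dgap u w o.
Hypothesis fr_release : forall (u r : R) o, 0 <= u <= r -> r <= tmax ->
  `|fr u r r o - fr r r r o| <= C3 * (r - u) `^ beta.

Variables (p m : nat) (s0 h V N0 : R).
Hypotheses (s00 : 0 <= s0) (h0 : 0 < h) (V0 : 0 <= V) (N00 : 0 < N0).
Hypothesis sT : s0 + (2 ^ m)%:R * h <= tmax.
Let q := p.+1.*2.
Let tk (k : nat) : R := s0 + k%:R * h.
Let len : R := (2 ^ m)%:R * h.
Hypothesis gapN : forall k, (k <= 2 ^ m)%N -> Lp P q (gap (tk k)) N0.
Hypothesis dgapV : forall k l, (k <= l <= 2 ^ m)%N ->
  Lp P q (dgap (tk k) (tk l)) (V * (tk l - tk k) `^ 2^-1).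

Let q_gt0 : (0 < q)%N. Proof. by []. Qed.
Let b0 : 0 < beta. Proof. by case/andP: b01. Qed.
Let b1 : beta < 1. Proof. by case/andP: b01. Qed.
Let gamma1_01 : 0 <= gamma1 < 1.
Proof. by rewrite /gamma1; have := b0; have := b1; move=> ? ?; apply/andP; split; lra. Qed.
Let gamma2_01 : 0 <= gamma2 < 1.
Proof. by rewrite /gamma2; have := b0; have := b1; move=> ? ?; apply/andP; split; lra. Qed.

Let tkT k : (k <= 2 ^ m)%N -> 0 <= tk k <= tmax.
Proof.
move=> km; rewrite /tk addr_ge0//=; last by rewrite mulr_ge0// ltW.
by apply: le_trans sT; rewrite lerD2l ler_wpM2r ?(ltW h0)// ler_nat.
Qed.

Let tk_lt k l : (k < l)%N -> tk k < tk l.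
Proof. by move=> kl; rewrite /tk ltrD2l ltr_pM2r// ltr_nat. Qed.

Let tk_le k l : (k <= l)%N -> tk k <= tk l.
Proof. by move=> kl; rewrite /tk lerD2l ler_wpM2r ?(ltW h0)// ler_nat. Qed.

Let tkB k l : tk (k + l) - tk k = l%:R * h.
Proof. by rewrite /tk natrD; ring. Qed.

Let fr_meas (u w r : R) : 0 <= u <= w -> w <= tmax -> 0 <= r <= tmax ->
  bmeas (fr u w r).
Proof.
move=> uw wT rT; apply: bmeas_salgebra (fr_past uw wT rT).
by apply: Fm; case/andP: uw => ? ?; apply/andP; split => //; lra.
Qed.

(* Blocks of the level-[j] partition start at multiples of 2 ^ (m - j). *)
Let start j c := (c * 2 ^ (m - j))%N.
Let half j := (2 ^ (m - j.+1))%N.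
Let middle j c := (start j c + half j)%N.

Let halfE j : (j < m)%N -> (2 ^ (m - j) = half j + half j)%N.
Proof. by move=> jm; rewrite addnn -mul2n /half -expnS -subSn// subSS. Qed.

Let block_end j c : (j <= m)%N -> (c < 2 ^ j)%N -> (start j c + 2 ^ (m - j) <= 2 ^ m)%N.
Proof.
move=> jm cj; rewrite /start -mulSnr.
by rewrite -[X in (_ <= 2 ^ X)%N](subnKC jm) expnD leq_mul2r cj orbT.
Qed.

(* [germ] is the Riemann sum over a block with everything frozen at its start.  When
   the block is halved, the right half is first conditioned on the past of the middle
   point, which is the martingale part, and then has its drifts updated there. *)
Let germ j c o : R := \sum_(i < 2 ^ (m - j))
  h * fr (tk (start j c)) (tk (start j c)) (tk (start j c + i.+1)) o.
Let mart j c o : R := \sum_(i < half j)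
  h * (fr (tk (start j c)) (tk (start j c)) (tk (middle j c + i.+1)) o -
       fr (tk (start j c)) (tk (middle j c)) (tk (middle j c + i.+1)) o).
Let drift j c o : R := \sum_(i < half j)
  h * (fr (tk (start j c)) (tk (middle j c)) (tk (middle j c + i.+1)) o -
       fr (tk (middle j c)) (tk (middle j c)) (tk (middle j c + i.+1)) o).

Let germ_split j c : (j < m)%N -> (c < 2 ^ j)%N -> forall o,
  germ j c o = germ j.+1 (2 * c)%N o + germ j.+1 (2 * c).+1 o + mart j c o + drift j c o.
Proof.
move=> jm cj o.
have e1 : start j.+1 (2 * c)%N = start j c.
  by rewrite /start (halfE jm) -/(half j) addnn -mul2n mulnCA mulnA.
have e2 : start j.+1 (2 * c).+1 = middle j c.
  by rewrite /middle -e1 /start -/(half j) mulSnr.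
rewrite -[RHS]addrA /mart /drift -big_split/=.
rewrite /germ e1 e2 (halfE jm) big_split_ord/= -/(half j).
rewrite -!big_split/=; apply: eq_bigr => i _.
by rewrite /middle -addnS addnA; ring.
Qed.

Section level.
Variables (j c : nat).
Hypotheses (jm : (j < m)%N) (cj : (c < 2 ^ j)%N).
Let delta : R := (half j)%:R * h.

Let half_gt0 : (0 < half j)%N. Proof. by rewrite expn_gt0. Qed.
Let delta0 : 0 < delta. Proof. by rewrite mulr_gt0// ltr0n. Qed.
Let last_le : (middle j c + half j <= 2 ^ m)%N.
Proof. by have := block_end (ltnW jm) cj; rewrite halfE// addnA. Qed.
Let middle_le : (middle j c <= 2 ^ m)%N.
Proof. exact: leq_trans (leq_addr _ _) last_le. Qed.
Let start_le : (start j c <= 2 ^ m)%N.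
Proof. exact: leq_trans (leq_addr _ _) middle_le. Qed.
Let start_ge0 : 0 <= tk (start j c). Proof. by case/andP: (tkT start_le). Qed.
Let middle_ge0 : 0 <= tk (middle j c). Proof. by case/andP: (tkT middle_le). Qed.
Let middleT : tk (middle j c) <= tmax. Proof. by case/andP: (tkT middle_le). Qed.
Let start_middle : tk (start j c) < tk (middle j c).
Proof. by apply: tk_lt; rewrite /middle -[ltnLHS]addn0 ltn_add2l. Qed.
Let point_le (i : 'I_(half j)) : (middle j c + i.+1 <= 2 ^ m)%N.
Proof. by apply: leq_trans last_le; rewrite leq_add2l. Qed.
Let pointT (i : 'I_(half j)) : tk (middle j c + i.+1) <= tmax.
Proof. by case/andP: (tkT (point_le i)). Qed.
Let middle_point (i : 'I_(half j)) : tk (middle j c) < tk (middle j c + i.+1).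
Proof. by apply: tk_lt; rewrite addnS ltnS leq_addr. Qed.
Let deltaE : tk (middle j c) - tk (start j c) = delta.
Proof. by rewrite /middle tkB. Qed.

Lemma grid_mart_past (t : R) : tk (middle j c) <= t ->
  bmeas (mart j c : g_sigma_algebraType (F t) -> R).
Proof.
move=> mt; apply: (Fmono mt); apply: bmeas_sum => i _; apply: bmeasM.
  exact: bmeas_cst.
have pT := tkT (point_le i).
apply: bmeasB; last first.
  by apply: fr_past; rewrite ?start_ge0 ?(ltW start_middle).
apply: (Fmono (ltW start_middle)); apply: fr_past => //.
  by rewrite start_ge0 lexx.
by case/andP: (tkT start_le).
Qed.

Lemma grid_mart_meas : bmeas (mart j c).
Proof. by apply: bmeas_salgebra (grid_mart_past (lexx _)); exact: Fm (tkT middle_le). Qed.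

Lemma grid_mart_orth (xi : T -> R) :
  bmeas (xi : g_sigma_algebraType (F (tk (start j c))) -> R) ->
  Ex P (fun o => xi o * mart j c o) = 0.
Proof.
move=> bxi.
have bxi' : bmeas xi := bmeas_salgebra (Fm (tkT start_le)) bxi.
transitivity (Ex P (fun o => \sum_(i < half j) h * (xi o *
    (fr (tk (start j c)) (tk (start j c)) (tk (middle j c + i.+1)) o -
     fr (tk (start j c)) (tk (middle j c)) (tk (middle j c + i.+1)) o)))).
  by apply: eq_Ex => o; rewrite mulr_sumr; apply: eq_bigr => i _; rewrite mulrCA.
have bi (i : 'I_(half j)) : bmeas (fun o => xi o *
    (fr (tk (start j c)) (tk (start j c)) (tk (middle j c + i.+1)) o -
     fr (tk (start j c)) (tk (middle j c)) (tk (middle j c + i.+1)) o)).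
  apply: bmeasM => //; apply: bmeasB; apply: fr_meas => //.
  - by rewrite start_ge0 lexx.
  - by case/andP: (tkT start_le).
  - exact: tkT (point_le i).
  - by rewrite start_ge0 ltW.
  - exact: tkT (point_le i).
rewrite Ex_sum => [|i]; last by apply: bmeasM => //; exact: bmeas_cst.
apply: big1 => i _; rewrite ExZ//.
by rewrite (fr_orth start_ge0 start_middle (ltW (middle_point i)) (pointT i) bxi) mulr0.
Qed.

Let tkBm (i : nat) : tk (middle j c + i.+1) - tk (middle j c) = i.+1%:R * h.
Proof. exact: tkB. Qed.

Let pow_sum g : 0 <= g < 1 ->
  \sum_(i < half j) h * (tk (middle j c + i.+1) - tk (middle j c)) `^ (- g) <=
    power_sum_const g * delta `^ (1 - g).
Proof.
move=> g01; under eq_bigr do rewrite tkBm.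
exact: power_sum_le.
Qed.

(* Both conditionings of the difference are bounded by the more singular one. *)
Let mart_bound o : `|mart j c o| <=
  2 * C1 * power_sum_const gamma1 * delta `^ (1 - gamma1) * gap (tk (start j c)) o.
Proof.
rewrite (le_trans (ler_norm_sum _ _ _))//.
apply: (@le_trans _ _ (\sum_(i < half j) (2 * C1 * gap (tk (start j c)) o) *
   (h * (tk (middle j c + i.+1) - tk (middle j c)) `^ (- gamma1)))); last first.
  rewrite -mulr_sumr (le_trans (ler_wpM2l _ (pow_sum gamma1_01)))//.
    by rewrite !mulr_ge0// ltW.
  by rewrite le_eqVlt; apply/orP; left; apply/eqP; ring.
apply: ler_sum => i _; rewrite normrM (gtr0_norm h0) mulrCA ler_wpM2l ?(ltW h0)//.
have h2 := fr_gap (tk (start j c)) o middle_ge0 (middle_point i) (pointT i).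
have sp := lt_trans start_middle (middle_point i).
have h1 := fr_gap (tk (start j c)) o start_ge0 sp (pointT i).
have h3 : (tk (middle j c + i.+1) - tk (start j c)) `^ (- gamma1) <=
    (tk (middle j c + i.+1) - tk (middle j c)) `^ (- gamma1).
  rewrite !powRN lef_pV2 ?posrE ?powR_gt0 ?subr_gt0//.
  apply: ge0_ler_powR; rewrite ?nnegrE ?subr_ge0.
  - by case/andP: gamma1_01.
  - exact: ltW (middle_point i).
  - exact: ltW sp.
  - by rewrite lerD2l lerN2 ltW.
apply: (le_trans (ler_normB _ _)); apply: (le_trans (lerD h1 h2)).
set x := (_ `^ _) in h3 *; set y := (_ `^ _) in h3 *.
have : C1 * x * gap (tk (start j c)) o <= C1 * y * gap (tk (start j c)) o.
  by rewrite ler_wpM2r// ler_wpM2l// ltW.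
by move/(lerD)/(_ (lexx (C1 * y * gap (tk (start j c)) o)))/le_trans; apply; lra.
Qed.

Let drift_bound o : `|drift j c o| <=
  C1 * power_sum_const gamma1 * delta `^ (1 - gamma1) * dgap (tk (start j c)) (tk (middle j c)) o
  + C2 * power_sum_const gamma2 * delta `^ (1 - gamma2) * delta * gap (tk (start j c)) o.
Proof.
rewrite (le_trans (ler_norm_sum _ _ _))//.
pose D := dgap (tk (start j c)) (tk (middle j c)) o; pose G := gap (tk (start j c)) o.
apply: (@le_trans _ _ (\sum_(i < half j) (
   (C1 * D) * (h * (tk (middle j c + i.+1) - tk (middle j c)) `^ (- gamma1)) +
   (C2 * delta * G) * (h * (tk (middle j c + i.+1) - tk (middle j c)) `^ (- gamma2))))).
  apply: ler_sum => i _; rewrite normrM (gtr0_norm h0).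
  have := fr_drift o start_ge0 (ltW start_middle) (middle_point i) (pointT i).
  rewrite deltaE -/D -/G => H.
  apply: (le_trans (ler_wpM2l (ltW h0) H)).
  by rewrite le_eqVlt; apply/orP; left; apply/eqP; ring.
rewrite big_split/=; apply: lerD; rewrite -mulr_sumr.
  rewrite (le_trans (ler_wpM2l _ (pow_sum gamma1_01)))//.
    by rewrite mulr_ge0 ?(ltW C10)// dgap_ge0.
  by rewrite le_eqVlt; apply/orP; left; apply/eqP; rewrite /D; ring.
rewrite (le_trans (ler_wpM2l _ (pow_sum gamma2_01)))//.
  by rewrite mulr_ge0 ?gap_ge0// mulr_ge0// ltW.
by rewrite le_eqVlt; apply/orP; left; apply/eqP; rewrite /G; ring.
Qed.

Let delta_gap : Lp P q (dgap (tk (start j c)) (tk (middle j c))) (V * delta `^ 2^-1).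
Proof.
by rewrite -deltaE; apply: dgapV; rewrite leq_addr.
Qed.

Let delta_pow (g e : R) : 0 < g -> delta `^ g * delta `^ e = delta `^ (g + e).
Proof. by move=> _; rewrite -powRD// (gt_eqF delta0) implybT. Qed.

Lemma grid_mart_Lp : Lp P q (mart j c)
  (2 * C1 * power_sum_const gamma1 * N0 * delta `^ (1 - gamma1)).
Proof.
have k0 : 0 <= 2 * C1 * power_sum_const gamma1 * delta `^ (1 - gamma1).
  have := power_sum_const_ge1 (proj2 (andP gamma1_01)).
  by move=> h1; rewrite !mulr_ge0 ?powR_ge0 ?(ltW C10)//; lra.
apply: (le_Lp q_gt0 (LpZ q_gt0 (2 * C1 * power_sum_const gamma1 * delta `^ (1 - gamma1)) (gapN start_le)));
  first by case: grid_mart_meas.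
  move=> o; apply: (le_trans (mart_bound o)); rewrite normrM (ger0_norm k0).
  by rewrite ler_wpM2l// ler_norm.
by rewrite (ger0_norm k0) mulrAC.
Qed.

Lemma grid_drift_Lp : Lp P q (drift j c)
  ((C1 * power_sum_const gamma1 * V + C2 * power_sum_const gamma2 * N0) *
   delta `^ (1 + beta / 2)).
Proof.
have c1 := power_sum_const_ge1 (proj2 (andP gamma1_01)).
have c2 := power_sum_const_ge1 (proj2 (andP gamma2_01)).
set k1 := C1 * power_sum_const gamma1 * delta `^ (1 - gamma1).
set k2 := C2 * power_sum_const gamma2 * delta `^ (1 - gamma2) * delta.
have k10 : 0 <= k1 by rewrite !mulr_ge0 ?powR_ge0 ?(ltW C10)//; lra.
have k20 : 0 <= k2.
  by apply: mulr_ge0 (ltW delta0); apply: mulr_ge0 (powR_ge0 _ _); apply: mulr_ge0 => //; lra.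
have H := LpD q_gt0 (LpZ q_gt0 k1 delta_gap) (LpZ q_gt0 k2 (gapN start_le)).
apply: (le_Lp q_gt0 H).
- apply: bmeas_meas; apply: bmeas_sum => i _; apply: bmeasM; first exact: bmeas_cst.
  have pT := tkT (point_le i).
  apply: bmeasB; apply: fr_meas => //; first by rewrite start_ge0 ltW.
  by rewrite middle_ge0 lexx.
- move=> o; apply: (le_trans (drift_bound o)); apply: ler_norm.
- rewrite (ger0_norm k10) (ger0_norm k20) /k1 /k2.
  have e1 : delta `^ (1 - gamma1) * delta `^ 2^-1 = delta `^ (1 + beta / 2).
    rewrite delta_pow; last by have /andP[_ ?] := gamma1_01; rewrite subr_gt0.
    by congr (_ `^ _); rewrite /gamma1; field.
  have e2 : delta `^ (1 - gamma2) * delta = delta `^ (1 + beta / 2).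
    rewrite -[X in _ * X = _]powRr1 ?(ltW delta0)// delta_pow; last first.
      by have /andP[_ ?] := gamma2_01; rewrite subr_gt0.
    by congr (_ `^ _); rewrite /gamma2; field.
  rewrite mulrDl -{1}e1 -e2.
  by rewrite le_eqVlt; apply/orP; left; apply/eqP; ring.
Qed.

End level.

Let Gam : R := burkholder_const R p.+1.
Let ca : R := 2 * C1 * power_sum_const gamma1 * Num.sqrt Gam +
  C1 * power_sum_const gamma1 + C2 * power_sum_const gamma2.

Let c1_ge1 : 1 <= power_sum_const gamma1.
Proof. by apply: power_sum_const_ge1; case/andP: gamma1_01. Qed.
Let c2_ge1 : 1 <= power_sum_const gamma2.
Proof. by apply: power_sum_const_ge1; case/andP: gamma2_01. Qed.
Let k1_ge0 : 0 <= C1 * power_sum_const gamma1.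
Proof. by rewrite mulr_ge0 ?(ltW C10)// (le_trans ler01). Qed.
Let k2_ge0 : 0 <= C2 * power_sum_const gamma2.
Proof. by rewrite mulr_ge0// (le_trans ler01). Qed.
Let Gam_ge0 : 0 <= Gam. Proof. by rewrite /Gam /burkholder_const mulr_ge0// exprn_ge0. Qed.
Let len0 : 0 < len. Proof. by rewrite /len mulr_gt0// ltr0n expn_gt0. Qed.
Let hl : R := len `^ 2^-1.
Let hl2 : hl * hl = len.
Proof.
rewrite /hl -powRD; last by rewrite (gt_eqF len0) implybT.
by rewrite (_ : 2^-1 + 2^-1 = 1) ?powRr1 ?ltW//; field.
Qed.
Let hl_ge0 : 0 <= hl. Proof. exact: powR_ge0. Qed.

(* The 2^j martingale increments of the level add up in square, hence a factor
   2^(j/2) only; both contributions end up with the spare power beta/2 of the block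
   length, which makes the levels summable. *)
Let level_bound j : (j < m)%N ->
  Num.sqrt (Gam * (2 ^ j).+1%:R) *
    (2 * C1 * power_sum_const gamma1 * N0 * ((half j)%:R * h) `^ (1 - gamma1)) +
  (2 ^ j)%:R * ((C1 * power_sum_const gamma1 * V + C2 * power_sum_const gamma2 * N0) *
    ((half j)%:R * h) `^ (1 + beta / 2)) <=
  ca * (hl * (1 + hl)) * (V + N0) * ((half j)%:R * h) `^ (beta / 2).
Proof.
move=> jm; set dl := (half j)%:R * h.
have dl0 : 0 < dl by rewrite mulr_gt0// ltr0n expn_gt0.
have lenE : (2 ^ j)%:R * (dl * 2) = len.
  rewrite /len /dl /half -[X in _ = (2 ^ X)%:R * h](subnKC jm).
  by rewrite addSn expnS expnD !natrM; ring.
have pdl g e : 0 < g -> dl `^ g * dl `^ e = dl `^ (g + e).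
  by move=> _; rewrite -powRD// (gt_eqF dl0) implybT.
have e1 : dl `^ (1 - gamma1) = dl `^ 2^-1 * dl `^ (beta / 2).
  by rewrite pdl ?invr_gt0//; congr (_ `^ _); rewrite /gamma1; field.
have e2 : dl `^ (1 + beta / 2) = dl * dl `^ (beta / 2).
  by rewrite -(pdl 1)// powRr1 ?(ltW dl0).
have s1 : Num.sqrt (Gam * (2 ^ j).+1%:R) * dl `^ 2^-1 <= Num.sqrt Gam * hl.
  have Gj : 0 <= Gam * (2 ^ j).+1%:R by rewrite mulr_ge0.
  rewrite /hl (powR12_sqrt (ltW dl0)) (powR12_sqrt (ltW len0)).
  rewrite -(sqrtrM _ Gj) -(sqrtrM _ Gam_ge0).
  apply: ler_wsqrtr; rewrite -mulrA; apply: ler_wpM2l => //.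
  have -> : len = (2 ^ j * 2)%:R * dl by rewrite -lenE natrM; ring.
  rewrite ler_pM2r// ler_nat muln2 -addnn -addn1 leq_add2l expn_gt0.
  by [].
have s2 : (2 ^ j)%:R * dl <= len.
  by rewrite -lenE ler_wpM2l//; move: dl0; move: (dl) => x; lra.
set x := dl `^ (beta / 2) in e1 e2 *; have x0 : 0 <= x by exact: powR_ge0.
have kk1 := k1_ge0; have kk2 := k2_ge0.
set c1 := C1 * power_sum_const gamma1 in kk1 *.
set c2 := C2 * power_sum_const gamma2 in kk2 *.
rewrite e1 e2.
have -> : ca * (hl * (1 + hl)) * (V + N0) * x =
   2 * c1 * Num.sqrt Gam * hl * N0 * x + (c1 * V + c2 * N0) * (hl * hl) * x
   + ((2 * c1 * Num.sqrt Gam * (hl * V + hl * hl * (V + N0))) + c1 * (hl * (V + N0)) +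
      c1 * (hl * hl) * N0 + c2 * (hl * (V + N0)) + c2 * (hl * hl) * V) * x.
  by rewrite /ca -/c1 -/c2 /c1; ring.
rewrite -[leLHS]addr0; apply: lerD.
  apply: lerD.
    rewrite (_ : _ * (_ * _) = (Num.sqrt (Gam * (2 ^ j).+1%:R) * dl `^ 2^-1) * (2 * c1 * N0 * x)); last by rewrite /c1; ring.
    rewrite [leRHS](_ : _ = (Num.sqrt Gam * hl) * (2 * c1 * N0 * x)); last by ring.
    by rewrite ler_wpM2r// mulr_ge0// (mulr_ge0 _ (ltW N00))// mulr_ge0.
  rewrite hl2 (_ : _ * (_ * _) = (c1 * V + c2 * N0) * ((2 ^ j)%:R * dl) * x); last by ring.
  have V0N : 0 <= c1 * V + c2 * N0 by apply: addr_ge0; [exact: mulr_ge0 kk1 V0|exact: mulr_ge0 kk2 (ltW N00)].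
  rewrite ler_wpM2r//; exact: ler_wpM2l.
have VN : 0 <= V + N0 by rewrite addr_ge0// ltW.
have hh : 0 <= hl * hl by exact: mulr_ge0.
have N0' := ltW N00.
have sG := sqrtr_ge0 Gam.
by repeat first [done | apply: addr_ge0 | apply: mulr_ge0].
Qed.

Let level_sum : \sum_(j < m) ((half j)%:R * h) `^ (beta / 2) <=
  geometric_const (beta / 2) * len `^ (beta / 2).
Proof.
rewrite (reindex_inj rev_ord_inj)/=.
have bh : 0 < beta / 2 by rewrite divr_gt0// b0.
apply: le_trans (geometric_sum_le m bh h0).
apply: ler_sum => j _.
by rewrite /half subnS subKn.
Qed.

Definition sewing_const : R :=
  (2 * C1 * power_sum_const ((1 - beta) / 2) * Num.sqrt (burkholder_const R p.+1) +
   C1 * power_sum_const ((1 - beta) / 2) + C2 * power_sum_const (1 - beta / 2)) *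
  (1 + geometric_const (beta / 2)).

Lemma sewing_const_ge0 : 0 <= sewing_const.
Proof.
have g0 : 0 <= geometric_const (beta / 2).
  rewrite invr_ge0 subr_ge0 -[leLHS](powRr0 2) ler_powR ?ler1n//.
  by rewrite divr_ge0// ltW.
rewrite /sewing_const mulr_ge0 ?addr_ge0// -/gamma1 -/gamma2.
by rewrite mulr_ge0 ?sqrtr_ge0// -mulrA mulr_ge0.
Qed.

(* The coarsest approximation, a single block frozen at its start. *)
Let germ0_Lp : Lp P q (germ 0 0) (C1 * power_sum_const gamma1 * len `^ (1 - gamma1) * N0).
Proof.
have k0 : 0 <= C1 * power_sum_const gamma1 * len `^ (1 - gamma1).
  by rewrite mulr_ge0// powR_ge0.
have st0 : start 0 0 = 0%N by rewrite /start mul0n.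
have t0 : 0 <= tk 0 by case/andP: (tkT (leq0n (2 ^ m))).
have pT (i : 'I_(2 ^ m)) := tkT (ltn_ord i).
have -> : germ 0 0 = fun o => \sum_(i < 2 ^ m) h * fr (tk 0) (tk 0) (tk i.+1) o.
  by apply/funext => o; rewrite /germ st0 subn0.
rewrite -[C1 * _ * _](ger0_norm k0).
apply: (le_Lp q_gt0 (LpZ q_gt0 (C1 * power_sum_const gamma1 * len `^ (1 - gamma1)) (gapN (leq0n _)))) => //.
  apply: bmeas_meas; apply: bmeas_sum => i _; apply: bmeasM; first exact: bmeas_cst.
  by apply: fr_meas => //; [rewrite t0 lexx|case/andP: (tkT (leq0n (2 ^ m)))].
move=> o; rewrite normrM (ger0_norm k0) (ger0_norm (gap_ge0 _ _)).
rewrite (le_trans (ler_norm_sum _ _ _))//.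
apply: (@le_trans _ _ (\sum_(i < 2 ^ m) (C1 * gap (tk 0) o) * (h * (i.+1%:R * h) `^ (- gamma1)))).
  apply: ler_sum => i _; rewrite normrM (gtr0_norm h0).
  have := fr_gap (tk 0) o t0 (tk_lt (ltn0Sn i)) (proj2 (andP (pT i))).
  rewrite -[tk i.+1]/(tk (0 + i.+1)) tkB => H.
  apply: (le_trans (ler_wpM2l (ltW h0) H)).
  by rewrite le_eqVlt; apply/orP; left; apply/eqP; ring.
rewrite -mulr_sumr (le_trans (ler_wpM2l _ (power_sum_le m gamma1_01 h0)))//.
  by rewrite mulr_ge0 ?(ltW C10)// gap_ge0.
by rewrite -/len le_eqVlt; apply/orP; left; apply/eqP; ring.
Qed.

Let sewn_Lp : Lp P q (fun o => \sum_(c < 2 ^ m) germ m c o)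
  (sewing_const * (hl * (1 + hl)) * (V + N0) * len `^ (beta / 2)).
Proof.
have : Lp P q (fun o => \sum_(c < 2 ^ m) germ m c o)
  (C1 * power_sum_const gamma1 * len `^ (1 - gamma1) * N0 + \sum_(j < m)
    (Num.sqrt (burkholder_const R p.+1 * (2 ^ j).+1%:R) *
      (2 * C1 * power_sum_const gamma1 * N0 * ((half j)%:R * h) `^ (1 - gamma1)) +
     (2 ^ j)%:R * ((C1 * power_sum_const gamma1 * V + C2 * power_sum_const gamma2 * N0) *
       ((half j)%:R * h) `^ (1 + beta / 2)))).
  apply: (@dyadic_sewing R d T P p m germ mart drift
    (fun j c => F (tk (start j c))) _
    (fun j => 2 * C1 * power_sum_const gamma1 * N0 * ((half j)%:R * h) `^ (1 - gamma1))
    (fun j => (C1 * power_sum_const gamma1 * V + C2 * power_sum_const gamma2 * N0) *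
      ((half j)%:R * h) `^ (1 + beta / 2)) germ_split _ _ _ _ _ _ germ0_Lp).
  - move=> j i c jm ic cj; apply: grid_mart_past => //; first exact: ltn_trans ic cj.
    apply: tk_le; rewrite /middle /start.
    apply: (@leq_trans (i.+1 * 2 ^ (m - j))); last by rewrite leq_mul2r ic orbT.
    by rewrite mulSnr leq_add2l (halfE jm) leq_addr.
  - by move=> j c xi jm cj bxi; exact: grid_mart_orth.
  - by move=> j c jm cj; exact: grid_mart_meas.
  - move=> j; rewrite !mulr_gt0// ?powR_gt0 ?mulr_gt0 ?ltr0n ?expn_gt0//.
    exact: lt_le_trans c1_ge1.
  - by move=> j c jm cj; exact: grid_mart_Lp.
  - by move=> j c jm cj; exact: grid_drift_Lp.
move=> H; apply: (le_Lp q_gt0 H) => //; first by case: H.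
have e1 : len `^ (1 - gamma1) = hl * len `^ (beta / 2).
  rewrite /hl -powRD; last by rewrite (gt_eqF len0) implybT.
  by congr (_ `^ _); rewrite /gamma1; field.
have lS := level_sum; set x := len `^ (beta / 2) in e1 lS *.
have x0 : 0 <= x by exact: powR_ge0.
have ca0 : 0 <= ca.
  by rewrite /ca addr_ge0// addr_ge0// mulr_ge0 ?sqrtr_ge0// -mulrA mulr_ge0.
have VN : 0 <= V + N0 by rewrite addr_ge0// ltW.
have -> : sewing_const * (hl * (1 + hl)) * (V + N0) * x =
    ca * (hl * (1 + hl)) * (V + N0) * x +
    ca * (hl * (1 + hl)) * (V + N0) * (geometric_const (beta / 2) * x).
  by rewrite /sewing_const -/gamma1 -/gamma2 -/Gam -/ca; ring.
apply: lerD.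
  rewrite e1 [leLHS](_ : _ = C1 * power_sum_const gamma1 * (hl * 1) * N0 * x); last by ring.
  have c1ca : C1 * power_sum_const gamma1 <= ca.
    by rewrite /ca addrAC lerDr addr_ge0// mulr_ge0 ?sqrtr_ge0// -mulrA mulr_ge0.
  have hhl : hl * 1 <= hl * (1 + hl) by rewrite ler_wpM2l// lerDl.
  have NV : N0 <= V + N0 by rewrite lerDr.
  have hl1 : 0 <= hl * 1 by rewrite mulr1.
  by rewrite ler_wpM2r// (ler_pM (mulr_ge0 k1_ge0 hl1) (ltW N00) _ NV)// (ler_pM k1_ge0 hl1).
apply: (@le_trans _ _ (\sum_(j < m) ca * (hl * (1 + hl)) * (V + N0) * ((half j)%:R * h) `^ (beta / 2))).
  by apply: ler_sum => j _; exact: level_bound.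
by rewrite -mulr_sumr ler_wpM2l// !mulr_ge0// addr_ge0.
Qed.

(** Stochastic sewing on a dyadic grid: [fr r r r] is f(r, X_r) - f(r, Y_r), so the
    sum is a Riemann sum.  The last two terms vanish as the mesh [h] goes to 0. *)
Lemma grid_sewing : Lp P q
  (fun o => \sum_(c < 2 ^ m) h * fr (tk c.+1) (tk c.+1) (tk c.+1) o)
  (sewing_const * (hl * (1 + hl)) * (V + N0) * len `^ (beta / 2) +
   Num.sqrt (burkholder_const R p.+1 * (2 ^ m).+1%:R) * (h * (4 * B)) +
   len * (C3 * h `^ beta)).
Proof.
have cT (c : nat) : (c < 2 ^ m)%N -> 0 <= tk c <= tmax by move=> cm; exact: tkT (ltnW cm).
have cST (c : nat) : (c < 2 ^ m)%N -> 0 <= tk c.+1 <= tmax by move=> cm; exact: tkT cm.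
pose D c : T -> R := if (c < 2 ^ m)%N then
  fun o => h * (fr (tk c) (tk c) (tk c.+1) o - fr (tk c) (tk c.+1) (tk c.+1) o)
  else fun=> 0.
have past_D c : (c < 2 ^ m)%N ->
    bmeas ((fun o => h * (fr (tk c) (tk c) (tk c.+1) o - fr (tk c) (tk c.+1) (tk c.+1) o))
      : g_sigma_algebraType (F (tk c.+1)) -> R).
  move=> cm; have /andP[t0 tT] := cT c cm; have /andP[t0' tT'] := cST c cm.
  apply: bmeasM; first exact: bmeas_cst.
  apply: bmeasB; last by apply: fr_past => //; rewrite ?t0 ?t0' ?tT'//= tk_le.
  apply: (Fmono (tk_le (leqnSn c))); apply: fr_past => //; rewrite ?t0 ?t0' ?lexx//.
have bD c : bmeas (D c).
  rewrite /D; case: ifPn => cm; last exact: bmeas_cst.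
  apply: bmeas_salgebra (past_D c cm); exact: Fm (cST c cm).
(* At the finest level, revealing the noise of each cell is one more martingale. *)
have MD : Lp P q (fun o => \sum_(c < 2 ^ m) D c o)
    (Num.sqrt (burkholder_const R p.+1 * (2 ^ m).+1%:R) * (h * (4 * B))).
  apply: martingale_Lp => //; first by rewrite !mulr_gt0.
    move=> c cm; apply: Lp_bounded => //; first by case: (bD c).
    move=> o; rewrite /D cm normrM (gtr0_norm h0) ler_wpM2l ?(ltW h0)//.
    rewrite (le_trans (ler_normB _ _))//.
    have h1 := @fr_bounded (tk c) (tk c) (tk c.+1) o (cT c cm) (cST c cm).
    have h2 := @fr_bounded (tk c) (tk c.+1) (tk c.+1) o (cST c cm) (cST c cm).
    by apply: (le_trans (lerD h1 h2)); rewrite -mulrDl -natrD.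
  move=> c cm; rewrite /D cm.
  have /andP[t0 tT] := cT c cm; have /andP[t0' tT'] := cST c cm.
  transitivity (Ex P (fun o => h * ((\sum_(j < c) D j o) ^+ p.*2.+1 *
      (fr (tk c) (tk c) (tk c.+1) o - fr (tk c) (tk c.+1) (tk c.+1) o)))).
    by apply: eq_Ex => o; rewrite mulrCA.
  have bS : bmeas ((fun o => (\sum_(j < c) D j o) ^+ p.*2.+1)
      : g_sigma_algebraType (F (tk c)) -> R).
    apply: bmeasX; apply: bmeas_sum => i _; rewrite /D (ltn_trans (ltn_ord i) cm).
    by apply: (Fmono (tk_le (ltn_ord i))); exact: past_D (ltn_trans (ltn_ord i) cm).
  rewrite ExZ; last first.
    apply: bmeasM; first exact: bmeas_salgebra (Fm (cT c cm)) bS.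
    by apply: bmeasB; apply: fr_meas => //; rewrite ?t0 ?t0' ?lexx//= tk_le.
  by rewrite (fr_orth t0 (tk_lt (ltnSn c)) (lexx _) tT' bS) mulr0.
have RE : Lp P q (fun o => \sum_(c < 2 ^ m)
    h * (fr (tk c) (tk c.+1) (tk c.+1) o - fr (tk c.+1) (tk c.+1) (tk c.+1) o))
    (len * (C3 * h `^ beta)).
  rewrite [len * _](_ : _ = \sum_(c < 2 ^ m) h * (C3 * h `^ beta)); last first.
    by rewrite sumr_const card_ord -mulr_natl /len -mulrA.
  apply: Lp_sum => // c; have cm := ltn_ord c.
  have /andP[t0 tT] := cT c cm; have /andP[t0' tT'] := cST c cm.
  apply: Lp_bounded => //.
    apply: bmeas_meas; apply: bmeasM; first exact: bmeas_cst.
    by apply: bmeasB; apply: fr_meas => //; rewrite ?t0 ?t0' ?lexx//= tk_le.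
  move=> o; rewrite normrM (gtr0_norm h0) ler_wpM2l ?(ltW h0)//.
  have e : tk c.+1 - tk c = h by have := tkB c 1; rewrite mul1r addn1.
  by rewrite -[X in _ <= C3 * X `^ _]e; apply: fr_release; rewrite ?t0 ?tk_le.
have H := LpB q_gt0 (LpB q_gt0 sewn_Lp MD) RE.
apply: (le_Lp q_gt0 H) => //.
  apply: bmeas_meas; apply: bmeas_sum => c _; apply: bmeasM; first exact: bmeas_cst.
  have /andP[t0 tT] := cST c (ltn_ord c).
  by apply: fr_meas => //; rewrite ?t0 ?lexx//.
move=> o; rewrite le_eqVlt; apply/orP; left; apply/eqP; congr (`|_|).
rewrite -!sumrB; apply: eq_bigr => c _.
rewrite /D ltn_ord /germ /start subnn muln1 big_ord_recl big_ord0/= addr0 addn1.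
by ring.
Qed.

End grid.

(** * Integrals along a path *)

Section interval_integral.
Context (R : realType).
Local Notation mu := (@lebesgue_measure R).

Lemma fin_itv (a b : bool) (s t : R) :
  (mu [set` Interval (BSide a s) (BSide b t)] < +oo)%E.
Proof. by rewrite lebesgue_measure_itv/=; case: ifP => _; rewrite ?ltry// -EFinB ltry. Qed.

Lemma measure_itv a b (s t : R) : s <= t ->
  mu [set` Interval (BSide a s) (BSide b t)] = (t - s)%:E.
Proof.
move=> st; rewrite lebesgue_measure_itv/= lte_fin; case: ifPn => //=.
by rewrite -leNgt => ts; rewrite (le_anti (introT andP (conj st ts))) subrr.
Qed.

Lemma bounded_itv_integrable a b (s t : R) (g : R -> R) (B : R) :
  measurable_fun [set` Interval (BSide a s) (BSide b t)] g ->
  (forall r : R, r \in Interval (BSide a s) (BSide b t) -> `|g r| <= B) ->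
  mu.-integrable [set` Interval (BSide a s) (BSide b t)] (EFin \o g).
Proof.
move=> mg gB; apply: measurable_bounded_integrable => //; first exact: fin_itv.
exists B; split; first exact: num_real.
by move=> x Bx r /gB rB; apply: le_trans (ltW Bx).
Qed.

Lemma Rintegral_cst_itv a b (s t c : R) : s <= t ->
  \int[mu]_(r in [set` Interval (BSide a s) (BSide b t)]) c = c * (t - s).
Proof.
move=> st; apply: etrans; first by apply: Rintegral_cst; exact: measurable_itv.
by congr (_ * _); apply: (congr1 fine (measure_itv a b st)).
Qed.

End interval_integral.

Section running_integral.
Context (R : realType) (tmax B : R) (g : R -> R).
Local Notation mu := (@lebesgue_measure R).
Hypothesis mg : measurable_fun `[0, tmax] g.
Hypothesis gB : forall r, 0 <= r <= tmax -> `|g r| <= B.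

Lemma running_integrable (S : set R) : measurable S -> S `<=` `[0, tmax] ->
  mu.-integrable S (EFin \o g).
Proof.
move=> mS ST.
have i0 : mu.-integrable `[0, tmax] (EFin \o g).
  by apply: (@bounded_itv_integrable _ _ _ _ _ _ B) => // r; rewrite in_itv/=; exact: gB.
exact: integrableS i0.
Qed.

Lemma running_increment (s t : R) : 0 <= s <= t -> t <= tmax ->
  \int[mu]_(r in `[0, t]) g r - \int[mu]_(r in `[0, s]) g r = \int[mu]_(r in `]s, t]) g r.
Proof.
move=> /andP[s0 st] tT; rewrite (@Rintegral_itvB _ g (BLeft 0) (BRight t) s)//.
apply: running_integrable => //.
by move=> r /=; rewrite !in_itv/= => /andP[-> /= rt]; exact: le_trans tT.
Qed.

Lemma running_lipschitz (s t : R) : 0 <= s <= tmax -> 0 <= t <= tmax ->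
  `|\int[mu]_(r in `[0, t]) g r - \int[mu]_(r in `[0, s]) g r| <= B * `|t - s|.
Proof.
wlog st : s t / s <= t.
  move=> H sT tT; case: (leP s t) => [st|/ltW ts]; first exact: H.
  by rewrite distrC (distrC t); exact: H.
move=> /andP[s0 sT] /andP[t0 tT]; rewrite running_increment ?s0//.
have sub : `]s, t] `<=` `[0, tmax].
  move=> r /=; rewrite !in_itv/= => /andP[sr rt].
  by rewrite (le_trans s0 (ltW sr)) (le_trans rt tT).
have ig : mu.-integrable `]s, t] (EFin \o g) by exact: running_integrable.
rewrite (le_trans (le_normr_Rintegral _ ig))//.
have -> : B * `|t - s| = \int[mu]_(r in `]s, t]) B.
  by rewrite Rintegral_cst_itv// ger0_norm// subr_ge0.
apply: le_Rintegral => //.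
- by have := integrable_norm ig; apply: eq_integrable.
- apply: (@bounded_itv_integrable _ _ _ _ _ _ B) => // r rD; rewrite ger0_norm//.
  by have := sub r rD; rewrite /= in_itv/= => /gB; apply: le_trans.
- by move=> r /sub; rewrite /= in_itv/= => /gB.
Qed.

(** Riemann sums with right endpoints.  Countably many discontinuities leave the
    step functions converging almost everywhere, and boundedness lets the limit
    pass through the integral. *)
Lemma riemann_sum_cvg (s t : R) (Z : set R) : 0 <= s < t -> t <= tmax -> countable Z ->
  (forall r, s < r < t -> ~ Z r -> {for r, continuous g}) ->
  (fun m => \sum_(c < 2 ^ m) ((t - s) / (2 ^ m)%:R) *
     g (s + c.+1%:R * ((t - s) / (2 ^ m)%:R))) @ \oo -->
  \int[mu]_(r in `[0, t]) g r - \int[mu]_(r in `[0, s]) g r.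
Proof.
move=> /andP[s0 st] tT cZ gc.
have sT : 0 <= s <= tmax by rewrite s0 (le_trans (ltW st) tT).
have B0 : 0 <= B by exact: le_trans (normr_ge0 _) (gB sT).
rewrite running_increment ?s0 ?(ltW st)//.
pose h m : R := (t - s) / (2 ^ m)%:R.
have pm m : 0 < (2 ^ m)%:R :> R by rewrite ltr0n expn_gt0.
have h0 m : 0 < h m by rewrite divr_gt0// subr_gt0.
pose tk m (k : nat) : R := s + k%:R * h m.
have tk0 m : tk m 0%N = s by rewrite /tk mul0r addr0.
have tkN m : tk m (2 ^ m)%N = t.
  by rewrite /tk /h mulrC divfK ?gt_eqF//; ring.
have tk_le m k l : (k <= l)%N -> tk m k <= tk m l.
  by move=> kl; rewrite /tk lerD2l ler_wpM2r ?(ltW (h0 m))// ler_nat.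
have tkS m k : tk m k.+1 = tk m k + h m by rewrite /tk -addn1 natrD; ring.
pose step m (r : R) : R := \sum_(c < 2 ^ m) g (tk m c.+1) * \1_(`]tk m c, tk m c.+1]) r.
have tkT m k : (k <= 2 ^ m)%N -> 0 <= tk m k <= tmax.
  move=> km; apply/andP; split; first by rewrite (le_trans s0)// -(tk0 m) tk_le.
  by apply: le_trans tT; rewrite -(tkN m) tk_le.
have stepE m r (c : 'I_(2 ^ m)) : tk m c < r <= tk m c.+1 -> step m r = g (tk m c.+1).
  move=> rc; rewrite /step (bigD1 c)//= indicE mem_set ?mulr1/= ?in_itv//=.
  rewrite big1 ?addr0// => i ic; rewrite indicE memNset ?mulr0//= in_itv/= => /andP[i1 i2].
  case/andP: rc => c1 c2; move: ic; rewrite -val_eqE/= neq_ltn => /orP[ic|ic].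
    by have := lt_le_trans c1 (le_trans i2 (tk_le m _ _ ic)); rewrite ltxx.
  by have := lt_le_trans i1 (le_trans c2 (tk_le m _ _ ic)); rewrite ltxx.
have cell m r : s < r <= t -> exists c : 'I_(2 ^ m), tk m c < r <= tk m c.+1.
  move=> /andP[sr rt].
  have exk : exists k, r <= tk m k by exists (2 ^ m)%N; rewrite tkN.
  case: (ex_minnP exk) => -[|k] rk kmin; first by move: rk; rewrite tk0 leNgt sr.
  have km : (k < 2 ^ m)%N by apply: kmin; rewrite tkN.
  by exists (Ordinal km) => /=; rewrite rk andbT ltNge; apply/negP => /kmin; rewrite ltnn.
have intE m : \int[mu]_(r in `]s, t]) step m r = \sum_(c < 2 ^ m) h m * g (tk m c.+1).
  rewrite /Rintegral; under eq_integral do rewrite /step -sumEFin.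
  rewrite integral_sum//; last first.
    move=> c; apply: (@bounded_itv_integrable _ _ _ _ _ _ `|g (tk m c.+1)|).
      by apply: measurable_funM => //; exact: measurable_indic.
    by move=> r _; rewrite normrM indicE ler_piMr// ger0_norm ?ler0n// lern1 leq_b1.
  rewrite (_ : (\sum_(c < _) _)%E = (\sum_(c < 2 ^ m) (h m * g (tk m c.+1))%:E)%E); last first.
    apply: eq_bigr => c _; transitivity (\int[mu]_(r in `]s, t]) ((g (tk m c.+1))%:E * (\1_`]tk m c, tk m c.+1] r)%:E))%E.
      by apply: eq_integral => r _; rewrite EFinM.
    rewrite integralZl//; last first.
      apply: (@bounded_itv_integrable _ _ _ _ _ _ 1) => [|r _].
        exact: measurable_indic.
      by rewrite indicE ger0_norm ?ler0n// lern1 leq_b1.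
    rewrite integral_indic// setIidl; last first.
      move=> r /=; rewrite !in_itv/= => /andP[c1 c2].
      rewrite -(tk0 m) -(tkN m) (le_lt_trans (tk_le m _ _ (leq0n c)) c1)/=.
      by rewrite (le_trans c2)// tk_le.
    rewrite mulrC EFinM; congr (_ * _)%E.
    apply: (etrans (measure_itv _ _ (tk_le m _ _ (leqnSn c)))).
    by rewrite tkS addrC addKr.
  by rewrite sumEFin.
rewrite (_ : (fun m => _) = fun m => \int[mu]_(r in `]s, t]) step m r); last first.
  by apply/funext => m; rewrite intE.
have mstep m : measurable_fun `]s, t] (EFin \o step m).
  apply/measurable_EFinP; apply: measurable_sum => c.
  by apply: measurable_funM => //; exact: measurable_indic.
have sub : `]s, t] `<=` `[0, tmax].
  move=> r /=; rewrite !in_itv/= => /andP[sr rt].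
  by rewrite (le_trans s0 (ltW sr)) (le_trans rt tT).
have mgst : measurable_fun `]s, t] (EFin \o g).
  by apply/measurable_EFinP; exact: measurable_funS mg.
have iB : mu.-integrable `]s, t] (EFin \o cst B).
  by apply: (@bounded_itv_integrable _ _ _ _ _ _ B) => // r _; rewrite ger0_norm.
have cvgst : {ae mu, forall r, `]s, t]%classic r -> (EFin \o step m) r @[m --> \oo] --> (EFin \o g) r}.
  exists (Z `|` [set t]); split.
  - by apply: measurableU => //; exact: countable_measurable.
  - rewrite null_set_setU//; [exact: countable_measurable|exact: countable_lebesgue_measure0|].
    exact: lebesgue_measure_set1.
  move=> r /= H; apply: contrapT => nZ; apply: H; rewrite in_itv/= => /andP[sr rt].
  have nZr : ~ Z r by move=> Zr; apply: nZ; left.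
  have rt' : r < t by rewrite lt_neqAle rt andbT; apply/eqP => rE; apply: nZ; right.
  apply: cvg_EFin; first exact: nearW.
  apply/cvgrPdist_le => e e0.
  have /cvgrPdist_le/(_ e e0) := gc r (introT andP (conj sr rt')) nZr.
  move=> /nbhs_ballP[dl /= dl0 near_r].
  have hdl : \forall m \near \oo, h m < dl.
    have q0 : 0 < dl / (t - s) by rewrite divr_gt0// subr_gt0.
    have := near_infty_natSinv_lt (PosNum q0); apply: filterS => m /= Hm.
    rewrite /h -ltr_pdivlMl ?subr_gt0// [_^-1 * dl]mulrC.
    apply: le_lt_trans Hm; rewrite lef_pV2 ?posrE// ler_nat.
    exact: ltn_expl.
  near=> m.
  have [|c /[dup] rc /stepE ->] := cell m r; first by rewrite sr.
  apply: near_r; rewrite /ball/= distrC ger0_norm; last by case/andP: rc; rewrite subr_ge0.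
  case/andP: rc => rc1 rc2; apply: le_lt_trans (_ : h m < dl); last by near: m.
  by rewrite tkS; move: rc1; move: (tk m c) (h m) => x y; lra.
have dom : {ae mu, forall r (m : nat), `]s, t]%classic r -> (`|(EFin \o step m) r| <= (EFin \o cst B) r)%E}.
  apply: aeW => r m /=; rewrite in_itv/= => rD; rewrite lee_fin.
  have [c /stepE ->] := cell m r rD; apply: gB; exact: tkT.
have [_ _ H] := @dominated_convergence _ _ _ mu _ (measurable_itv `]s, t]) _ _ _ mstep mgst cvgst iB dom.
have : fine (\int[mu]_(r in `]s, t]) (EFin \o step m) r)%E @[m --> \oo] --> 
  fine (\int[mu]_(r in `]s, t]) (EFin \o g) r)%E.
  apply: fine_cvg; rewrite fineK//.
  by apply: integrable_fin_num => //; exact: running_integrable.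
by [].
Unshelve. all: by end_near.
Qed.

End running_integral.

(** * The Euler grid *)

Section euler_grid.
Context (R : realType) (tmax : R) (N : nat).
Hypotheses (tmax0 : 0 < tmax) (N0 : (0 < N)%N).
Local Notation mu := (@lebesgue_measure R).
Local Notation euler_floor := (eta_n tmax N).
Let gp (k : nat) : R := k%:R * tmax / N%:R.
Let N0' : 0 < N%:R :> R. Proof. by rewrite ltr0n. Qed.

Lemma euler_floor_ge0 (r : R) : 0 <= euler_floor r.
Proof. by rewrite /eta_n divr_ge0// mulr_ge0// ltW. Qed.

Let cellP (r : R) : 0 <= r -> exists k : nat, gp k <= r < gp k.+1.
Proof.
move=> r0; exists (Num.truncn (r * N%:R / tmax)).
have q0 : 0 <= r * N%:R / tmax by rewrite divr_ge0// ?mulr_ge0// ltW.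
have /andP[h1 h2] := truncn_itv q0.
rewrite /gp ler_pdivrMr// -ler_pdivlMr// h1/=.
by rewrite ltr_pdivlMr// -ltr_pdivrMr.
Qed.

Lemma euler_floor_le (r : R) : 0 <= r -> euler_floor r <= r.
Proof.
by move=> /cellP[k rk]; rewrite (eta_nE tmax0 N0 rk); case/andP: rk.
Qed.

Lemma euler_floor_gap (r : R) : 0 <= r -> r - euler_floor r <= tmax / N%:R.
Proof.
move=> /cellP[k rk]; rewrite (eta_nE tmax0 N0 rk); case/andP: rk => _ /ltW.
by rewrite /gp -addn1 natrD mulrDl mul1r mulrDl; move: (_ / _) (_ / _) => x y; lra.
Qed.

Lemma euler_floor_in (r : R) : 0 <= r <= tmax -> 0 <= euler_floor r <= tmax.
Proof.
by move=> /andP[r0 rT]; rewrite euler_floor_ge0 (le_trans (euler_floor_le r0)).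
Qed.

Lemma euler_floor_measurable (G : R -> R) :
  measurable_fun `[0, tmax] (fun r => G (euler_floor r)).
Proof.
move=> mD Y mY.
rewrite (_ : _ `&` _ = \bigcup_(k in [set k | Y (G (gp k))])
    (`[0, tmax] `&` `[gp k, gp k.+1[)).
  by apply: bigcup_measurable => k _; apply: measurableI.
apply/seteqP; split => r /=.
  move=> [rD GY]; have r0 : 0 <= r by move: rD; rewrite in_itv/= => /andP[].
  have [k rk] := cellP r0; exists k; first by rewrite /= /gp -(eta_nE tmax0 N0 rk).
  by split => //; rewrite /= in_itv.
move=> [k /= GY [rD]]; rewrite in_itv/= => rk.
by split => //; rewrite (eta_nE tmax0 N0 rk).
Qed.

Definition euler_points : set R := range gp.

Lemma euler_points_countable : countable euler_points.
Proof. by apply: sub_countable (countableP setT); exact: card_image_le. Qed.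

Lemma euler_floor_continuous (G : R -> R) (r : R) : 0 <= r -> ~ euler_points r ->
  {for r, continuous (fun r => G (euler_floor r))}.
Proof.
move=> r0 nr; have [k rk] := cellP r0.
have rk' : r \in `]gp k, gp k.+1[.
  rewrite in_itv/=; case/andP: rk => h1 ->; rewrite andbT lt_neqAle h1 andbT.
  by apply/eqP => rE; apply: nr; exists k.
have -> : {for r, continuous (fun r => G (euler_floor r))} =
   ((fun r => G (euler_floor r)) @ r --> G (gp k)).
  by rewrite /prop_for/continuous_at /= (eta_nE tmax0 N0 rk).
apply: cvg_near_cst; near=> u.
have : u \in `]gp k, gp k.+1[ by near: u; exact: near_in_itvoo.
rewrite in_itv/= => /andP[u1 u2].
by rewrite (@eta_nE _ _ _ k u) // (ltW u1).
Unshelve. all: by end_near.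
Qed.

(** Between two grid points the rate is constant, except possibly at the right
    endpoint, which has measure zero. *)
Lemma euler_floor_increment (G : R -> R) (k : nat) (t : R) :
  gp k <= t <= gp k.+1 -> t <= tmax ->
  \int[mu]_(r in `[0, t]) G (euler_floor r) -
  \int[mu]_(r in `[0, gp k]) G (euler_floor r) = G (gp k) * (t - gp k).
Proof.
move=> /andP[kt tk] tT.
have gp0 : 0 <= gp k by rewrite /gp divr_ge0// mulr_ge0// ltW.
have E : \int[mu]_(r in `]gp k, t]) G (euler_floor r) = G (gp k) * (t - gp k).
  have co (r : R) : `]gp k, t[%classic r -> G (euler_floor r) = G (gp k).
    rewrite /= in_itv/= => /andP[r1 r2]; rewrite (@eta_nE _ _ _ k r)//.
    by rewrite (ltW r1) (lt_le_trans r2).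
  have ic : mu.-integrable `]gp k, t[ (EFin \o cst (G (gp k))).
    by apply: (@bounded_itv_integrable _ _ _ _ _ _ `|G (gp k)|).
  rewrite -Rintegral_itv_bndo_bndc; last first.
    by apply: eq_integrable ic => // r; rewrite inE => /co /= ->.
  transitivity (\int[mu]_(r in `]gp k, t[) G (gp k)); last exact: Rintegral_cst_itv.
  by apply: eq_Rintegral => r; rewrite inE => /co ->.
rewrite -E (@Rintegral_itvB _ _ (BLeft 0) (BRight t) (gp k))//.
have is_ : mu.-integrable `[0, tmax] (EFin \o (fun r => G (euler_floor r))).
  apply: (@bounded_itv_integrable _ _ _ _ _ _ (\sum_(j < N.+1) `|G (gp j)|)).
    exact: euler_floor_measurable.
  move=> r; rewrite in_itv/= => /andP[r0 rT]; have [j rj] := cellP r0.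
  have jN : (j < N.+1)%N.
    case/andP: rj => + _ => /le_trans/(_ rT).
    rewrite /gp ler_pdivrMr// mulrC ler_pM2l// ler_nat.
    by [].
  by rewrite (eta_nE tmax0 N0 rj) (bigD1 (Ordinal jN))//= lerDl sumr_ge0.
apply: integrableS is_ => //.
by move=> r /=; rewrite !in_itv/= => /andP[-> /= rt]; exact: le_trans tT.
Qed.

End euler_grid.

Section drift_along_path.
Context (R : realType) (n : nat) (tmax K beta eta : R).
Variable f : R -> 'rV[R]_n -> R.
Hypotheses (K0 : 0 < K) (b0 : 0 < beta) (e0 : 0 < eta).
Hypothesis fH : forall t, 0 <= t <= tmax -> holder K beta (f t).
Hypothesis fT : forall t s x, 0 <= t <= tmax -> 0 <= s <= tmax ->
  `|f t x - f s x| <= K * `|t - s| `^ eta.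

Let pow_small (a e : R) : 0 < a -> 0 < e ->
  exists2 dl : R, 0 < dl & forall u : R, 0 <= u <= dl -> u `^ a <= e.
Proof.
move=> a0 ep; exists (e `^ a^-1); first exact: powR_gt0.
move=> u /andP[u0 ue].
have -> : e = (e `^ a^-1) `^ a by rewrite -powRrM mulVf ?gt_eqF// powRr1 ?ltW.
by apply: ge0_ler_powR; rewrite ?nnegrE ?powR_ge0// ltW.
Qed.

Lemma drift_along_path_continuous (x : R -> 'rV[R]_n) :
  {within `[0, tmax], continuous x} ->
  {within `[0, tmax], continuous (fun r => f r (x r))}.
Proof.
move=> /subspace_continuousP cx; apply/subspace_continuousP => r rD.
have rT : 0 <= r <= tmax by move: rD; rewrite /= in_itv.
apply/cvgrPdist_le => e ep.
have eK : 0 < e / 2 / K by rewrite !divr_gt0.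
have [d1 d10 H1] := pow_small e0 eK.
have [d2 d20 H2] := pow_small b0 eK.
have d3 : 0 < d2 / n.+1%:R by rewrite divr_gt0// ltr0n.
have /cvgrPdist_le/(_ _ d3) near_x := cx r rD.
have near_r : \forall u \near within `[0, tmax] (nbhs r), `|r - u| <= d1.
  apply: cvg_within; apply/nbhs_ballP; exists d1 => //= u; rewrite /ball/=.
  exact: ltW.
have near_D : \forall u \near within `[0, tmax] (nbhs r), `[0, tmax]%classic u.
  exact: withinT.
apply: filterS3 near_x near_r near_D => u ux ur; rewrite /= in_itv/= => uT.
rewrite /from_subspace in ux *.
rewrite (_ : _ - _ = (f r (x r) - f r (x u)) + (f r (x u) - f u (x u))); last by ring.
rewrite (le_trans (ler_normD _ _))// (splitr e); apply: lerD.
  apply: (le_trans (fH rT _ _)); rewrite -ler_pdivlMl// mulrC; apply: H2.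
  rewrite l1_ge0/= (le_trans (l1_le_norm _))//.
  rewrite (le_trans (ler_wpM2l _ ux))// mulrCA -[leRHS]mulr1 ler_pM2l//.
  by rewrite ler_pdivrMr ?ltr0n// mul1r ler_nat.
apply: (le_trans (fT _ rT uT)); rewrite -ler_pdivlMl// mulrC; apply: H1.
by rewrite normr_ge0.
Qed.

Lemma drift_along_perturbed_vmeasurable (x : R -> 'rV[R]_n) :
  {within `[0, tmax], continuous x} ->
  measurable_fun `[0, tmax] (fun r => f r (x r)).
Proof.
move=> cx; apply: subspace_continuous_measurable_fun => //.
exact: drift_along_path_continuous.
Qed.

Lemma drift_along_path_continuous_at (x : R -> 'rV[R]_n) (r : R) :
  {within `[0, tmax], continuous x} -> 0 < r < tmax ->
  {for r, continuous (fun r => f r (x r))}.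
Proof.
move=> cx rT.
have sub : `]0, tmax[ `<=` `[0, tmax].
  by move=> u /=; rewrite !in_itv/= => /andP[/ltW -> /ltW ->].
have := continuous_subspaceW sub (drift_along_path_continuous cx).
rewrite continuous_open_subspace; last exact: interval_open.
by move/(_ r); apply; rewrite inE/= in_itv.
Qed.

End drift_along_path.

(** * Closing the estimate *)

Section closing.
Context (R : realType) (n : nat) d (T : measurableType d) (P : probability T R).
Context (tmax : R) (W : R -> T -> 'rV[R]_n).
Hypotheses (wW : wiener_process P tmax W) (cP : measure_is_complete P).
Variables (b : R -> 'rV[R]_n -> 'rV[R]_n) (B K beta Lam : R).
Hypotheses (B0 : 0 < B) (K0 : 0 < K) (b01 : 0 < beta < 1) (Lam0 : 0 <= Lam).
Hypothesis bB : forall i (t : R) x, 0 <= t <= tmax -> `|b t x 0 i| <= B.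
Hypothesis bH : forall i (t : R), 0 <= t <= tmax -> holder K beta (fun x => b t x 0 i).
Variables phi psi : R -> T -> 'rV[R]_n.
Notation pastT t := (g_sigma_algebraType (past_events P W t)).
Hypothesis aphi : forall t : R, 0 <= t <= tmax -> vmeas (phi t : pastT t -> _).
Hypothesis apsi : forall t : R, 0 <= t <= tmax -> vmeas (psi t : pastT t -> _).
Hypothesis phiL : forall (s t : R) o, 0 <= s <= tmax -> 0 <= t <= tmax ->
  l1 (phi t o - phi s o) <= Lam * `|t - s|.
Hypothesis psiL : forall (s t : R) o, 0 <= s <= tmax -> 0 <= t <= tmax ->
  l1 (psi t o - psi s o) <= Lam * `|t - s|.
Variables (p : nat) (g : R -> T -> 'I_n -> R) (E : R).
Let q := p.+1.*2.
Let D t o := phi t o - psi t o.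
Hypotheses (E0 : 0 < E) (D0 : forall o, D 0 o = 0).
Hypothesis gLp : forall (r : R) i, 0 <= r <= tmax ->
  Lp P q (fun o => b r (perturbed W psi r o) 0 i - g r o i) E.
Hypothesis riemann : forall i (s t : R), 0 <= s < t -> t <= tmax -> {ae P, forall o,
  (fun m => \sum_(c < 2 ^ m) ((t - s) / (2 ^ m)%:R) *
     (b (s + c.+1%:R * ((t - s) / (2 ^ m)%:R))
        (perturbed W phi (s + c.+1%:R * ((t - s) / (2 ^ m)%:R)) o) 0 i -
      g (s + c.+1%:R * ((t - s) / (2 ^ m)%:R)) o i)) @ \oo -->
  D t o 0 i - D s o 0 i}.

Let q_gt0 : (0 < q)%N. Proof. by []. Qed.
Let b0 : 0 < beta. Proof. by case/andP: b01. Qed.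

Let mD (t : R) : 0 <= t <= tmax -> vmeas (D t).
Proof.
move=> tT; have pm := past_events_measurable wW cP tT.
by apply: vmeasB; apply: vmeas_salgebra pm _; [exact: aphi|exact: apsi].
Qed.

Let ml1 (Y : T -> 'rV[R]_n) : vmeas Y -> measurable_fun setT (fun o => l1 (Y o)).
Proof.
move=> mY; apply: measurable_sum => i; apply: measurableT_comp => //; exact: mY.
Qed.

Let mesh_cvg (len a : R) : 0 < len -> 0 < a ->
  (fun m => (len / (2 ^ m)%:R) `^ a) @ \oo --> (0 : R).
Proof.
move=> len0 a0.
have -> : (fun m => (len / (2 ^ m)%:R) `^ a) = (fun m => len `^ a * (2^-1 `^ a) ^+ m).
  apply/funext => m; rewrite powRM ?invr_ge0 ?ler0n ?(ltW len0)//; congr (_ * _).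
  by rewrite natrX -exprVn -powR_mulrn ?invr_ge0// -powRrM mulrC powRrM powR_mulrn ?powR_ge0.
rewrite -[X in _ --> X](mulr0 (len `^ a)); apply: cvgM; first exact: cvg_cst.
apply: cvg_expr; rewrite ger0_norm ?powR_ge0//.
have := gt0_ltr_powR a0 (_ : 2^-1 \in Num.nneg) (_ : (1 : R) \in Num.nneg) (_ : 2^-1 < 1).
rewrite powR1; apply; rewrite ?nnegrE ?invr_ge0//.
by rewrite invf_lt1// ltr1n.
Qed.

Let S : R := sewing_const beta (4 * K) (24 * K * Lam) p.

(** Sewing controls the Riemann sums of b(r, X_r) - b(r, Y_r) uniformly in the mesh,
    and the consistency error b(r, Y_r) - g_r is summed without cancellation. *)
Lemma coordinate_increment_Lp i (s t V N0 : R) : 0 <= s < t -> t <= tmax ->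
  0 <= V -> 0 < N0 ->
  (forall r : R, s <= r <= t -> Lp P q (gap phi psi r) N0) ->
  (forall u w : R, s <= u <= w -> w <= t ->
     Lp P q (fun o => l1 (D w o - D u o)) (V * (w - u) `^ 2^-1)) ->
  Lp P q (fun o => D t o 0 i - D s o 0 i)
    (S * ((t - s) `^ 2^-1 * (1 + (t - s) `^ 2^-1)) * (V + N0) * (t - s) `^ (beta / 2) +
     (t - s) * E).
Proof.
move=> st tT V0 N00 gN dV; have /andP[s0 lt_st] := st.
have len0 : 0 < t - s by rewrite subr_gt0.
pose h m : R := (t - s) / (2 ^ m)%:R.
have pm m : 0 < (2 ^ m)%:R :> R by rewrite ltr0n expn_gt0.
have h0 m : 0 < h m by rewrite divr_gt0.
have lenE m : (2 ^ m)%:R * h m = t - s by rewrite mulrC divfK// gt_eqF.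
pose main := S * ((t - s) `^ 2^-1 * (1 + (t - s) `^ 2^-1)) * (V + N0) * (t - s) `^ (beta / 2).
pose cM := Num.sqrt (burkholder_const R p.+1 * (2 * (t - s))) * (4 * B).
pose cR := (t - s) * (2 * K * Lam `^ beta).
pose F m o := \sum_(c < 2 ^ m) h m * (b (s + c.+1%:R * h m)
   (perturbed W phi (s + c.+1%:R * h m) o) 0 i - g (s + c.+1%:R * h m) o i).
have tkT m (k : nat) : (k <= 2 ^ m)%N -> s <= s + k%:R * h m <= t.
  move=> km; rewrite lerDl mulr_ge0 ?(ltW (h0 m))//=.
  by rewrite -lerBrDl -(lenE m) ler_pM2r// ler_nat.
have tkT' m (k : nat) : (k <= 2 ^ m)%N -> 0 <= s + k%:R * h m <= tmax.
  by move=> /(tkT m)/andP[h1 h2]; rewrite (le_trans s0 h1) (le_trans h2 tT).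
have LF m : Lp P q (F m) (main + cM * h m `^ 2^-1 + cR * h m `^ beta + (t - s) * E).
  pose fr := frozen P W (fun r x => b r x 0 i) phi psi.
  have bBi := bB i; have bHi := bH i.
  have LG : Lp P q (fun o => \sum_(c < 2 ^ m) h m *
     (b (s + c.+1%:R * h m) (perturbed W psi (s + c.+1%:R * h m) o) 0 i
      - g (s + c.+1%:R * h m) o i)) ((t - s) * E).
    rewrite -(lenE m) -mulrA (_ : (2 ^ m)%:R * _ = \sum_(c < 2 ^ m) `|h m| * E); last first.
      by rewrite sumr_const card_ord (gtr0_norm (h0 m)) mulr_natl.
    by apply: Lp_sum => // c; apply: LpZ => //; apply: gLp; exact: tkT'.
  have C1 : 0 < 4 * K by rewrite mulr_gt0.
  have C2 : 0 <= 24 * K * Lam by rewrite mulr_ge0// mulr_ge0// ltW.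
  have Fmono (u v : R) (f : T -> R) : u <= v ->
      bmeas (f : pastT u -> R) -> bmeas (f : pastT v -> R).
    move=> uv [mf [c fc]]; apply: (bmeasI (B := c)) => // _ A mA.
    by rewrite setTI; apply: (past_eventsS uv); rewrite -[f @^-1` A]setTI; exact: mf.
  have rel (u r : R) o : 0 <= u <= r -> r <= tmax ->
      `|fr u r r o - fr r r r o| <= 2 * K * Lam `^ beta * (r - u) `^ beta.
    move=> ur rT; rewrite -mulrA -powRM//; last by rewrite subr_ge0; case/andP: ur.
    exact: (frozen_release P W K0 b01 bHi phiL psiL o ur rT).
  have sT : s + (2 ^ m)%:R * h m <= tmax by rewrite lenE addrC subrK.
  have gN' (k : nat) : (k <= 2 ^ m)%N -> Lp P q (gap phi psi (s + k%:R * h m)) N0.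
    by move=> km; apply: gN; exact: tkT.
  have dV' (k l : nat) : (k <= l <= 2 ^ m)%N ->
      Lp P q (fun o => l1 (D (s + l%:R * h m) o - D (s + k%:R * h m) o))
        (V * ((s + l%:R * h m) - (s + k%:R * h m)) `^ 2^-1).
    move=> /andP[kl lm]; apply: dV; last by case/andP: (tkT m l lm).
    case/andP: (tkT m k (leq_trans kl lm)) => -> _ /=.
    by rewrite lerD2l ler_wpM2r ?(ltW (h0 m))// ler_nat.
  have LS := @grid_sewing R d T P tmax beta B (4 * K) (24 * K * Lam) (2 * K * Lam `^ beta)
    (past_events P W) fr (gap phi psi) (fun u w o => l1 (D w o - D u o))
    b01 B0 C1 C2 (fun t tT => past_events_measurable wW cP tT) Fmono
    (frozen_past wW K0 b01 bBi bHi aphi apsi)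
    (fun u w r o => frozen_bounded wW K0 b01 bBi bHi phi psi u o)
    (frozen_orthogonal wW cP K0 b01 bBi bHi aphi apsi)
    (fun u w r o => frozen_gap wW K0 b01 bBi bHi phi psi u o)
    (fun u w r o => frozen_drift wW cP K0 b01 bBi bHi psi phiL o)
    (fun u o => l1_ge0 _) (fun u w o => l1_ge0 _) rel p m s (h m) V N0 s0 (h0 m) V0 N00 sT gN' dV'.
  have {}LS : Lp P q (fun o => \sum_(c < 2 ^ m) h m *
      fr (s + c.+1%:R * h m) (s + c.+1%:R * h m) (s + c.+1%:R * h m) o)
    (main + cM * h m `^ 2^-1 + cR * h m `^ beta).
    apply: (le_Lp q_gt0 LS) => //; first by case: LS.
    rewrite lenE; apply: lerD; last by rewrite /cR mulrA.
    apply: lerD; first exact: lexx.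
    have Gam0 : 0 <= burkholder_const R p.+1 by rewrite /burkholder_const mulr_ge0// exprn_ge0.
    rewrite /cM; move: (burkholder_const R p.+1) Gam0 => Gam Gam0.
    have hE : h m = Num.sqrt (h m) * Num.sqrt (h m) by rewrite -expr2 sqr_sqrtr ?(ltW (h0 m)).
    rewrite powR12_sqrt ?(ltW (h0 m))// [X in X * (4 * B)]hE.
    rewrite [leRHS](_ : _ = Num.sqrt (Gam * (2 * (t - s))) * (Num.sqrt (h m) * (4 * B))); last by ring.
    rewrite [leLHS](_ : _ = Num.sqrt (Gam * (2 ^ m).+1%:R) * Num.sqrt (h m) * (Num.sqrt (h m) * (4 * B))); last by ring.
    have B4 : 0 <= 4 * B by rewrite mulr_ge0// ltW.
    rewrite -sqrtrM; last by rewrite mulr_ge0.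
    apply: ler_wpM2r; first by rewrite mulr_ge0// sqrtr_ge0.
    apply: ler_wsqrtr; rewrite -mulrA; apply: ler_wpM2l => //.
    rewrite -(lenE m) mulrA -natrM ler_wpM2r ?(ltW (h0 m))// ler_nat mul2n -addnn -addn1 leq_add2l.
    by rewrite expn_gt0.
  apply: (le_Lp q_gt0 (LpD q_gt0 LS LG)) => //.
    apply: measurable_sum => c; apply: measurable_funM => //.
    have tc : 0 <= s + c.+1%:R * h m <= tmax by exact: tkT'.
    have Pm := past_events_measurable wW cP tc.
    rewrite (_ : (fun o => _) = fun o =>
       (b (s + c.+1%:R * h m) (perturbed W phi (s + c.+1%:R * h m) o) 0 i -
        b (s + c.+1%:R * h m) (perturbed W psi (s + c.+1%:R * h m) o) 0 i) +
       (b (s + c.+1%:R * h m) (perturbed W psi (s + c.+1%:R * h m) o) 0 i -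
        g (s + c.+1%:R * h m) o i)); last by apply/funext => o; ring.
    apply: measurable_funD; last by case: (gLp i tc).
    have mb chi : vmeas (chi (s + c.+1%:R * h m)) -> measurable_fun setT
        (fun o => b (s + c.+1%:R * h m) (perturbed W chi (s + c.+1%:R * h m) o) 0 i).
      move=> mchi; apply: (measurable_continuous_vector (g := fun x => b (s + c.+1%:R * h m) x 0 i)).
        exact: holder_continuous (bH i tc).
      by apply: vmeasD => //; exact: wiener_vmeas wW _ _.
    by apply: measurable_funB; apply: mb; apply: vmeas_salgebra Pm _; [exact: aphi|exact: apsi].
  move=> o; rewrite le_eqVlt; apply/orP; left; apply/eqP; congr (`|_|).
  rewrite /F -big_split/=; apply: eq_bigr => c _; rewrite /fr frozen_now.
  by move: (b _ _ _ _) (b _ _ _ _) (g _ _ _) => x y z; ring.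
apply: (Lp_limit q_gt0 LF).
- by apply: measurable_funB; apply: mD; rewrite ?s0 ?(le_trans s0 (ltW lt_st))// (le_trans (ltW lt_st)).
- have := riemann i st tT; apply: filterS => o; exact.
- rewrite -[X in _ --> X](_ : main + cM * 0 + cR * 0 + (t - s) * E = _); last by rewrite !mulr0 !addr0.
  apply: cvgD; last exact: cvg_cst.
  apply: cvgD; first apply: cvgD; first exact: cvg_cst.
    by apply: cvgM; [exact: cvg_cst|apply: mesh_cvg].
  by apply: cvgM; [exact: cvg_cst|apply: mesh_cvg].
Qed.

Variable l : R.
Hypotheses (l0 : 0 < l) (l1_ : l <= 1).
Hypothesis l_small : 2 * n%:R * S * l `^ (beta / 2) <= 8^-1.

Let S_ge0 : 0 <= S.
Proof.
apply: sewing_const_ge0 => //; first by rewrite mulr_gt0.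
by rewrite mulr_ge0// mulr_ge0// ltW.
Qed.

Let seminorm_on (s e V : R) := forall u w : R, s <= u <= w -> w <= e ->
  Lp P q (fun o => l1 (D w o - D u o)) (V * (w - u) `^ 2^-1).

Let half_le1 (x : R) : 0 <= x <= 1 -> 0 <= x `^ 2^-1 <= 1.
Proof.
move=> /andP[x0 x1]; rewrite powR_ge0/= powR12_sqrt// -[leRHS]sqrtr1.
exact: ler_wsqrtr.
Qed.

Let half_sqr (x : R) : 0 <= x -> x = x `^ 2^-1 * x `^ 2^-1.
Proof. by move=> x0; rewrite powR12_sqrt// -expr2 sqr_sqrtr. Qed.

(* On an interval of length at most one, the seminorm bounds the increments. *)
Let gap_in (s e V N r : R) : 0 <= s -> e <= tmax -> e - s <= 1 -> 0 <= V ->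
  Lp P q (gap phi psi s) N -> seminorm_on s e V -> s <= r <= e ->
  Lp P q (gap phi psi r) (N + V).
Proof.
move=> s0 eT se V0 gN dV /andP[sr re].
have H := dV s r (introT andP (conj (lexx s) sr)) re.
apply: (le_Lp q_gt0 (LpD q_gt0 gN H)).
- by apply: ml1; apply: mD; rewrite (le_trans s0 sr) (le_trans re).
- move=> o; rewrite !ger0_norm ?addr_ge0 ?l1_ge0// /gap.
  apply: le_trans (l1_triangle _ _); rewrite le_eqVlt; apply/orP; left; apply/eqP.
  by congr l1; apply/rowP => i; rewrite /D !mxE; ring.
- have /half_le1/andP[_ h1] : 0 <= r - s <= 1.
    by rewrite subr_ge0 sr/= (le_trans _ se)// lerD2r.
  by rewrite lerD2l -[leRHS]mulr1 ler_wpM2l.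
Qed.

(* The bound of the increment carries the power (1 + beta)/2 of its length: once the
   square root has been taken out, a factor l^(beta/2) remains, and it is small. *)
Let improve (s e V N : R) : 0 <= s -> e <= tmax -> e - s <= l -> 0 <= V -> 0 < N ->
  Lp P q (gap phi psi s) N -> seminorm_on s e V ->
  seminorm_on s e (V / 4 + N / 8 + n%:R * E).
Proof.
move=> s0 eT se V0 N0 gN dV u w /andP[su]; rewrite le_eqVlt => /predU1P[<- ue|uw we].
  rewrite subrr powR0 ?invr_neq0// mulr0.
  apply: Lp_bounded => //.
    by apply: ml1; apply: vmeasB; apply: mD; rewrite (le_trans s0 su) (le_trans ue eT).
  by move=> o; rewrite subrr (_ : l1 0 = 0) ?normr0// /l1 big1// => i _; rewrite mxE normr0.
have uT : 0 <= u < w by rewrite (le_trans s0 su).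
have wT : w <= tmax by exact: le_trans we eT.
have NV0 : 0 < N + V by rewrite ltr_wpDr.
have se1 : e - s <= 1 by exact: le_trans se l1_.
have gN' (r : R) : u <= r <= w -> Lp P q (gap phi psi r) (N + V).
  by move=> /andP[ur rw]; apply: (gap_in s0 eT se1 V0 gN dV); rewrite (le_trans su ur) (le_trans rw we).
have dV' (u' w' : R) : u <= u' <= w' -> w' <= w ->
    Lp P q (fun o => l1 (D w' o - D u' o)) (V * (w' - u') `^ 2^-1).
  by move=> /andP[h1 h2] h3; apply: dV; rewrite ?(le_trans su h1)// (le_trans h3 we).
pose c := S * ((w - u) `^ 2^-1 * (1 + (w - u) `^ 2^-1)) * (V + (N + V)) *
  (w - u) `^ (beta / 2) + (w - u) * E.
have H i : Lp P q (fun o => D w o 0 i - D u o 0 i) c.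
  exact: (coordinate_increment_Lp i uT wT V0 NV0 gN' dV').
have cle : n%:R * c <= (V / 4 + N / 8 + n%:R * E) * (w - u) `^ 2^-1.
  have wu : 0 <= w - u <= l.
    rewrite subr_ge0 (ltW uw)/= (le_trans _ se)// lerB//.
  have /andP[wu0 wul] := wu.
  have /half_le1 /andP[hl0 hl1] : 0 <= w - u <= 1 by rewrite wu0 (le_trans wul).
  rewrite /c [X in _ + X * E](half_sqr wu0); move: hl0 hl1; move: (_ `^ 2^-1) => hl hl0 hl1.
  have pw : (w - u) `^ (beta / 2) <= l `^ (beta / 2).
    by apply: ge0_ler_powR; rewrite ?nnegrE ?divr_ge0 ?(ltW b0) ?(ltW l0).
  have pw0 := powR_ge0 (w - u) (beta / 2).
  move: pw pw0 l_small S_ge0; move: (_ `^ _) (l `^ _) (S) => x y S' xy x0 y8 S0.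
  have n0 : 0 <= n%:R :> R by [].
  have e1 : 2 * n%:R * S' * x <= 8^-1.
    by apply: le_trans y8; rewrite ler_wpM2l// !mulr_ge0.
  have k0 : 0 <= n%:R * S' * x by rewrite !mulr_ge0.
  have e2 : n%:R * S' * x * (1 + hl) <= 8^-1.
    apply: le_trans e1; rewrite -[2 * _ * _ * _]mulrA -[2 * _ * _]mulrA [leRHS]mulrC mulrA.
    by rewrite ler_wpM2l// -[2]/(1 + 1) lerD2l.
  have VN : 0 <= V + (N + V) by rewrite addr_ge0// ltW.
  have -> : n%:R * (S' * (hl * (1 + hl)) * (V + (N + V)) * x + hl * hl * E) =
     hl * ((n%:R * S' * x * (1 + hl)) * (V + (N + V)) + hl * (n%:R * E)) by ring.
  rewrite [leRHS]mulrC; apply: ler_wpM2l => //; apply: lerD.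
    apply: (le_trans (ler_wpM2r VN e2)); lra.
  by rewrite -[leRHS]mul1r ler_wpM2r// mulr_ge0// ltW.
have Hs : Lp P q (fun o => \sum_(i < n) `|D w o 0 i - D u o 0 i|) (\sum_(i < n) c).
  by apply: Lp_sum => // i; apply: Lp_norm => //; exact: H.
apply: (le_Lp q_gt0 Hs).
- by apply: ml1; apply: vmeasB; apply: mD; rewrite ?(ltW (lt_le_trans uw wT)) ?wT ?andbT; 
    case/andP: uT => // h1 h2; rewrite ?(le_trans h1 (ltW h2))// h1.
- move=> o; rewrite le_eqVlt; apply/orP; left; apply/eqP; congr (`|_|).
  by apply: eq_bigr => i _; rewrite !mxE.
- apply: le_trans cle; rewrite sumr_const card_ord -[leLHS]mulr_natl; exact: lexx.
Qed.

(** Starting from the Lipschitz bound and improving forever gives a bound in terms of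
    the initial gap and the consistency error only. *)
Let close (s e N : R) : 0 <= s -> e <= tmax -> e - s <= l -> 0 < N ->
  Lp P q (gap phi psi s) N -> seminorm_on s e (N / 4 + 2 * (n%:R * E)).
Proof.
move=> s0 eT se N0 gN.
pose V0 := 2 * Lam; pose lim := N / 4 + 2 * (n%:R * E).
have nE : 0 <= n%:R * E by rewrite mulr_ge0// ltW.
have V00 : 0 <= V0 by rewrite mulr_ge0.
have it k : seminorm_on s e (V0 * 4^-1 ^+ k + lim).
  elim: k => [|k ih] u w suw we.
    have /andP[su uw] := suw.
    have uT : 0 <= u <= tmax by rewrite (le_trans s0 su) (le_trans uw (le_trans we eT)).
    have wT : 0 <= w <= tmax by rewrite (le_trans s0 (le_trans su uw)) (le_trans we eT).
    apply: Lp_bounded => //; first by apply: ml1; apply: vmeasB; exact: mD.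
    move=> o; rewrite ger0_norm ?l1_ge0// expr0 mulr1.
    have h1 := phiL o uT wT; have h2 := psiL o uT wT.
    have -> : D w o - D u o = (phi w o - phi u o) + - (psi w o - psi u o).
      by apply/rowP => i; rewrite /D !mxE; ring.
    apply: (le_trans (l1_triangle _ _)); rewrite l1N.
    apply: (le_trans (lerD h1 h2)); rewrite ger0_norm ?subr_ge0//.
    have wu : 0 <= w - u <= 1.
      by rewrite subr_ge0 uw/= (le_trans _ l1_)// (le_trans _ se)// lerB.
    have /andP[hl0 hl1] := half_le1 wu; case/andP: wu => wu0 _.
    have -> : Lam * (w - u) + Lam * (w - u) = V0 * (w - u) `^ 2^-1 * (w - u) `^ 2^-1.
      by rewrite {1 2}(half_sqr wu0) /V0; ring.
    apply: ler_wpM2r => //; apply: (@le_trans _ _ V0).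
      by rewrite -[leRHS]mulr1 ler_wpM2l.
    by rewrite lerDl /lim addr_ge0 ?divr_ge0 ?(ltW N0)// mulr_ge0.
  have V1 : 0 <= V0 * 4^-1 ^+ k + lim.
    by rewrite addr_ge0 ?mulr_ge0 ?exprn_ge0 ?invr_ge0// addr_ge0 ?divr_ge0 ?(ltW N0)// mulr_ge0.
  have H := improve s0 eT se V1 N0 gN ih suw we.
  apply: (le_Lp q_gt0 H) => //; first by case: H.
  apply: ler_wpM2r; first exact: powR_ge0.
  rewrite exprS /lim; move: (V0) (4^-1 ^+ k) (n%:R * E) nE => a c f f0.
  by move: (a * c) (mulrCA a 4^-1 c) => z ->; lra.
move=> u w suw we; apply: (Lp_limit q_gt0 (fun k => it k u w suw we)).
- by case: (it 0%N u w suw we).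
- by apply: aeW => o; exact: cvg_cst.
- apply: cvgM; last exact: cvg_cst.
  rewrite -[X in _ --> X](add0r lim); apply: cvgD; last exact: cvg_cst.
  rewrite -[X in _ --> X](mulr0 V0); apply: cvgM; first exact: cvg_cst.
  by apply: cvg_expr; rewrite ger0_norm ?invr_ge0// invf_lt1// ltr1n.
Qed.

(** Since 5/4 N + 2 n E <= 2 N as soon as N >= 3 n E, each step of length [l] at most
    doubles the bound. *)
Let gap_grid (j : nat) (r : R) : 0 <= r <= tmax -> r <= j%:R * l ->
  Lp P q (gap phi psi r) (2 ^+ j * (1 + 3 * n%:R) * E).
Proof.
elim: j r => [|j ih] r /andP[r0 rT] rj.
  have -> : r = 0 by apply/eqP; rewrite eq_le r0 andbT (le_trans rj)// mul0r.
  apply: Lp_bounded => //; first by apply: ml1; apply: mD; rewrite lexx (le_trans r0).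
  move=> o; rewrite /gap -/(D 0 o) D0 (_ : l1 0 = 0) ?normr0; last first.
    by rewrite /l1 big1// => i _; rewrite mxE normr0.
  by rewrite !mulr_ge0 ?(ltW E0)// addr_ge0// mulr_ge0.
have [rj'|jr] := leP r (j%:R * l).
  have H := ih r (introT andP (conj r0 rT)) rj'; apply: (le_Lp q_gt0 H) => //; first by case: H.
  apply: ler_wpM2r; first exact: ltW.
  apply: ler_wpM2r; first by rewrite addr_ge0// mulr_ge0.
  by rewrite ler_eXn2l ?ltr1n.
pose s := j%:R * l.
have s0 : 0 <= s by rewrite mulr_ge0// ltW.
have sT : 0 <= s <= tmax by rewrite s0 (le_trans (ltW jr)).
have gN := ih s sT (lexx _).
set N := _ * E in gN.
have N0 : 0 < N by rewrite !mulr_gt0 ?exprn_gt0// ltr_pwDl// mulr_ge0.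
have rs : r - s <= l by rewrite lerBlDl (le_trans rj)// /s -natr1 mulrDl mul1r.
have cl := close s0 rT rs N0 gN.
have nE : 0 <= n%:R * E by rewrite mulr_ge0// ltW.
have V0 : 0 <= N / 4 + 2 * (n%:R * E) by rewrite addr_ge0 ?divr_ge0 ?(ltW N0)// mulr_ge0.
have srr : s <= r <= r by rewrite lexx (ltW jr).
have H := gap_in s0 rT (le_trans rs l1_) V0 gN cl srr.
apply: (le_Lp q_gt0 H) => //; first by case: H.
rewrite exprS; have : 3 * (n%:R * E) <= N.
  rewrite /N -mulrA -[leLHS]mul1r; apply: ler_pM => //; first by rewrite mulr_ge0.
    by rewrite exprn_ege1// ler1n.
  by rewrite mulrA ler_wpM2r ?(ltW E0)// lerDr.
have -> : 2 * 2 ^+ j * (1 + 3 * n%:R) * E = 2 * N by rewrite /N; ring.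
by move: (N) (n%:R * E) (ltW N0) => a c; lra.
Qed.

Definition gap_const : R := 2 ^+ (Num.truncn (tmax / l)).+1 * (1 + 3 * n%:R).
Definition seminorm_const : R := gap_const / 4 + 2 * n%:R + 2 * gap_const / l `^ 2^-1.

Hypothesis tmax0 : 0 < tmax.

Let gap_const0 : 0 < gap_const.
Proof. by rewrite mulr_gt0 ?exprn_gt0// ltr_pwDl// mulr_ge0. Qed.

Lemma seminorm_const_gt0 : 0 < seminorm_const.
Proof.
rewrite /seminorm_const -addrA ltr_pwDl ?divr_gt0// addr_ge0 ?mulr_ge0//.
by rewrite invr_ge0 powR_ge0.
Qed.

Lemma gap_Lp (r : R) : 0 <= r <= tmax -> Lp P q (gap phi psi r) (gap_const * E).
Proof.
move=> rT; apply: gap_grid => //; case/andP: rT => _ /le_trans; apply.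
by rewrite -ler_pdivrMr// ltW// truncnS_gt.
Qed.

(** Increments shorter than [l] follow from closing the estimate at their left end;
    for the longer ones the gaps at both ends are enough. *)
Lemma increment_Lp (u w : R) : 0 <= u <= w -> w <= tmax ->
  Lp P q (fun o => l1 (D w o - D u o)) (seminorm_const * E * (w - u) `^ 2^-1).
Proof.
move=> /andP[u0 uw] wT.
have uT : 0 <= u <= tmax by rewrite u0 (le_trans uw).
have wT' : 0 <= w <= tmax by rewrite (le_trans u0 uw).
have G0 := gap_const0.
have GE : 0 < gap_const * E by rewrite mulr_gt0.
have sl : 0 < l `^ 2^-1 by exact: powR_gt0.
have [wul|wul] := leP (w - u) l.
  have H := close u0 wT wul GE (gap_Lp uT) (introT andP (conj (lexx u) uw)) (lexx w).
  apply: (le_Lp q_gt0 H) => //; first by case: H.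
  apply: ler_wpM2r; first exact: powR_ge0.
  rewrite /seminorm_const [leRHS]mulrDl [X in X <= _](_ : _ = (gap_const / 4 + 2 * n%:R) * E); last by ring.
  by rewrite lerDl mulr_ge0 ?(ltW E0)// divr_ge0 ?(ltW sl)// mulr_ge0// ltW.
have H := LpD q_gt0 (gap_Lp wT') (gap_Lp uT).
apply: (le_Lp q_gt0 H).
- by apply: ml1; apply: vmeasB; exact: mD.
- move=> o; rewrite !ger0_norm ?addr_ge0 ?l1_ge0// /gap -/(D w o) -/(D u o).
  by apply: (le_trans (l1_triangle _ _)); rewrite l1N.
- have s1 : l `^ 2^-1 <= (w - u) `^ 2^-1.
    by apply: ge0_ler_powR; rewrite ?nnegrE ?invr_ge0 ?(ltW l0)// ?(ltW wul)// subr_ge0.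
  apply: (@le_trans _ _ (2 * gap_const / l `^ 2^-1 * E * (w - u) `^ 2^-1)).
    rewrite (_ : _ + _ = 2 * gap_const / l `^ 2^-1 * E * l `^ 2^-1); last by field; rewrite gt_eqF.
    by rewrite ler_wpM2l// mulr_ge0 ?(ltW E0)// divr_ge0 ?(ltW sl)// mulr_ge0// ltW.
  rewrite ler_wpM2r ?powR_ge0// ler_wpM2r ?(ltW E0)// lerDr addr_ge0 ?mulr_ge0//.
Qed.

End closing.

(** * The consistency error of the Euler scheme *)

Section wiener_moments.
Context (R : realType) (n : nat) d (T : measurableType d) (P : probability T R).
Context (tmax : R) (W : R -> T -> 'rV[R]_n).
Hypothesis wW : wiener_process P tmax W.

Definition gauss_const (k : nat) : R := 2 * (k%:R ^+ k * expR 2^-1).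

Lemma gauss_const_ge1 k : (0 < k)%N -> 1 <= gauss_const k.
Proof.
move=> k0; have h1 : 1 <= k%:R ^+ k * expR 2^-1 :> R.
  rewrite -[leLHS]mul1r; apply: ler_pM => //; first by rewrite exprn_ege1// ler1n.
  by rewrite -expR0 ler_expR invr_ge0.
by rewrite /gauss_const; move: h1; move: (_ * expR _) => x; lra.
Qed.

(** The Gaussian moment is at most G times the k-th power of the standard deviation,
    and G <= G ^ k. *)
Lemma wiener_increment_Lp (k : nat) (s r : R) i : (0 < k)%N -> 0 <= s <= r -> r <= tmax ->
  Lp P k (fun o => W r o 0 i - W s o 0 i) (gauss_const k * Num.sqrt (r - s)).
Proof.
move=> k0 /andP[s0]; rewrite le_eqVlt => /predU1P[<- sT|sr rT].
  apply: Lp_bounded => // [|o]; last by rewrite !subrr sqrtr0 mulr0 normr0.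
  by rewrite (_ : (fun o => _) = cst 0)//; apply/funext => o; rewrite subrr.
have sq0 : 0 < Num.sqrt (r - s) by rewrite sqrtr_gt0 subr_gt0.
have mf : measurable_fun setT (fun o => W r o 0 i - W s o 0 i).
  by apply: measurable_funB; apply: (wiener_measurable wW);
    rewrite ?s0 ?(le_trans s0 (ltW sr)) ?rT// (le_trans (ltW sr)).
have G1 := gauss_const_ge1 k0.
have G0 : 0 <= gauss_const k := le_trans ler01 G1.
apply: moment_Lp => //; first by rewrite mulr_ge0// ltW.
set sg := Num.sqrt (r - s) in sq0 *.
pose h (x : R) : \bar R := ((`|x| / sg) ^+ k)%:E.
have mh : measurable_fun [set: measurableTypeR R] h.
  have mh' : measurable_fun [set: R] (fun x : R => (`|x| / sg) ^+ k).
    apply: measurable_funX; apply: measurable_funM; last exact: measurable_cst.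
    exact: normr_measurable.
  exact/measurable_EFinP.
pose Y o : R := W r o 0 i - W s o 0 i.
have E1 : (\int[P]_o h (Y o) = \int[normal_prob 0 sg]_x h x)%E.
  have mf' : measurable_fun setT (Y : T -> measurableTypeR R) := mf.
  pose mixin := isMeasurableFun.Build _ _ _ _ _ mf'.
  pose Y' : {mfun T >-> measurableTypeR R} := HB.pack Y mixin.
  transitivity (\int[distribution P Y']_y h y)%E.
    apply/esym/ge0_integral_pushforward => //= x.
    by rewrite lee_fin exprn_ge0// divr_ge0// ltW.
  by apply: eq_measure_integral => A mA _; exact: (wiener_gaussian wW i s0 sr rT mA).
have E2 : (\int[P]_o (`|Y o| `^ k%:R)%:E =
    (sg ^+ k)%:E * \int[P]_o h (Y o))%E.
  rewrite -ge0_integralZl_EFin//.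
  - apply: eq_integral => o _; rewrite -EFinM powR_mulrn//; congr EFin.
    by rewrite expr_div_n mulrC divfK// expf_neq0// gt_eqF.
  - by move=> o _; rewrite lee_fin exprn_ge0// divr_ge0// ltW.
  - exact: measurableT_comp mh mf.
  - by rewrite exprn_ge0// ltW.
rewrite E2 E1 powR_mulrn ?mulr_ge0 ?(ltW sq0)// exprMn EFinM muleC.
apply: lee_wpmul2r; first by rewrite lee_fin exprn_ge0// ltW.
apply: (le_trans (normal_moment sq0 k0)); rewrite lee_fin -/(gauss_const k).
by apply: ler_eXnr.
Qed.

End wiener_moments.

Section consistency.
Context (R : realType) (n : nat) d (T : measurableType d) (P : probability T R).
Context (tmax : R) (W : R -> T -> 'rV[R]_n).
Hypotheses (wW : wiener_process P tmax W) (cP : measure_is_complete P).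
Variables (b : R -> 'rV[R]_n -> 'rV[R]_n) (K beta eta Lam : R) (N : nat).
Hypotheses (tmax0 : 0 < tmax) (N0 : (0 < N)%N).
Hypotheses (K0 : 0 < K) (b01 : 0 < beta < 1) (eta1 : 2^-1 <= eta) (Lam0 : 0 <= Lam).
Hypothesis bH : forall i (t : R), 0 <= t <= tmax -> holder K beta (fun x => b t x 0 i).
Hypothesis bT : forall i (t s : R) x, 0 <= t <= tmax -> 0 <= s <= tmax ->
  `|b t x 0 i - b s x 0 i| <= K * `|t - s| `^ eta.
Variable psi : R -> T -> 'rV[R]_n.
Hypothesis mpsi : forall t : R, 0 <= t <= tmax -> vmeas (psi t).
Hypothesis psiL : forall (s t : R) o, 0 <= s <= tmax -> 0 <= t <= tmax ->
  l1 (psi t o - psi s o) <= Lam * `|t - s|.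

Let b0 : 0 < beta. Proof. by case/andP: b01. Qed.
Let b1 : beta < 1. Proof. by case/andP: b01. Qed.

Let powR_le1D (y : R) : 0 <= y -> y `^ beta <= 1 + y.
Proof.
move=> y0; have [y1|y1] := leP y 1.
  apply: (@le_trans _ _ (1 `^ beta)); last by rewrite powR1 lerDl.
  by apply: ge0_ler_powR; rewrite ?nnegrE// ltW.
by rewrite (le_trans (ler1_powR (ltW y1) (ltW b1)))// lerDr.
Qed.

Definition consistency_const (k : nat) : R :=
  K * tmax `^ eta + K * tmax `^ (beta / 2) *
    (1 + (n%:R * gauss_const R k * Num.sqrt tmax + Lam * tmax) / Num.sqrt tmax).

Lemma consistency_const_gt0 k : (0 < k)%N -> 0 < consistency_const k.
Proof.
move=> k0; have G0 : 0 <= gauss_const R k := le_trans ler01 (gauss_const_ge1 R k0).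
rewrite /consistency_const ltr_pwDl ?mulr_gt0 ?powR_gt0//.
rewrite mulr_ge0 ?mulr_ge0 ?powR_ge0 ?(ltW K0)// addr_ge0// divr_ge0 ?sqrtr_ge0//.
by rewrite addr_ge0 ?mulr_ge0 ?sqrtr_ge0 ?(ltW tmax0).
Qed.

(** Over one Euler step the noise moves by the square root of the step, which the drift
    sees with exponent beta; the modulus in time is at most as large since eta >= 1/2. *)
Lemma consistency_Lp (k : nat) (r : R) i : (0 < k)%N -> 0 <= r <= tmax ->
  Lp P k (fun o => b r (perturbed W psi r o) 0 i -
      b (eta_n tmax N r) (perturbed W psi (eta_n tmax N r) o) 0 i)
    (consistency_const k * N%:R `^ (- (beta / 2))).
Proof.
move=> k0 rT; have /andP[r0 rT'] := rT.
have uT := euler_floor_in tmax0 N0 rT.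
have ur := euler_floor_le tmax0 N0 r0.
have urg := euler_floor_gap tmax0 N0 r0.
set u := eta_n tmax N r in uT ur urg *.
set tau := tmax / N%:R in urg.
have N0' : 0 < N%:R :> R by rewrite ltr0n.
have N1 : 1 <= N%:R :> R by rewrite ler1n.
have tau0 : 0 < tau by rewrite divr_gt0.
have st0 : 0 < Num.sqrt tau by rewrite sqrtr_gt0.
have G0 : 0 <= gauss_const R k := le_trans ler01 (gauss_const_ge1 R k0).
pose c1 := K * tau `^ (beta / 2) / Num.sqrt tau.
pose c0 := K * tau `^ eta + K * tau `^ (beta / 2) * (1 + Lam * tau / Num.sqrt tau).
pose dW o := \sum_(j < n) `|W r o 0 j - W u o 0 j|.
have ru0 : 0 <= u <= r by case/andP: uT => -> _.
have LdW : Lp P k dW (n%:R * (gauss_const R k * Num.sqrt tau)).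
  have H : Lp P k dW (\sum_(j < n) gauss_const R k * Num.sqrt (r - u)).
    by apply: Lp_sum => // j; apply: Lp_norm => //; exact: (wiener_increment_Lp wW).
  apply: (le_Lp k0 H) => //; first by case: H.
  rewrite sumr_const card_ord -[leLHS]mulr_natl; apply: ler_wpM2l => //.
  by apply: ler_wpM2l => //; exact: ler_wsqrtr.
have c00 : 0 <= c0.
  rewrite /c0 addr_ge0 ?mulr_ge0 ?powR_ge0 ?(ltW K0)// addr_ge0// divr_ge0 ?(ltW st0)//.
  by rewrite mulr_ge0// ltW.
have c10 : 0 <= c1 by rewrite divr_ge0 ?(ltW st0)// mulr_ge0 ?powR_ge0// ltW.
have H := LpD k0 (Lp_cst P k0 c00) (LpZ k0 c1 LdW).
have mb (t : R) : 0 <= t <= tmax ->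
    measurable_fun setT (fun o => b t (perturbed W psi t o) 0 i).
  move=> tT; apply: (measurable_continuous_vector (g := fun x => b t x 0 i)).
    exact: holder_continuous (bH i tT).
  by apply: vmeasD; [exact: wiener_vmeas wW _ tT|exact: mpsi].
apply: (le_Lp k0 H).
- by apply: measurable_funB; exact: mb.
- move=> o; have dW0 : 0 <= dW o by exact: sumr_ge0.
  rewrite [leRHS]ger0_norm; last by rewrite addr_ge0// mulr_ge0.
  rewrite (_ : _ - _ = (b r (perturbed W psi r o) 0 i - b u (perturbed W psi r o) 0 i) +
    (b u (perturbed W psi r o) 0 i - b u (perturbed W psi u o) 0 i)); last by ring.
  rewrite (le_trans (ler_normD _ _))//.
  have e1 : `|b r (perturbed W psi r o) 0 i - b u (perturbed W psi r o) 0 i| <= K * tau `^ eta.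
    apply: (le_trans (bT i _ rT uT)); rewrite ler_pM2l// ger0_norm ?subr_ge0//.
    apply: ge0_ler_powR; rewrite ?nnegrE ?subr_ge0 ?(ltW tau0)//.
    by apply: le_trans eta1; rewrite invr_ge0.
  have e2 : l1 (perturbed W psi r o - perturbed W psi u o) <= dW o + Lam * tau.
    rewrite (_ : _ - _ = (W r o - W u o) + (psi r o - psi u o)); last first.
      by apply/rowP => j; rewrite /perturbed !mxE; ring.
    apply: (le_trans (l1_triangle _ _)); apply: lerD.
      by rewrite le_eqVlt; apply/orP; left; apply/eqP; apply: eq_bigr => j _; rewrite !mxE.
    apply: (le_trans (psiL o uT rT)); rewrite ger0_norm ?subr_ge0//; exact: ler_wpM2l.
  (* The increment is compared with its typical size, the square root of the step. *)
  have e3 : l1 (perturbed W psi r o - perturbed W psi u o) `^ beta <=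
      tau `^ (beta / 2) * (1 + (dW o + Lam * tau) / Num.sqrt tau).
    have A0 : 0 <= dW o + Lam * tau by rewrite addr_ge0// mulr_ge0// ltW.
    apply: (@le_trans _ _ ((dW o + Lam * tau) `^ beta)).
      by apply: ge0_ler_powR; rewrite ?nnegrE ?l1_ge0// ltW.
    rewrite -[X in X `^ beta <= _](divfK (lt0r_neq0 st0)) mulrC powRM ?(ltW st0)//; last first.
      by rewrite divr_ge0// ltW.
    rewrite -powR12_sqrt ?(ltW tau0)// -powRrM [2^-1 * beta]mulrC ler_wpM2l ?powR_ge0//.
    by apply: powR_le1D; rewrite divr_ge0// powR_ge0.
  have e4 := bH i uT (perturbed W psi r o) (perturbed W psi u o).
  apply: (le_trans (lerD e1 (le_trans e4 (ler_wpM2l (ltW K0) e3)))).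
  by rewrite /c0 /c1 le_eqVlt; apply/orP; left; apply/eqP; ring.
- rewrite ger0_norm//.
  have tN a : tau `^ a = tmax `^ a * N%:R `^ (- a).
    rewrite /tau powRM ?invr_ge0 ?(ltW tmax0)//; congr (_ * _).
    by rewrite -powR_inv1// -powRrM mulN1r.
  have te : tau `^ eta <= tmax `^ eta * N%:R `^ (- (beta / 2)).
    rewrite tN ler_wpM2l ?powR_ge0// ler_powR// lerN2.
    by have := b1; have := eta1; lra.
  have sN : Num.sqrt tau = Num.sqrt tmax * N%:R `^ (- 2^-1).
    by rewrite -!powR12_sqrt ?(ltW tau0) ?(ltW tmax0)// tN.
  have st : Num.sqrt tau <= Num.sqrt tmax.
    by apply: ler_wsqrtr; rewrite ler_pdivrMr// ler_peMr// (ltW tmax0).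
  have sT0 : 0 < Num.sqrt tmax by rewrite sqrtr_gt0.
  have -> : c0 + c1 * (n%:R * (gauss_const R k * Num.sqrt tau)) =
    K * tau `^ eta + K * tau `^ (beta / 2) * (1 + n%:R * gauss_const R k + Lam * Num.sqrt tau).
    have -> : Lam * Num.sqrt tau = Lam * tau / Num.sqrt tau.
      by rewrite -{2}[tau]sqr_sqrtr ?(ltW tau0)// expr2; field; rewrite gt_eqF.
    by rewrite /c0 /c1; field; rewrite gt_eqF.
  have -> : consistency_const k = K * tmax `^ eta +
      K * tmax `^ (beta / 2) * (1 + n%:R * gauss_const R k + Lam * Num.sqrt tmax).
    have -> : Lam * Num.sqrt tmax = Lam * tmax / Num.sqrt tmax.
      by rewrite -{2}[tmax]sqr_sqrtr ?(ltW tmax0)// expr2; field; rewrite gt_eqF.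
    by rewrite /consistency_const; field; rewrite gt_eqF.
  rewrite [leRHS]mulrDl; apply: lerD; first by rewrite -mulrA ler_pM2l.
  rewrite tN [K * (_ * _)]mulrA [leRHS]mulrAC; apply: ler_wpM2l.
    by rewrite !mulr_ge0 ?powR_ge0// ltW.
  by rewrite lerD2l ler_wpM2l.
Qed.

End consistency.

(** * The solution and its Euler approximation as drift perturbations of the noise *)

Section coupling.
Context (R : realType) (n : nat) d (T : measurableType d) (P : probability T R).
Context (tmax : R) (x0 : 'rV[R]_n) (W X Y : R -> T -> 'rV[R]_n).
Hypotheses (wW : wiener_process P tmax W) (cP : measure_is_complete P).
Variables (b : R -> 'rV[R]_n -> 'rV[R]_n) (B K beta eta : R) (N : nat).
Hypotheses (tmax0 : 0 < tmax) (N0 : (0 < N)%N).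
Hypotheses (B0 : 0 < B) (K0 : 0 < K) (b01 : 0 < beta < 1) (eta1 : 2^-1 <= eta).
Hypothesis bB : forall i (t : R) x, 0 <= t <= tmax -> `|b t x 0 i| <= B.
Hypothesis bH : forall i (t : R), 0 <= t <= tmax -> holder K beta (fun x => b t x 0 i).
Hypothesis bT : forall i (t s : R) x, 0 <= t <= tmax -> 0 <= s <= tmax ->
  `|b t x 0 i - b s x 0 i| <= K * `|t - s| `^ eta.
Hypothesis sX : strong_solution P tmax x0 b W X.
Hypothesis eY : euler_maruyama P tmax x0 b W N Y.
Notation pastT t := (g_sigma_algebraType (past_events P W t)).
Local Notation mu := (@lebesgue_measure R).
Local Notation euler_floor := (eta_n tmax N).

Let b0 : 0 < beta. Proof. by case/andP: b01. Qed.
Let eta0 : 0 < eta. Proof. by apply: lt_le_trans eta1; rewrite invr_gt0. Qed.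

Let rateX (o : T) i (r : R) : R := b r (X r o) 0 i.
Let rateY (o : T) i (r : R) : R := b (euler_floor r) (Y (euler_floor r) o) 0 i.

Definition regular (o : T) : Prop :=
  [/\ {within `[0, tmax], continuous (fun t => X t o)},
      forall t i, 0 <= t <= tmax -> X t o 0 i = x0 0 i
        + \int[mu]_(s in `[0, t]) (b s (X s o) 0 i) + W t o 0 i &
      forall t i, 0 <= t <= tmax -> Y t o 0 i = x0 0 i
        + \int[mu]_(s in `[0, t]) (b (eta_n tmax N s) (Y (eta_n tmax N s) o) 0 i)
        + W t o 0 i].

Lemma regular_ae : {ae P, forall o, regular o}.
Proof.
have h1 := strong_continuous sX; have h2 := strong_eq sX.
by apply: filterS3 h1 h2 eY => o c1 c2 c3; split.
Qed.

(** Outside the almost sure event the drift is set to zero, which keeps it adapted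
    because every sigma-algebra of the filtration contains the null sets. *)
Definition drift_of (Z : R -> T -> 'rV[R]_n) (t : R) (o : T) : 'rV[R]_n :=
  if `[< regular o >] then Z t o - W t o else 0.

Lemma drift_of_regular Z t o : regular o -> perturbed W (drift_of Z) t o = Z t o.
Proof.
by move=> ro; rewrite /perturbed /drift_of asboolT// addrC subrK.
Qed.

Let mrateX o i : regular o -> measurable_fun `[0, tmax] (rateX o i).
Proof.
move=> [cX _ _].
exact: (drift_along_perturbed_vmeasurable K0 b0 eta0 (bH i) (fun t s x => bT i x) cX).
Qed.

Let mrateY o i : measurable_fun `[0, tmax] (rateY o i).
Proof. exact: (euler_floor_measurable tmax0 N0 (fun u => b u (Y u o) 0 i)). Qed.

Let rateXB o i (r : R) : 0 <= r <= tmax -> `|rateX o i r| <= B.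
Proof. exact: bB. Qed.

Let rateYB o i (r : R) : 0 <= r <= tmax -> `|rateY o i r| <= B.
Proof. by move=> rT; apply: bB; exact: euler_floor_in. Qed.

Let driftX (t : R) o i : regular o -> 0 <= t <= tmax ->
  drift_of X t o 0 i = x0 0 i + \int[mu]_(r in `[0, t]) rateX o i r.
Proof.
by move=> ro tT; rewrite /drift_of asboolT// !mxE; case: ro => _ -> // _; rewrite addrK.
Qed.

Let driftY (t : R) o i : regular o -> 0 <= t <= tmax ->
  drift_of Y t o 0 i = x0 0 i + \int[mu]_(r in `[0, t]) rateY o i r.
Proof.
by move=> ro tT; rewrite /drift_of asboolT// !mxE; case: ro => _ _ -> //; rewrite addrK.
Qed.

Let lipschitz_of (Z : R -> T -> 'rV[R]_n) (rate : T -> 'I_n -> R -> R) :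
  (forall o i, regular o -> measurable_fun `[0, tmax] (rate o i)) ->
  (forall o i (r : R), 0 <= r <= tmax -> `|rate o i r| <= B) ->
  (forall (t : R) o i, regular o -> 0 <= t <= tmax ->
    drift_of Z t o 0 i = x0 0 i + \int[mu]_(r in `[0, t]) rate o i r) ->
  forall (s t : R) o, 0 <= s <= tmax -> 0 <= t <= tmax ->
  l1 (drift_of Z t o - drift_of Z s o) <= n%:R * B * `|t - s|.
Proof.
move=> mr rB dE s t o sT tT; have [ro|nro] := pselect (regular o); last first.
  rewrite /drift_of asboolF// subrr (_ : l1 0 = 0) ?mulr_ge0 ?(ltW B0)//.
  by rewrite /l1 big1// => i _; rewrite mxE normr0.
rewrite -mulrA mulr_natl -[X in _ *+ X]card_ord -sumr_const; apply: ler_sum => i _.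
rewrite mxE [X in _ + X]mxE (dE t)// (dE s)// [x0 0 i + _]addrC addrKA.
exact: (running_lipschitz (mr o i ro) (@rB o i) sT tT).
Qed.

Lemma driftX_lipschitz (s t : R) o : 0 <= s <= tmax -> 0 <= t <= tmax ->
  l1 (drift_of X t o - drift_of X s o) <= n%:R * B * `|t - s|.
Proof. exact: (lipschitz_of mrateX rateXB driftX). Qed.

Lemma driftY_lipschitz (s t : R) o : 0 <= s <= tmax -> 0 <= t <= tmax ->
  l1 (drift_of Y t o - drift_of Y s o) <= n%:R * B * `|t - s|.
Proof. exact: (lipschitz_of (fun o i _ => mrateY o i) rateYB driftY). Qed.

Lemma driftX_adapted (t : R) : 0 <= t <= tmax -> vmeas (drift_of X t : pastT t -> _).
Proof.
move=> tT i; apply: (measurable_past_ae (f := fun o => X t o 0 i - W t o 0 i)).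
  apply: measurable_funB; last by apply: measurable_past_wiener; case/andP: tT => ->/=.
  by move=> _ A mA; rewrite setTI; exact: (strong_adapted sX i tT mA).
by apply: filterS regular_ae => o ro; rewrite /drift_of asboolT// !mxE.
Qed.

(** Induction over the grid: on each step the scheme moves with a rate that is already
    known at the left endpoint. *)
Lemma driftY_adapted (t : R) : 0 <= t <= tmax -> vmeas (drift_of Y t : pastT t -> _).
Proof.
pose gp (k : nat) : R := k%:R * tmax / N%:R.
have N0' : 0 < N%:R :> R by rewrite ltr0n.
have gp0 k : 0 <= gp k by rewrite /gp divr_ge0// mulr_ge0// ltW.
suff H k : forall u : R, 0 <= u <= tmax -> u <= gp k -> vmeas (drift_of Y u : pastT u -> _).
  by move=> tT; apply: (H N) => //; case/andP: tT => _; rewrite /gp mulrAC divff ?mul1r// gt_eqF.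
elim: k => [|k ih] u uT uk.
  have u0 : u = 0 by apply/eqP; rewrite eq_le; case/andP: uT => -> _; rewrite (le_trans uk)// /gp !mul0r.
  move=> i; apply: (measurable_past_ae (f := fun=> x0 0 i)) => //.
  apply: filterS regular_ae => o ro; rewrite driftY// u0.
  by rewrite set_itv1 Rintegral_set1 addr0.
have [uk'|ku] := leP u (gp k); first exact: ih.
have /andP[u0 utT] := uT.
have kT : 0 <= gp k <= tmax by rewrite gp0 (le_trans (ltW ku)).
have mk := ih (gp k) kT (lexx _).
have mk' : vmeas (drift_of Y (gp k) : pastT u -> _).
  move=> i _ A mA; rewrite setTI; apply: (past_eventsS (ltW ku)).
  by rewrite -[_ @^-1` A]setTI; exact: mk.
move=> i; apply: (measurable_past_ae (f := fun o => drift_of Y (gp k) o 0 i +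
    b (gp k) (perturbed W (drift_of Y) (gp k) o) 0 i * (u - gp k))).
  apply: measurable_funD; first exact: mk'.
  apply: measurable_funM; last exact: measurable_cst.
  apply: (measurable_continuous_vector (g := fun x => b (gp k) x 0 i)).
    exact: holder_continuous (bH i kT).
  apply: vmeasD; last exact: mk'.
  by move=> j; apply: measurable_past_wiener; rewrite gp0 ltW.
apply: filterS regular_ae => o ro; rewrite !driftY// drift_of_regular//.
have kk : k%:R * tmax / N%:R <= u <= k.+1%:R * tmax / N%:R by rewrite (ltW ku).
have E : \int[mu]_(r in `[0, u]) rateY o i r - \int[mu]_(r in `[0, gp k]) rateY o i r =
    b (gp k) (Y (gp k) o) 0 i * (u - gp k).
  exact: (euler_floor_increment tmax0 N0 (fun v => b v (Y v o) 0 i) kk utT).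
by rewrite -E -addrA subrKC.
Qed.

Lemma drift_start o : drift_of X 0 o - drift_of Y 0 o = 0.
Proof.
have zT : 0 <= (0 : R) <= tmax by rewrite lexx ltW.
have [ro|nro] := pselect (regular o); last by rewrite /drift_of asboolF// subrr.
apply/rowP => i; rewrite mxE [X in _ + X]mxE driftX// driftY//.
by rewrite set_itv1 !Rintegral_set1 subrr mxE.
Qed.

Definition euler_rate (r : R) (o : T) (i : 'I_n) : R :=
  b (euler_floor r) (perturbed W (drift_of Y) (euler_floor r) o) 0 i.

(** The rate of the difference is bounded and jumps at most at the Euler grid. *)
Lemma drift_riemann i (s t : R) : 0 <= s < t -> t <= tmax -> {ae P, forall o,
  (fun m => \sum_(c < 2 ^ m) ((t - s) / (2 ^ m)%:R) *
     (b (s + c.+1%:R * ((t - s) / (2 ^ m)%:R))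
        (perturbed W (drift_of X) (s + c.+1%:R * ((t - s) / (2 ^ m)%:R)) o) 0 i -
      euler_rate (s + c.+1%:R * ((t - s) / (2 ^ m)%:R)) o i)) @ \oo -->
  (drift_of X t o - drift_of Y t o) 0 i - (drift_of X s o - drift_of Y s o) 0 i}.
Proof.
move=> st tT; have /andP[s0 lt_st] := st.
have sT' : 0 <= s <= tmax by rewrite s0 (le_trans (ltW lt_st)).
have tT' : 0 <= t <= tmax by rewrite (le_trans s0 (ltW lt_st)).
apply: filterS regular_ae => o ro.
pose g r := rateX o i r - rateY o i r.
have mg : measurable_fun `[0, tmax] g by apply: measurable_funB; [exact: mrateX|exact: mrateY].
have gB (r : R) : 0 <= r <= tmax -> `|g r| <= B + B.
  by move=> rT; apply: (le_trans (ler_normB _ _)); apply: lerD; [exact: rateXB|exact: rateYB].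
have gc (r : R) : s < r < t -> ~ euler_points tmax N r -> {for r, continuous g}.
  move=> /andP[sr rt] nr; have r0 := le_lt_trans s0 sr.
  have cX : {for r, continuous (rateX o i)}.
    apply: (drift_along_path_continuous_at K0 b0 eta0 (bH i) (fun t s x => bT i x)).
      by case: ro.
    by rewrite r0 (lt_le_trans rt).
  have cY : {for r, continuous (rateY o i)} :=
    @euler_floor_continuous R tmax N tmax0 N0 (fun u => b u (Y u o) 0 i) r (ltW r0) nr.
  exact: (cvgB cX cY).
have H := riemann_sum_cvg mg gB st tT (euler_points_countable tmax N) gc.
rewrite [X in _ --> X](_ : _ = \int[mu]_(r in `[0, t]) g r - \int[mu]_(r in `[0, s]) g r); last first.
  have iX (u : R) : 0 <= u <= tmax -> mu.-integrable `[0, u] (EFin \o rateX o i).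
    move=> uT; apply: (running_integrable (mrateX i ro) (@rateXB o i)) => //.
    by move=> r /=; rewrite !in_itv/= => /andP[-> /= ru]; case/andP: uT => _; exact: le_trans.
  have iY (u : R) : 0 <= u <= tmax -> mu.-integrable `[0, u] (EFin \o rateY o i).
    move=> uT; apply: (running_integrable (mrateY o i) (@rateYB o i)) => //.
    by move=> r /=; rewrite !in_itv/= => /andP[-> /= ru]; case/andP: uT => _; exact: le_trans.
  rewrite /g !RintegralB//; [|exact: iX|exact: iY|exact: iX|exact: iY].
  rewrite !mxE !driftX// !driftY//.
  move: (Rintegral _ _ _) (Rintegral _ _ _) (Rintegral _ _ _) (Rintegral _ _ _) => A1 A2 A3 A4.
  by ring.
rewrite (_ : (fun m => _) = (fun m => \sum_(c < 2 ^ m) ((t - s) / (2 ^ m)%:R) *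
     g (s + c.+1%:R * ((t - s) / (2 ^ m)%:R))))//.
apply/funext => m; apply: eq_bigr => c _.
by rewrite /euler_rate !drift_of_regular.
Qed.

End coupling.

(** * From increments to the supremum *)

Section integral_domination.
Context (R : realType) d (T : measurableType d) (P : probability T R).

(** The supremum over an uncountable set of times need not be measurable, so the
    comparison is made with the lower integral of simple functions. *)
Lemma ge0_le_integral_ae (F G : T -> \bar R) :
  (forall w, 0 <= F w)%E -> (forall w, 0 <= G w)%E -> measurable_fun setT G ->
  {ae P, forall w, (F w <= G w)%E} -> (\int[P]_w F w <= \int[P]_w G w)%E.
Proof.
move=> F0 G0 mG [A [mA A0 FGA]].
pose G' w := if w \in A then +oo%E else G w.
have FG' w : (F w <= G' w)%E.
  rewrite /G'; case: ifPn => wA; first by rewrite leey.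
  apply: contrapT => nFG; move/negP: wA; apply; rewrite inE; exact: FGA.
have G'0 w : (0 <= G' w)%E by rewrite /G'; case: ifP.
apply: (@le_trans _ _ (\int[P]_w G' w)%E).
  rewrite !ge0_integralTE//; apply: le_ereal_sup => _ [h hF <-].
  by exists h => // w; exact: le_trans (hF w) (FG' w).
rewrite le_eqVlt; apply/orP; left; apply/eqP; apply: ae_eq_integral => //.
  apply: measurable_fun_ifT => //; apply: (measurable_fun_bool true).
  rewrite setTI (_ : _ @^-1` _ = A)//; apply/seteqP; split => w /=.
    by move/set_mem.
  exact: mem_set.
exists A; split => // w /= H; apply: contrapT => nA; apply: H => _.
by rewrite /G' memNset.
Qed.

(** Where f <= a the power is at most a ^ p, and where f > a it is at most
    a ^ (p - k) f ^ k. *)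
Lemma Lp_moment_le (k : nat) (p a : R) (f : T -> R) : (0 < k)%N -> 0 < a ->
  0 <= p <= k%:R -> (forall w, 0 <= f w) -> Lp P k f a ->
  (\int[P]_w (f w `^ p)%:E <= (2 * a `^ p)%:E)%E.
Proof.
move=> k0 a0 /andP[p0 pk] f0 fa; have [mf _] := fa.
have mpow (e : R) : measurable_fun setT (fun w => (f w `^ e)%:E).
  by apply/measurable_EFinP; exact: measurableT_comp (measurable_powR e) mf.
apply: (@le_trans _ _ (\int[P]_w ((a `^ p)%:E + (a `^ (p - k%:R))%:E * (f w `^ k%:R)%:E))%E).
  apply: ge0_le_integral => //.
  - by move=> w _; rewrite lee_fin powR_ge0.
  - apply: emeasurable_funD => //; apply: emeasurable_funM => //.
  - move=> w _; rewrite -EFinM -EFinD lee_fin.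
    have [fa'|af] := leP (f w) a.
      rewrite (@le_trans _ _ (a `^ p))//; last by rewrite lerDl mulr_ge0 ?powR_ge0.
      by apply: ge0_ler_powR; rewrite ?nnegrE// ltW.
    rewrite (@le_trans _ _ (a `^ (p - k%:R) * f w `^ k%:R))//; last by rewrite lerDr powR_ge0.
    have fw0 : 0 < f w by exact: lt_trans af.
    have -> : f w `^ p = f w `^ (p - k%:R) * f w `^ k%:R.
      by rewrite -powRD ?subrK// (gt_eqF fw0) implybT.
    rewrite ler_wpM2r ?powR_ge0// -opprB !powRN lef_pV2 ?posrE ?powR_gt0//.
    by apply: ge0_ler_powR; rewrite ?nnegrE ?subr_ge0// ltW.
rewrite ge0_integralD//; last 3 first.
- by move=> w _; rewrite lee_fin powR_ge0.
- by move=> w _; rewrite mule_ge0// lee_fin powR_ge0.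
- by apply: emeasurable_funM.
rewrite integral_cst// ge0_integralZl_EFin ?powR_ge0//; last first.
  by move=> w _; rewrite lee_fin powR_ge0.
move: (@probability_setT _ _ _ P) => /= ->; rewrite mule1.
have H := Lp_moment k0 fa.
have H' : (\int[P]_w (f w `^ k%:R)%:E <= (a `^ k%:R)%:E)%E.
  apply: le_trans H; rewrite le_eqVlt; apply/orP; left; apply/eqP.
  by apply: eq_integral => w _; rewrite ger0_norm.
apply: (@le_trans _ _ ((a `^ p)%:E + (a `^ (p - k%:R))%:E * (a `^ k%:R)%:E)%E).
  by rewrite leeD2l// lee_wpmul2l// lee_fin powR_ge0.
rewrite -EFinM -EFinD lee_fin -powRD; last by rewrite (gt_eqF a0) implybT.
by rewrite subrK; move: (_ `^ _) => x; lra.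
Qed.

End integral_domination.

Section chaining.
Context (R : realType) (n : nat) (tmax : R).
Hypothesis tmax0 : 0 < tmax.

Definition dyadic (m k : nat) : R := k%:R * (tmax / (2 ^ m)%:R).

Let pm m : 0 < (2 ^ m)%:R :> R. Proof. by rewrite ltr0n expn_gt0. Qed.

Lemma dyadic_in m k : (k <= 2 ^ m)%N -> 0 <= dyadic m k <= tmax.
Proof.
move=> km; rewrite /dyadic mulr_ge0 ?divr_ge0 ?(ltW tmax0)//=.
by rewrite mulrCA ler_piMr ?(ltW tmax0)// ler_pdivrMr// mul1r ler_nat.
Qed.

Lemma dyadic_step m k : dyadic m k.+1 - dyadic m k = tmax / (2 ^ m)%:R.
Proof. by rewrite /dyadic -addn1 natrD; ring. Qed.

Lemma dyadic_double m k : dyadic m.+1 k.*2 = dyadic m k.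
Proof.
rewrite /dyadic -mul2n expnS !natrM; field; exact: lt0r_neq0.
Qed.

(** Each dyadic point is reached from its parent of the previous level in at most one
    step, and every other time is close to a dyadic point. *)
Lemma chaining_bound (x : R -> 'rV[R]_n) (M : nat -> R) (L : R) :
  x 0 = 0 ->
  (forall s t : R, 0 <= s <= tmax -> 0 <= t <= tmax -> l1 (x t - x s) <= L * `|t - s|) ->
  (forall j k, (k < 2 ^ j)%N -> l1 (x (dyadic j k.+1) - x (dyadic j k)) <= M j) ->
  0 <= L -> forall m (t : R), 0 <= t <= tmax ->
  l1 (x t) <= \sum_(j < m.+1) M j + L * (tmax / (2 ^ m)%:R).
Proof.
move=> x0 xL xM L0 m t tT.
have M0 j : 0 <= M j by apply: le_trans (l1_ge0 _) (xM j 0%N _); rewrite expn_gt0.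
have l10 : l1 (0 : 'rV[R]_n) = 0 by rewrite /l1 big1// => i _; rewrite mxE normr0.
have H k : (k <= 2 ^ m)%N -> l1 (x (dyadic m k)) <= \sum_(j < m.+1) M j.
  elim: m k => [|m ih] k km.
    rewrite big_ord_recl big_ord0 addr0; case: k km => [_|[_|//]].
      by rewrite /dyadic mul0r x0 l10.
    have := xM 0%N 0%N isT; rewrite [dyadic 0 0]/dyadic mul0r x0 subr0; exact.
  rewrite big_ord_recr/=; have [ke|ko] := boolP (~~ odd k).
    rewrite -(even_halfK ke) dyadic_double.
    have kh : (k./2 <= 2 ^ m)%N by rewrite -leq_double (even_halfK ke) -mul2n -expnS.
    by rewrite (le_trans (ih _ kh))// lerDl.
  rewrite negbK in ko; have kE := odd_halfK ko.
  have kh : (k./2 <= 2 ^ m)%N by rewrite -leq_double kE (leq_trans (leq_pred _))// -mul2n -expnS.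
  have k1 : (k.-1 < 2 ^ m.+1)%N by rewrite prednK// odd_gt0.
  have := xM m.+1 k.-1 k1; rewrite prednK ?odd_gt0// => xk.
  rewrite -[x (dyadic m.+1 k)](subrK (x (dyadic m.+1 k.-1))).
  rewrite (le_trans (l1_triangle _ _))// addrC lerD//.
  by rewrite -kE dyadic_double; exact: ih.
have /andP[t0 tT'] := tT.
pose k := Num.truncn (t * (2 ^ m)%:R / tmax).
have q0 : 0 <= t * (2 ^ m)%:R / tmax by rewrite divr_ge0 ?mulr_ge0// ltW.
have /andP[h1 h2] := truncn_itv q0.
have km : (k <= 2 ^ m)%N.
  rewrite -(ler_nat R) (le_trans h1)// ler_pdivrMr// mulrC ler_wpM2l//.
have kt : dyadic m k <= t.
  by rewrite /dyadic mulrA ler_pdivrMr// -ler_pdivlMr.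
have tk : t - dyadic m k <= tmax / (2 ^ m)%:R.
  rewrite -(dyadic_step m k) lerD2r ltW// /dyadic mulrA ltr_pdivlMr//.
  by rewrite -ltr_pdivrMr.
rewrite -[x t](subrK (x (dyadic m k))) (le_trans (l1_triangle _ _))// addrC.
apply: lerD; first exact: H.
apply: (le_trans (xL _ _ (dyadic_in km) tT)).
by rewrite ger0_norm ?subr_ge0// ler_wpM2l.
Qed.

(** The decay per level of the dyadic increments; see [level_norm_Lp]. *)
Definition chaining_ratio : R := 2 `^ (- 4^-1).

Let rho4 : chaining_ratio ^+ 4 = 2^-1.
Proof.
rewrite -powR_mulrn ?powR_ge0// -powRrM (_ : _ * _ = - 1); last by field.
by rewrite powR_inv1.
Qed.

Lemma chaining_ratio_lt1 : chaining_ratio < 1.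
Proof.
have rho0 : 0 <= chaining_ratio by exact: powR_ge0.
by rewrite -(@expr_lt1 _ 4)// rho4 invf_lt1// ltr1n.
Qed.

Context d (T : measurableType d) (P : probability T R).
Variables (p : nat) (D : R -> T -> 'rV[R]_n) (H : R).
Let q := p.+2.*2.
Hypothesis H0 : 0 < H.
Hypothesis mD : forall t : R, 0 <= t <= tmax -> vmeas (D t).
Hypothesis DH : forall u w : R, 0 <= u <= w -> w <= tmax ->
  Lp P q (fun o => l1 (D w o - D u o)) (H * (w - u) `^ 2^-1).

(** The l^q norm over the increments of level [j] dominates their maximum, and its
    q-th moment is the sum of theirs. *)
Definition level_norm (j : nat) (o : T) : R :=
  (\sum_(k < 2 ^ j) l1 (D (dyadic j k.+1) o - D (dyadic j k) o) `^ q%:R) `^ q%:R^-1.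

Let rho : R := chaining_ratio.

Let q_gt0 : 0 < q%:R :> R. Proof. by rewrite ltr0n. Qed.

Lemma level_norm_ge j k o : (k < 2 ^ j)%N ->
  l1 (D (dyadic j k.+1) o - D (dyadic j k) o) <= level_norm j o.
Proof.
move=> kj; rewrite /level_norm.
set y := l1 _.
have -> : y = (y `^ q%:R) `^ q%:R^-1.
  by rewrite -powRrM (mulfV (lt0r_neq0 q_gt0)) powRr1// l1_ge0.
apply: ge0_ler_powR; rewrite ?nnegrE ?invr_ge0 ?(ltW q_gt0) ?powR_ge0//.
  by apply: sumr_ge0 => i _; exact: powR_ge0.
by rewrite (bigD1 (Ordinal kj))//= lerDl; apply: sumr_ge0 => i _; exact: powR_ge0.
Qed.

(** The 2^j increments of length 2^-j contribute 2^j 2^(-j q / 2) to the q-th moment,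
    which is at most 2^(-j q / 4) because q >= 4. *)
Lemma level_norm_Lp j : Lp P q (level_norm j) (H * Num.sqrt tmax * rho ^+ j).
Proof.
have mterm k : (k < 2 ^ j)%N -> measurable_fun setT
    (fun o => l1 (D (dyadic j k.+1) o - D (dyadic j k) o) `^ q%:R).
  move=> kj; apply: measurableT_comp (measurable_powR q%:R) _.
  apply: measurable_sum => i; apply: measurableT_comp => //.
  have h : vmeas (fun o => D (dyadic j k.+1) o - D (dyadic j k) o).
    by apply: vmeasB; apply: mD; apply: dyadic_in => //; exact: ltnW.
  exact: h.
have msum : measurable_fun setT (fun o => \sum_(k < 2 ^ j)
    l1 (D (dyadic j k.+1) o - D (dyadic j k) o) `^ q%:R).
  by apply: measurable_sum => k; exact: mterm.
pose r := rho ^+ j.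
have rho0 : 0 < rho by exact: powR_gt0.
have r0 : 0 < r by exact: exprn_gt0.
have r1 : r <= 1 by apply: exprn_ile1; [exact: ltW|exact: ltW chaining_ratio_lt1].
have r4 : (2 ^ j)%:R * r ^+ 4 = 1.
  by rewrite natrX /r exprAC rho4 -exprMn mulfV// expr1n.
have sq : (tmax / (2 ^ j)%:R) `^ 2^-1 = Num.sqrt tmax * r ^+ 2.
  have -> : tmax / (2 ^ j)%:R = tmax * (r ^+ 2) ^+ 2.
    rewrite -exprM; congr (_ * _); apply: (mulfI (lt0r_neq0 (pm j))).
    by rewrite r4 mulfV// lt0r_neq0.
  have h0 : 0 <= tmax * (r ^+ 2) ^+ 2 by apply: mulr_ge0 (ltW tmax0) (sqr_ge0 _).
  rewrite (powR12_sqrt h0) (sqrtrM _ (ltW tmax0)) sqrtr_sqr ger0_norm//.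
  by apply: exprn_ge0; exact: ltW.
have HT : 0 <= H * Num.sqrt tmax by rewrite mulr_ge0 ?sqrtr_ge0// ltW.
apply: moment_Lp => //.
- exact: measurableT_comp (measurable_powR q%:R^-1) msum.
- by rewrite mulr_ge0// exprn_ge0// ltW.
rewrite (eq_integral (fun o => \sum_(k < 2 ^ j)
    (l1 (D (dyadic j k.+1) o - D (dyadic j k) o) `^ q%:R)%:E)%E); last first.
  move=> o _; rewrite sumEFin; congr EFin.
  rewrite ger0_norm ?powR_ge0// /level_norm -powRrM mulVf ?gt_eqF// powRr1//.
  by apply: sumr_ge0 => k _; exact: powR_ge0.
rewrite ge0_integral_sum//; last 2 first.
- by move=> k; apply/measurable_EFinP; exact: mterm.
- by move=> k o _; rewrite lee_fin powR_ge0.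
apply: (@le_trans _ _ (\sum_(k < 2 ^ j) ((H * Num.sqrt tmax * r ^+ 2) ^+ q)%:E)%E).
  apply: lee_sum => k _.
  have kj := ltn_ord k.
  have /andP[d0 _] := dyadic_in (ltnW kj).
  have /andP[_ dT] := dyadic_in kj.
  have dd : dyadic j k <= dyadic j k.+1.
    by rewrite -subr_ge0 dyadic_step divr_ge0// ltW.
  have := DH (introT andP (conj d0 dd)) dT; rewrite dyadic_step sq mulrA => /Lp_moment => /(_ isT).
  rewrite powR_mulrn; last by rewrite mulr_ge0// exprn_ge0// ltW.
  apply: le_trans; rewrite le_eqVlt; apply/orP; left; apply/eqP.
  by apply: eq_integral => o _; rewrite ger0_norm ?l1_ge0.
rewrite sumEFin lee_fin sumr_const card_ord powR_mulrn; last first.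
  by rewrite mulr_ge0// exprn_ge0// ltW.
rewrite -/r -mulr_natl; move: (H * Num.sqrt tmax) HT => A A0.
rewrite (exprMn_comm q (mulrC A _)) (exprMn_comm q (mulrC A _)) mulrCA.
rewrite ler_wpM2l ?exprn_ge0//.
have -> : (r ^+ 2) ^+ q = r ^+ 4 * r ^+ (2 * q - 4).
  by rewrite -exprM -exprD subnKC// /q !doubleS mulnS.
rewrite mulrA r4 mul1r; apply: ler_wiXn2l => //; first exact: ltW.
by rewrite /q !doubleS; lia.
Qed.

Lemma chaining_sup_Lp m : Lp P q (fun o => \sum_(j < m.+1) level_norm j o)
  (H * Num.sqrt tmax / (1 - rho)).
Proof.
have HT : 0 <= H * Num.sqrt tmax by rewrite mulr_ge0 ?sqrtr_ge0// ltW.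
have S : Lp P q (fun o => \sum_(j < m.+1) level_norm j o)
    (\sum_(j < m.+1) H * Num.sqrt tmax * rho ^+ j).
  by apply: Lp_sum => // j; exact: level_norm_Lp.
apply: (le_Lp _ S) => //; first by case: S.
rewrite -mulr_sumr ler_wpM2l// -[leRHS]mul1r ler_pdivlMr ?subr_gt0 ?chaining_ratio_lt1//.
have := subrX1 rho m.+1; rewrite -opprB => /eqP.
rewrite -[_ - 1]opprB mulNr eqr_opp => /eqP E.
rewrite mulrC -E gerBl exprn_ge0//.
exact: powR_ge0.
Qed.

End chaining.

(** * Strong rate of the Euler scheme *)

Section euler_rate_bound.
Context (R : realType) (n : nat) d (T : measurableType d) (P : probability T R).
Context (tmax : R) (x0 : 'rV[R]_n) (W X Y : R -> T -> 'rV[R]_n).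
Hypotheses (wW : wiener_process P tmax W) (cP : measure_is_complete P).
Variables (b : R -> 'rV[R]_n -> 'rV[R]_n) (B K beta eta : R) (N : nat).
Hypotheses (tmax0 : 0 < tmax) (N0 : (0 < N)%N).
Hypotheses (B0 : 0 < B) (K0 : 0 < K) (b01 : 0 < beta < 1) (eta1 : 2^-1 <= eta).
Hypothesis bB : forall i (t : R) x, 0 <= t <= tmax -> `|b t x 0 i| <= B.
Hypothesis bH : forall i (t : R), 0 <= t <= tmax -> holder K beta (fun x => b t x 0 i).
Hypothesis bT : forall i (t s : R) x, 0 <= t <= tmax -> 0 <= s <= tmax ->
  `|b t x 0 i - b s x 0 i| <= K * `|t - s| `^ eta.
Hypothesis sX : strong_solution P tmax x0 b W X.
Hypothesis eY : euler_maruyama P tmax x0 b W N Y.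
Variable p : R.
Hypothesis p1 : 1 <= p.

Let b0 : 0 < beta. Proof. by case/andP: b01. Qed.

(* Moments of order q = 2 (k + 2) with k + 1 > p: even, at least 4, at least p. *)
Let k : nat := Num.truncn p.
Let q : nat := k.+2.*2.
Let Lam : R := n%:R * B.

Let sew : R := sewing_const beta (4 * K) (24 * K * Lam) k.+1.

(** Its power beta/2 is the inverse of 16 n sew + 1, and 2 x / (16 x + 1) <= 1/8. *)
Definition step_length : R := (16 * n%:R * sew + 1) `^ (- (2 / beta)).

Definition sup_const : R :=
  seminorm_const n tmax step_length * consistency_const n tmax K beta eta Lam q *
  Num.sqrt tmax / (1 - chaining_ratio R).

(** The inner factor 2 pays for the remainder of the chaining, the outer one for
    passing from moments of order [q] to those of order [p]. *)
Definition error_const : R := 2 * (2 * sup_const) `^ p.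

Let Lam0 : 0 <= Lam. Proof. by rewrite mulr_ge0// ltW. Qed.

Let sew0 : 0 <= sew.
Proof.
apply: sewing_const_ge0 => //; first by rewrite mulr_gt0.
by rewrite mulr_ge0// mulr_ge0// ltW.
Qed.

Let base1 : 1 <= 16 * n%:R * sew + 1.
Proof. by rewrite lerDr mulr_ge0// mulr_ge0. Qed.

Let base0 : 0 < 16 * n%:R * sew + 1. Proof. exact: lt_le_trans base1. Qed.

Let l0 : 0 < step_length. Proof. exact: powR_gt0. Qed.

Let l1_ : step_length <= 1.
Proof.
rewrite /step_length powRN invf_le1 ?powR_gt0//.
rewrite -[leLHS](powRr0 (16 * n%:R * sew + 1)) ler_powR//.
by rewrite divr_ge0// ltW.
Qed.

Let l_small : 2 * n%:R * sew * step_length `^ (beta / 2) <= 8^-1.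
Proof.
have -> : step_length `^ (beta / 2) = (16 * n%:R * sew + 1)^-1.
  rewrite /step_length -powRrM (_ : - (2 / beta) * (beta / 2) = -1).
    by rewrite powR_inv1 ?(ltW base0).
  by field; exact: lt0r_neq0.
rewrite ler_pdivrMr//; move: (n%:R * sew) (mulrA 2 n%:R sew) (mulrA 16 n%:R sew) => z <- <-.
by lra.
Qed.

Let c0 : 0 < consistency_const n tmax K beta eta Lam q.
Proof. exact: consistency_const_gt0. Qed.

Let sn0 : 0 < seminorm_const n tmax step_length.
Proof. exact: seminorm_const_gt0. Qed.

Let rho1 : 0 < 1 - chaining_ratio R.
Proof. by rewrite subr_gt0; exact: chaining_ratio_lt1. Qed.

Let sup0 : 0 < sup_const.
Proof. by rewrite divr_gt0// mulr_gt0 ?sqrtr_gt0// mulr_gt0. Qed.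

Lemma error_const_gt0 : 0 < error_const.
Proof. by rewrite mulr_gt0// powR_gt0// mulr_gt0. Qed.

Lemma euler_error :
  (\int[P]_w ereal_sup [set (enorm ((X t w - Y t w) 0%R) `^ p)%:E | t in `[0%R, tmax]]
     <= (error_const / N%:R `^ (p * beta / 2))%:E)%E.
Proof.
pose phi := drift_of tmax x0 W X Y b N X.
pose psi := drift_of tmax x0 W X Y b N Y.
pose D t o := phi t o - psi t o.
pose E := consistency_const n tmax K beta eta Lam q * N%:R `^ (- (beta / 2)).
have N0' : 0 < N%:R :> R by rewrite ltr0n.
have E0 : 0 < E by rewrite mulr_gt0// powR_gt0.
have aphi : forall t : R, 0 <= t <= tmax ->
    vmeas (phi t : g_sigma_algebraType (past_events P W t) -> _).
  exact: (driftX_adapted sX eY).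
have apsi : forall t : R, 0 <= t <= tmax ->
    vmeas (psi t : g_sigma_algebraType (past_events P W t) -> _).
  exact: (driftY_adapted tmax0 N0 K0 b01 bH sX eY).
have phiL : forall (s t : R) o, 0 <= s <= tmax -> 0 <= t <= tmax ->
    l1 (phi t o - phi s o) <= Lam * `|t - s|.
  exact: (@driftX_lipschitz _ _ _ _ tmax x0 W X Y b B K beta eta N B0 K0 b01 eta1 bB bH bT).
have psiL : forall (s t : R) o, 0 <= s <= tmax -> 0 <= t <= tmax ->
    l1 (psi t o - psi s o) <= Lam * `|t - s|.
  exact: (@driftY_lipschitz _ _ _ _ tmax x0 W X Y b B N tmax0 N0 B0 bB).
have mpsi (t : R) (tT : 0 <= t <= tmax) : vmeas (psi t).
  exact: vmeas_salgebra (past_events_measurable wW cP tT) (apsi t tT).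
have mphi (t : R) (tT : 0 <= t <= tmax) : vmeas (phi t).
  exact: vmeas_salgebra (past_events_measurable wW cP tT) (aphi t tT).
have gLp : forall (r : R) i, 0 <= r <= tmax -> Lp P q
    (fun o => b r (perturbed W psi r o) 0 i - euler_rate tmax x0 W X Y b N r o i) E.
  by move=> r i rT; apply: (consistency_Lp wW tmax0 N0 K0 b01 eta1 Lam0 bH bT mpsi psiL).
pose H := seminorm_const n tmax step_length * E.
have H0 : 0 < H by rewrite mulr_gt0.
have DH : forall u w : R, 0 <= u <= w -> w <= tmax ->
    Lp P q (fun o => l1 (D w o - D u o)) (H * (w - u) `^ 2^-1).
  have rie := drift_riemann tmax0 N0 K0 b01 eta1 bB bH bT sX eY.
  have st : forall o, phi 0 o - psi 0 o = 0 by exact: drift_start.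
  move=> u w uw wT.
  exact: (increment_Lp (p := k.+1) wW cP B0 K0 b01 Lam0 bB bH aphi apsi phiL psiL E0 st gLp rie l0 l1_ l_small).
have mD (t : R) (tT : 0 <= t <= tmax) : vmeas (D t) by apply: vmeasB; [exact: mphi|exact: mpsi].
pose A := H * Num.sqrt tmax / (1 - chaining_ratio R).
have A0 : 0 < A by rewrite divr_gt0// mulr_gt0// sqrtr_gt0.
(* Enough levels for the remainder of the chaining not to exceed the main term. *)
have [m mA] : exists m : nat, (Lam + Lam) * (tmax / (2 ^ m)%:R) <= A.
  pose j := (Num.truncn ((Lam + Lam) * tmax / A)).+1; exists j.
  rewrite mulrA ler_pdivrMr ?ltr0n ?expn_gt0// -ler_pdivrMl// mulrC.
  by apply: (le_trans (ltW (truncnS_gt _))); rewrite ler_nat ltnW// ltn_expl.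
pose S o := \sum_(j < m.+1) level_norm tmax k D j o + A.
have LS : Lp P q S (A + A).
  apply: LpD => //; last exact: (Lp_cst P (isT : (0 < q)%N) (ltW A0)).
  exact: (chaining_sup_Lp tmax0 H0 mD DH m).
have S0 o : 0 <= S o.
  by rewrite addr_ge0 ?(ltW A0)//; apply: sumr_ge0 => j _; exact: powR_ge0.
have mS : measurable_fun setT (fun o => (S o `^ p)%:E).
  apply/measurable_EFinP; apply: measurableT_comp (measurable_powR p) _.
  by case: LS.
apply: (@le_trans _ _ (\int[P]_o (S o `^ p)%:E)%E).
  apply: ge0_le_integral_ae => //.
  - move=> o; apply: (@le_trans _ _ (enorm ((X 0 o - Y 0 o) 0) `^ p)%:E).
      by rewrite lee_fin powR_ge0.
    by apply: ereal_sup_ubound; exists 0 => //; rewrite /= in_itv/= lexx ltW.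
  - by move=> o; rewrite lee_fin powR_ge0.
  - apply: filterS (regular_ae sX eY) => o ro.
    apply: ub_ereal_sup => _ [t tT <-]; rewrite lee_fin.
    have {}tT : 0 <= t <= tmax by move: tT; rewrite /= in_itv.
    apply: ge0_ler_powR; rewrite ?nnegrE ?sqrtr_ge0 ?S0//; first exact: le_trans p1.
    apply: (le_trans (enorm_le_l1 _)).
    have -> : X t o - Y t o = D t o.
      by rewrite /D /phi /psi /drift_of !asboolT// opprB addrA subrK.
    have DL (s u : R) : 0 <= s <= tmax -> 0 <= u <= tmax ->
        l1 (D u o - D s o) <= (Lam + Lam) * `|u - s|.
      move=> sT uT; rewrite (_ : _ - _ = (phi u o - phi s o) + - (psi u o - psi s o)); last first.
        by apply/rowP => i; rewrite /D !mxE; ring.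
      apply: (le_trans (l1_triangle _ _)); rewrite l1N mulrDl.
      by apply: lerD; [exact: phiL|exact: psiL].
    have D0 : D 0 o = 0 by exact: drift_start.
    have LL0 : 0 <= Lam + Lam by exact: addr_ge0.
    have := chaining_bound tmax0 D0 DL (fun j i ij => @level_norm_ge R n tmax _ T k D j i o ij) LL0 m tT.
    by move/le_trans; apply; rewrite lerD2l.
have q0 : (0 < q)%N by [].
have pq : 0 <= p <= q%:R.
  rewrite (le_trans _ p1)//= (le_trans (ltW (truncnS_gt p)))// ler_nat /q -/k.
  by rewrite -addnn; apply: (@leq_trans k.+2); rewrite ?leq_addr.
have AA : 0 < A + A by rewrite addr_gt0.
apply: (le_trans (Lp_moment_le q0 AA pq S0 LS)); rewrite lee_fin.
have -> : A + A = (2 * sup_const) * N%:R `^ (- (beta / 2)).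
  by rewrite /A /H /E /sup_const; ring.
rewrite powRM ?powR_ge0//; last by rewrite mulr_ge0// ltW.
rewrite -powRrM mulNr powRN (_ : beta / 2 * p = p * beta / 2); last by ring.
by rewrite /error_const mulrA.
Qed.

End euler_rate_bound.

Theorem theorem2p11 (R : realType) (d : nat) (T : R) (x0 : 'rV[R]_d)
    (K beta eta p normb : R) (M : \bar R) :
  (0 < d)%N -> 0 < T -> 0 < K -> 0 < beta < 1 -> 2^-1 <= eta <= 1 -> 1 <= p ->
  exists C : R, 0 < C /\
  forall b : R -> 'rV[R]_d -> 'rV[R]_d,
  (exists B : R, forall t x, 0 <= t <= T -> enorm (b t x 0) <= B) ->
  (forall t x y, 0 <= t <= T ->
     enorm ((b t x - b t y) 0) <= K * enorm ((x - y) 0) `^ beta) ->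
  (forall t s x, 0 <= t <= T -> 0 <= s <= T ->
     enorm ((b t x - b s x) 0) <= K * `|t - s| `^ eta) ->
  Cb_norm beta 0 T (fun t x => b t x 0) = normb%:E ->
  second_derivative_const T beta b = M ->
  forall (disp : measure_display) (Omega : measurableType disp)
    (P : probability Omega R) (W X : R -> Omega -> 'rV[R]_d)
    (Xn : nat -> R -> Omega -> 'rV[R]_d),
  measure_is_complete P ->
  wiener_process P T W ->
  strong_solution P T x0 b W X ->
  (forall n, (0 < n)%N -> euler_maruyama P T x0 b W n (Xn n)) ->
  forall n : nat, (0 < n)%N ->
  (\int[P]_w ereal_sup [set (enorm ((X t w - Xn n t w) 0%R) `^ p)%:E
                         | t in `[0%R, T]]
     <= (C / n%:R `^ (p * beta / 2))%:E)%E.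
Proof.
move=> d0 T0 K0 b01 /andP[eta1 _] p1.
pose B := `|normb| + 1; have B0 : 0 < B by rewrite ltr_wpDl.
exists (error_const d T B K beta eta p); split; first exact: error_const_gt0.
move=> b _ bH bT bN _ disp Omega P W X Xn cP wW sX eXn n n0.
(* The Hölder part of the norm is a supremum over pairs of distinct points; it is
   nonnegative because such pairs exist in positive dimension. *)
have bB i (t : R) x : 0 <= t <= T -> `|b t x 0 i| <= B.
  move=> tT; apply: (le_trans (l1_enorm_coord _ _)).
  apply: (@le_trans _ _ normb); last by rewrite /B (le_trans (ler_norm _))// lerDl.
  rewrite -lee_fin -bN /Cb_norm -[leLHS]adde0; apply: leeD.
    by apply: ereal_sup_ubound; exists t, x.
  have x10 : (const_mx 1 : 'rV[R]_d) != 0.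
    apply/eqP => /rowP/(_ (Ordinal d0)); rewrite !mxE => /eqP.
    by rewrite oner_eq0.
  apply: (@le_trans _ _ (enorm (fun i => b t (const_mx 1) 0 i - b t 0 0 i)
            / enorm ((const_mx 1 - 0 : 'rV[R]_d) 0) `^ beta)%:E).
    by rewrite lee_fin divr_ge0 ?sqrtr_ge0 ?powR_ge0.
  by apply: ereal_sup_ubound; exists t, (const_mx 1), 0.
apply: (euler_error wW cP T0 n0 B0 K0 b01 eta1 bB _ _ sX (eXn n n0) p1).
- move=> i t tT x y; rewrite (_ : _ - _ = (b t x - b t y) 0 i); last by rewrite !mxE.
  apply: (le_trans (l1_enorm_coord _ _)); apply: (le_trans (bH t x y tT)).
  rewrite ler_pM2l//; apply: ge0_ler_powR; rewrite ?nnegrE ?sqrtr_ge0 ?l1_ge0//.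
    by case/andP: b01 => /ltW.
  exact: enorm_le_l1.
- move=> i t s x tT sT; rewrite (_ : _ - _ = (b t x - b s x) 0 i); last by rewrite !mxE.
  by apply: (le_trans (l1_enorm_coord _ _)); exact: bT.
Qed.
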